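(* (Left sketching.) Let $A\in\mathbb{R}^{n\times d}$, let $k\ge1$ satisfy $k\le\mathrm{rank}(A)$ and $\sigma_k>\sigma_{k+1}$, where $\sigma_i=\sigma_i(A)$, and let $b=f+\xi\in\mathbb{R}^n$ be as in the fixed design model. Let $\nu,\delta\in(0,1/2)$ and denote $$\epsilon=\frac{\nu(1+\nu^2)^{-1/2}}{1+\nu(1+\nu^2)^{-1/2}}\cdot\mathrm{gap}_k(A).$$ Suppose that $S$ is sampled (independently of $b$) from a distribution that has the $(\epsilon,\delta)$-approximate Gram matrix property for $A$. Then for $R=V_{SA,k}$, with probability at least $1-\delta$ over $S$, the approximate solution $x_R$ is a $$\left(\frac{\sigma_{k+1}}{\sigma_k}\nu,\ \frac{\nu}{\left(\sqrt{1-\nu^2}-\nu\right)\sigma_k}\right)\text{-approximate PCR of rank }k$$ and $$\mathcal{E}(x_R)\le\frac{(1+\nu)\,\|x^\star\|_2^2\,\sigma_{k+1}^2}{n}+\frac{\sigma^2k}{n}.$$ Moreover, the condition on $S$ is met if $S$ is a CountSketch matrix with $\Omega\!\left(\frac{\mathrm{sr}(A)^2}{\mathrm{gap}_k(A)^2\nu^2\delta}\right)$ rows, and also if $S$ is a subgaussian map with $\Omega\!\left(\frac{\mathrm{sr}(A)+\log(1/\delta)}{\mathrm{gap}_k(A)^2\nu^2}\right)$ rows.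
   Context: $\|\cdot\|_2$ is the Euclidean/spectral norm. $\sigma_1(X)\ge\sigma_2(X)\ge\cdots$ are the singular values of $X$ (with $\sigma_{k+1}$ read as $0$ if $k$ equals the smaller dimension). For $X\in\mathbb{R}^{m\times n}$ with thin SVD $X=U_X\Sigma_XV_X^{T}$, $V_{X,k}$ is the first $k$ columns of $V_X$ and $V_{X,k+}$ the last $\min(m,n)-k$ columns; statements are meant for any such decomposition. $\mathrm{gap}_k(X)=(\sigma_k(X)^2-\sigma_{k+1}(X)^2)/\sigma_1(X)^2$ is the relative gap and $\mathrm{sr}(X)=\|X\|_F^2/\|X\|_2^2$ the stable rank. $X^{+}$ is the Moore–Penrose pseudo-inverse and $P_X$ the orthogonal projection onto the column space of $X$. $x_k=\arg\min_{x\in\mathrm{range}(V_{A,k})}\|Ax-b\|_2$ and $x_R=R(AR)^{+}b$. A vector $\tilde x\in\mathbb{R}^d$ is an $(\epsilon',\upsilon)$-approximate PCR of rank $k$ if $\big|\,\|A\tilde x-b\|_2-\|Ax_k-b\|_2\big|\le\epsilon'\|b\|_2$ and $\|V_{A,k+}^{T}\tilde x\|_2\le\upsilon\|b\|_2$. For a fixed $X\in\mathbb{R}^{m\times n}$ and $\epsilon,\delta\in(0,1/2)$, a distribution $\mathcal{D}$ on matrices with $m$ columns has the $(\epsilon,\delta)$-approximate Gram matrix property for $X$ if $\Pr_{S\sim\mathcal{D}}\big(\|X^{T}S^{T}SX-X^{T}X\|_2\ge\epsilon\|X\|_2^2\big)\le\delta$. Fixed design model: $A$ and $f\in\mathbb{R}^n$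 are fixed, $b=f+\xi$ where the entries of $\xi$ are independent with mean $0$ and variance $\sigma^2$. $x^\star$ is the minimum-norm minimizer of $\mathbb{E}[\|Ax-b\|_2^2/n]$ (so $Ax^\star=P_Af$). $\mathcal{E}(\theta)=\mathbb{E}[\|A\theta-Ax^\star\|_2^2/n]$, with expectation over $\xi$ only (the sketch $S$ being held fixed). A CountSketch matrix is a random matrix whose columns are independent, each being a uniformly random standard basis vector multiplied by an independent uniform random sign. A subgaussian map with $s$ rows is a random matrix whose entries are $s^{-1/2}$ times i.i.d. samples from a mean-zero, unit-variance subgaussian distribution (e.g. $N(0,1)$). ''$\Omega(\cdot)$ rows'' means at least a sufficiently large constant (absolute for CountSketch, depending only on the subgaussian distribution for subgaussian maps) times the quantity in parentheses. *)

(* Defs.v *)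
From HB Require Import structures.
From mathcomp Require Import all_boot all_order all_algebra.
From mathcomp Require Import all_classical all_reals all_analysis.

Set Implicit Arguments.
Unset Strict Implicit.
Unset Printing Implicit Defensive.

Import Order.TTheory GRing.Theory Num.Theory.
Import numFieldNormedType.Exports.

Local Open Scope classical_set_scope.
Local Open Scope ring_scope.

Section linear_algebra.
Context {R : realType}.

Definition norm2 n (v : 'cV[R]_n) : R := Num.sqrt (\sum_i v i 0 ^+ 2).

Definition spectral_norm m n (X : 'M[R]_(m, n)) : R :=
  sup [set norm2 (X *m v) | v in [set v : 'cV[R]_n | norm2 v <= 1]].

Definition frobenius m n (X : 'M[R]_(m, n)) : R :=
  Num.sqrt (\sum_i \sum_j X i j ^+ 2).

Definition thin_svd m n (X : 'M[R]_(m, n)) (U : 'M[R]_(m, minn m n))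
    (s : 'rV[R]_(minn m n)) (V : 'M[R]_(n, minn m n)) : Prop :=
  [/\ U^T *m U = 1%:M, V^T *m V = 1%:M, (forall i, 0 <= s 0 i),
      (forall i j : 'I_(minn m n), (i <= j)%N -> s 0 j <= s 0 i) &
      X = U *m diag_mx s *m V^T].

(* Every X has a thin SVD, and all its thin SVDs have the same diagonal, so
   the value chosen by xget is determined by X. *)
Definition singular_values m n (X : 'M[R]_(m, n)) : 'rV[R]_(minn m n) :=
  xget 0 [set s | exists U V, thin_svd X U s V].

(* Numbered from 1, and 0 beyond the smaller dimension (the index i = 0 is
   meaningless). *)
Definition sigma m n (X : 'M[R]_(m, n)) (i : nat) : R :=
  oapp (singular_values X 0) 0 (insub i.-1).

Definition gap m n (k : nat) (X : 'M[R]_(m, n)) : R :=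
  (sigma X k ^+ 2 - sigma X k.+1 ^+ 2) / sigma X 1 ^+ 2.

Definition stable_rank m n (X : 'M[R]_(m, n)) : R :=
  frobenius X ^+ 2 / spectral_norm X ^+ 2.

(* The first k columns of V when k <= r; padded with zero columns otherwise. *)
Definition first_cols n r (k : nat) (V : 'M[R]_(n, r)) : 'M[R]_(n, k) :=
  V *m pid_mx k.

Lemma last_cols_subproof r k (j : 'I_(r - k)) : (k + j < r)%N.
Proof. by rewrite -ltn_subRL. Qed.

Definition last_cols n r (k : nat) (V : 'M[R]_(n, r)) : 'M[R]_(n, r - k) :=
  colsub (fun j => Ordinal (last_cols_subproof j)) V.

Definition penrose m n (X : 'M[R]_(m, n)) (Y : 'M[R]_(n, m)) : Prop :=
  [/\ X *m Y *m X = X, Y *m X *m Y = Y,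
      (X *m Y)^T = X *m Y & (Y *m X)^T = Y *m X].

Definition pinv m n (X : 'M[R]_(m, n)) : 'M[R]_(n, m) :=
  xget 0 [set Y | penrose X Y].

(* The argmin of ||A x - b|| over range(V_k), where V is the right factor of
   a thin SVD of A; it is unique when k <= rank A. *)
Definition pcr_solution n d r (A : 'M[R]_(n, d)) (V : 'M[R]_(d, r)) (k : nat)
    (b : 'cV[R]_n) : 'cV[R]_d :=
  xget 0 [set x | (exists y, x = first_cols k V *m y) /\
    forall y, norm2 (A *m x - b) <= norm2 (A *m (first_cols k V *m y) - b)].

Definition sketched_solution n d t (A : 'M[R]_(n, d)) (M : 'M[R]_(d, t))
    (b : 'cV[R]_n) : 'cV[R]_d :=
  M *m pinv (A *m M) *m b.

(* V is the right factor of a thin SVD of A. *)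
Definition approx_pcr n d r (A : 'M[R]_(n, d)) (V : 'M[R]_(d, r)) (k : nat)
    (b : 'cV[R]_n) (eps ups : R) (x : 'cV[R]_d) : Prop :=
  `|norm2 (A *m x - b) - norm2 (A *m pcr_solution A V k b - b)|
    <= eps * norm2 b /\
  norm2 ((last_cols k V)^T *m x) <= ups * norm2 b.

Definition sketch_accuracy n d (A : 'M[R]_(n, d)) (k : nat) (nu : R) : R :=
  let c := nu * (Num.sqrt (1 + nu ^+ 2))^-1 in c / (1 + c) * gap k A.

End linear_algebra.

Section probability.
Context d {T : measurableType d} {R : realType} (P : probability T R).

(* Since some B i may be setT, this is the product rule over all subfamilies. *)
Definition mutually_independent (I : finType) (X : I -> {RV P >-> R}) : Prop :=
  forall B : I -> set R, (forall i, measurable (B i)) ->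
    P [set w | forall i, B i (X i w)] =
    (\prod_i P [set w | B i (X i w)])%E.

Definition random_matrix (s n : nat) : Type := 'I_s -> 'I_n -> {RV P >-> R}.

Definition mx_at s n (S : random_matrix s n) (w : T) : 'M[R]_(s, n) :=
  \matrix_(i, j) S i j w.

(* Inner form, since Ev need not be measurable a priori. *)
Definition with_prob_ge (p : R) (Ev : set T) : Prop :=
  exists E : set T, [/\ measurable E, E `<=` Ev & (p%:E <= P E)%E].

(* Stated without 0 < eps < 1/2 and 0 < delta < 1/2; sketch_accuracy is below
   1/2 when 0 < nu < 1/2. *)
Definition gram_property s m n (S : random_matrix s m) (X : 'M[R]_(m, n))
    (eps delta : R) : Prop :=
  (P [set w | (eps * spectral_norm X ^+ 2 <=
       spectral_norm (X^T *m (mx_at S w)^T *m mx_at S w *m X - X^T *m X))%R]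
   <= delta%:E)%E.

(* The boxes \prod_i B i j form a pi-system generating the Borel sets of R^s,
   so this is independence of the column vectors. *)
Definition independent_columns s n (S : random_matrix s n) : Prop :=
  forall B : 'I_s -> 'I_n -> set R, (forall i j, measurable (B i j)) ->
    P [set w | forall j i, B i j (S i j w)] =
    (\prod_j P [set w | forall i, B i j (S i j w)])%E.

(* s^-1 is the probability of the basis vector and 2^-1 that of the sign. *)
Definition countsketch s n (S : random_matrix s n) : Prop :=
  [/\ (0 < s)%N, independent_columns S &
      forall (j : 'I_n) (i : 'I_s) (e : bool),
        P [set w | col j (mx_at S w) = (-1) ^+ e *: delta_mx i 0] =
        (s%:R^-1 * 2^-1)%:E].

Definition iid_scaled_entries (Q : probability (measurableTypeR R) R) s n
    (S : random_matrix s n) : Prop :=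
  exists Y : 'I_s * 'I_n -> {RV P >-> R},
    [/\ mutually_independent Y,
        forall ij B, measurable B -> P (Y ij @^-1` B) = Q B &
        forall i j w, S i j w = (Num.sqrt s%:R)^-1 * Y (i, j) w].

(* Zero mean and finite variance force xi i to be square integrable: the
   library's integrals would otherwise be infinite. *)
Definition white_noise n (xi : 'I_n -> {RV P >-> R}) (sd : R) : Prop :=
  [/\ mutually_independent xi,
      forall i, ('E_P[xi i] = 0)%E & forall i, ('V_P[xi i] = (sd ^+ 2)%:E)%E].

Definition response n (f : 'cV[R]_n) (xi : 'I_n -> {RV P >-> R}) (w : T) :
  'cV[R]_n := \col_i (f i 0 + xi i w).

Definition mean_loss n d (A : 'M[R]_(n, d)) (b : T -> 'cV[R]_n)
    (x : 'cV[R]_d) : \bar R :=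
  'E_P[fun w => (norm2 (A *m x - b w) ^+ 2 / n%:R)%R]%E.

(* The minimizer of least Euclidean norm; it is unique. *)
Definition min_norm_optimum n d (A : 'M[R]_(n, d)) (b : T -> 'cV[R]_n) :
    'cV[R]_d :=
  xget 0 [set x | (forall y, mean_loss A b x <= mean_loss A b y)%E /\
    forall y, (forall z, mean_loss A b y <= mean_loss A b z)%E ->
      norm2 x <= norm2 y].

Definition excess_risk n d (A : 'M[R]_(n, d)) (b : T -> 'cV[R]_n)
    (theta : T -> 'cV[R]_d) : \bar R :=
  'E_P[fun w => (norm2 (A *m theta w - A *m min_norm_optimum A b) ^+ 2
                 / n%:R)%R]%E.

End probability.

Definition subgaussian {R : realType} (Q : probability (measurableTypeR R) R) :
    Prop :=
  exists2 K : R, 0 < K & forall t : R, 0 <= t ->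
    (Q [set x | (t <= `|x|)%R] <= (2 * expR (- (t ^+ 2 / K ^+ 2)))%:E)%E.

Definition standard_subgaussian {R : realType}
    (Q : probability (measurableTypeR R) R) : Prop :=
  [/\ ('E_Q[idfun] = 0)%E, ('V_Q[idfun] = 1)%E & subgaussian Q].

(* Main.v *)
(* Deterministic part: if the Gram matrices are eps-close then, by Weyl and a
   Davis-Kahan argument, the top k right singular subspaces make an angle of sine
   at most c = nu / sqrt (1 + nu^2), i.e. tangent at most nu; both the PCR bounds and
   the bias are read off from this angle, and the variance is the trace of a rank-k
   projection.
   CountSketch: the law of S is uniform on the finite set of configurations; sign
   flips kill all cross terms of the second moment of S^T S - 1, so the mean square
   Frobenius error is at most 2 |A|_F^4 / s, and Markov's inequality applies.
   Subgaussian maps: a dimension-free bound by a PAC-Bayes argument. A bilinear form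
   at x, y is averaged over discrete Gaussian perturbations of x and y on a fine
   lattice of inverse variance of order sr(A), restricted to those with |A x| <= 2 |A|.
   The price of the shift, exp (O(sr(A))), replaces the covering number of the unit
   sphere, which would be exponential in the dimension. *)
From HB Require Import structures.
Require Import Defs.
From mathcomp Require Import all_boot all_order all_algebra.
From mathcomp Require Import all_classical all_reals all_analysis.
From mathcomp Require Import measurable_realfun.
From mathcomp Require Import zify ring lra.

Set Implicit Arguments.
Unset Strict Implicit.
Unset Printing Implicit Defensive.

Import Order.TTheory GRing.Theory Num.Theory.
Import numFieldNormedType.Exports.

Local Open Scope classical_set_scope.
Local Open Scope ring_scope.

(** * Euclidean and spectral norms *)

Section euclidean.
Context {R : realType}.
Implicit Types n m : nat.

(** The accuracy [c / (1 + c) * gap] is what the angle bound asks for. With [E] the Gram error, Weyl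
    keeps the k-th eigenvalue of the sketched Gram matrix above [sigma_k^2 - |E|], so the sine of
    the angle is at most [|E| / (sigma_k^2 - sigma_(k+1)^2 - |E|)]; requiring this to be at most [c]
    and solving for [|E|] gives that factor. Singular values, pseudo-inverses and minimisers are
    chosen by [xget]. Each is reached by exhibiting a candidate and then using only properties
    shared by all candidates. For subgaussian maps the lattice turns every average over the prior
    into a finite sum, so exchanging it with the expectation is linearity. The mesh depends on the
    dimension, but the number of points never enters: only ratios of Gaussian masses do, and these
    are bounded uniformly in mesh and dimension. The truncation of [|A x|] is forced by the products
    of row forms being only subexponential: their exponential moments are controlled only for a
    small parameter times [|A x| |A y|]. *)

Definition dot n (u v : 'cV[R]_n) : R := (u^T *m v) 0 0.

Lemma dotE n (u v : 'cV[R]_n) : dot u v = \sum_i u i 0 * v i 0.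
Proof. by rewrite /dot mxE; apply: eq_bigr => i _; rewrite mxE. Qed.

Lemma dotC n (u v : 'cV[R]_n) : dot u v = dot v u.
Proof. by rewrite !dotE; apply: eq_bigr => i _; rewrite mulrC. Qed.

Lemma dotDl n (u v w : 'cV[R]_n) : dot (u + v) w = dot u w + dot v w.
Proof. by rewrite /dot linearD /= mulmxDl mxE. Qed.

Lemma dotDr n (u v w : 'cV[R]_n) : dot u (v + w) = dot u v + dot u w.
Proof. by rewrite /dot mulmxDr mxE. Qed.

Lemma dotNl n (u v : 'cV[R]_n) : dot (- u) v = - dot u v.
Proof. by rewrite /dot linearN /= mulNmx mxE. Qed.

Lemma dotNr n (u v : 'cV[R]_n) : dot u (- v) = - dot u v.
Proof. by rewrite /dot mulmxN mxE. Qed.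

Lemma dotBl n (u v w : 'cV[R]_n) : dot (u - v) w = dot u w - dot v w.
Proof. by rewrite dotDl dotNl. Qed.

Lemma dotBr n (u v w : 'cV[R]_n) : dot u (v - w) = dot u v - dot u w.
Proof. by rewrite dotDr dotNr. Qed.

Lemma dotZl n a (u v : 'cV[R]_n) : dot (a *: u) v = a * dot u v.
Proof. by rewrite /dot linearZ /= -scalemxAl mxE. Qed.

Lemma dotZr n a (u v : 'cV[R]_n) : dot u (a *: v) = a * dot u v.
Proof. by rewrite /dot -scalemxAr mxE. Qed.

Lemma dot0l n (v : 'cV[R]_n) : dot 0 v = 0.
Proof. by rewrite /dot trmx0 mul0mx mxE. Qed.

Lemma dot0r n (v : 'cV[R]_n) : dot v 0 = 0.
Proof. by rewrite /dot mulmx0 mxE. Qed.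

Lemma dot_mull m n (X : 'M[R]_(m, n)) u v : dot (X *m u) v = dot u (X^T *m v).
Proof. by rewrite /dot trmx_mul mulmxA. Qed.

Lemma dot_ge0 n (u : 'cV[R]_n) : 0 <= dot u u.
Proof. by rewrite dotE sumr_ge0 // => i _; rewrite -expr2 sqr_ge0. Qed.

Lemma dot_eq0 n (u : 'cV[R]_n) : (dot u u == 0) = (u == 0).
Proof.
apply/eqP/eqP => [/eqP|->]; last by rewrite dot0l.
rewrite dotE psumr_eq0; last by move=> i _; rewrite -expr2 sqr_ge0.
move=> /allP h; apply/colP => i; rewrite mxE.
by have /implyP := h i (mem_index_enum _); rewrite -expr2 sqrf_eq0 => /(_ isT)/eqP.
Qed.

Lemma norm2_ge0 n (u : 'cV[R]_n) : 0 <= norm2 u.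
Proof. exact: sqrtr_ge0. Qed.

Lemma norm2_sqr n (u : 'cV[R]_n) : norm2 u ^+ 2 = dot u u.
Proof.
rewrite /norm2 sqr_sqrtr; last by apply: sumr_ge0 => i _; exact: sqr_ge0.
by rewrite dotE.
Qed.

Lemma norm2_sqrt n (u : 'cV[R]_n) : norm2 u = Num.sqrt (dot u u).
Proof. by rewrite -norm2_sqr sqrtr_sqr ger0_norm ?norm2_ge0. Qed.

Lemma norm2_eq0 n (u : 'cV[R]_n) : (norm2 u == 0) = (u == 0).
Proof. by rewrite -dot_eq0 -norm2_sqr sqrf_eq0. Qed.

Lemma norm2_0 n : norm2 (0 : 'cV[R]_n) = 0.
Proof. by apply/eqP; rewrite norm2_eq0. Qed.

Lemma norm2_gt0 n (u : 'cV[R]_n) : (0 < norm2 u) = (u != 0).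
Proof. by rewrite lt0r norm2_ge0 andbT norm2_eq0. Qed.

Lemma norm2_le n (c : R) (u : 'cV[R]_n) :
  0 <= c -> (norm2 u <= c) = (dot u u <= c ^+ 2).
Proof. by move=> c0; rewrite -norm2_sqr ler_sqr ?nnegrE ?norm2_ge0. Qed.

Lemma norm2_ler m n (u : 'cV[R]_m) (v : 'cV[R]_n) :
  (norm2 u <= norm2 v) = (dot u u <= dot v v).
Proof. by rewrite norm2_le ?norm2_ge0// norm2_sqr. Qed.

Lemma norm2Z n a (u : 'cV[R]_n) : norm2 (a *: u) = `|a| * norm2 u.
Proof.
by rewrite norm2_sqrt dotZl dotZr mulrA -expr2 sqrtrM ?sqr_ge0// sqrtr_sqr -norm2_sqrt.
Qed.

Lemma norm2N n (u : 'cV[R]_n) : norm2 (- u) = norm2 u.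
Proof. by rewrite -scaleN1r norm2Z normrN1 mul1r. Qed.

Lemma norm2_distC n (u v : 'cV[R]_n) : norm2 (u - v) = norm2 (v - u).
Proof. by rewrite -norm2N opprB. Qed.

Lemma dot_le_norm2 n (u v : 'cV[R]_n) : dot u v <= norm2 u * norm2 v.
Proof.
have [->|u0] := eqVneq u 0; first by rewrite dot0l norm2_0 mul0r.
have := dot_ge0 (norm2 u *: v - norm2 v *: u).
rewrite dotBl !dotBr !dotZl !dotZr -!norm2_sqr (dotC v u) => h.
have [->|v0] := eqVneq v 0; first by rewrite dot0r norm2_0 mulr0.
rewrite -norm2_gt0 in u0; rewrite -norm2_gt0 in v0.
have : 0 <= (norm2 u * norm2 v) * (norm2 u * norm2 v - dot u v) by lra.
by rewrite pmulr_rge0 ?mulr_gt0// subr_ge0.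
Qed.

Lemma normr_dot_le n (u v : 'cV[R]_n) : `|dot u v| <= norm2 u * norm2 v.
Proof. by rewrite ler_norml dot_le_norm2 lerNl -dotNl -[norm2 u]norm2N dot_le_norm2. Qed.

Lemma norm2D n (u v : 'cV[R]_n) : norm2 (u + v) <= norm2 u + norm2 v.
Proof.
rewrite norm2_le ?addr_ge0 ?norm2_ge0//.
rewrite dotDl !dotDr (dotC v u) sqrrD -!norm2_sqr.
have := dot_le_norm2 u v; lra.
Qed.

Lemma norm2B n (u v : 'cV[R]_n) : norm2 (u - v) <= norm2 u + norm2 v.
Proof. by rewrite -[norm2 v]norm2N norm2D. Qed.

Lemma dot_isometry m n (M : 'M[R]_(m, n)) u v :
  M^T *m M = 1%:M -> dot (M *m u) (M *m v) = dot u v.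
Proof. by move=> MM; rewrite dot_mull mulmxA MM mul1mx. Qed.

Lemma norm2_isometry m n (M : 'M[R]_(m, n)) u :
  M^T *m M = 1%:M -> norm2 (M *m u) = norm2 u.
Proof. by move=> MM; rewrite !norm2_sqrt dot_isometry. Qed.

Lemma dot_projection m n (M : 'M[R]_(m, n)) x : M^T *m M = 1%:M ->
  dot x x = dot (M^T *m x) (M^T *m x) + dot (x - M *m (M^T *m x)) (x - M *m (M^T *m x)).
Proof.
by move=> MM; rewrite dotBl !dotBr (dot_isometry _ _ MM) [dot x (M *m _)]dotC !dot_mull; ring.
Qed.

Lemma bessel m n (M : 'M[R]_(m, n)) x : M^T *m M = 1%:M ->
  dot (M^T *m x) (M^T *m x) <= dot x x.
Proof. by move=> MM; rewrite [leRHS](dot_projection x MM) lerDl dot_ge0. Qed.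

Lemma frobenius_ge0 m n (X : 'M[R]_(m, n)) : 0 <= frobenius X.
Proof. exact: sqrtr_ge0. Qed.

Lemma frobenius_sqr m n (X : 'M[R]_(m, n)) :
  frobenius X ^+ 2 = \sum_i \sum_j X i j ^+ 2.
Proof.
by rewrite sqr_sqrtr//; apply: sumr_ge0 => i _; apply: sumr_ge0 => j _; exact: sqr_ge0.
Qed.

Lemma norm2_mul_frobenius m n (X : 'M[R]_(m, n)) v :
  norm2 (X *m v) <= frobenius X * norm2 v.
Proof.
rewrite norm2_le ?mulr_ge0 ?frobenius_ge0 ?norm2_ge0//.
rewrite exprMn frobenius_sqr norm2_sqr dotE mulr_suml.
apply: ler_sum => i _.
have -> : (X *m v) i 0 = dot (row i X)^T v.
  by rewrite /dot trmxK -row_mul [RHS]mxE.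
have -> : \sum_j X i j ^+ 2 = dot (row i X)^T (row i X)^T.
  by rewrite dotE; apply: eq_bigr => j _; rewrite !mxE expr2.
rewrite -expr2 -!norm2_sqr -exprMn -[leLHS]real_normK ?num_real// ler_sqr ?nnegrE//.
  exact: normr_dot_le.
by rewrite mulr_ge0 ?norm2_ge0.
Qed.

(** [sup] carries information only for a nonempty bounded set; the Frobenius norm supplies the
    bound. *)
Lemma spectral_norm_has_sup m n (X : 'M[R]_(m, n)) :
  has_sup [set norm2 (X *m v) | v in [set v : 'cV[R]_n | norm2 v <= 1]].
Proof.
split; first by exists (norm2 (X *m 0)); exists 0 => //=; rewrite norm2_0.
exists (frobenius X) => _ [v /= v1 <-]; apply: le_trans (norm2_mul_frobenius _ _) _.
by rewrite -[leRHS]mulr1 ler_wpM2l// frobenius_ge0.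
Qed.

Lemma spectral_norm_ge0 m n (X : 'M[R]_(m, n)) : 0 <= spectral_norm X.
Proof.
apply: le_trans (ub_le_sup (proj2 (spectral_norm_has_sup X)) _); first exact: (norm2_ge0 (X *m 0)).
by exists 0 => //=; rewrite norm2_0.
Qed.

Lemma spectral_normP m n (X : 'M[R]_(m, n)) v :
  norm2 (X *m v) <= spectral_norm X * norm2 v.
Proof.
have [->|v0] := eqVneq v 0; first by rewrite mulmx0 !norm2_0 mulr0.
rewrite -norm2_gt0 in v0.
rewrite -ler_pdivrMr// mulrC -[X in X * _]ger0_norm ?invr_ge0 ?norm2_ge0//.
rewrite -norm2Z scalemxAr; apply: ub_le_sup; first exact: (spectral_norm_has_sup X).2.
exists ((norm2 v)^-1 *: v) => //=.
by rewrite norm2Z ger0_norm ?invr_ge0 ?norm2_ge0// mulVf// gt_eqF.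
Qed.

Lemma spectral_norm_le m n (X : 'M[R]_(m, n)) c :
  0 <= c -> (forall v, norm2 (X *m v) <= c * norm2 v) -> spectral_norm X <= c.
Proof.
move=> c0 h; apply: ge_sup; first exact: (spectral_norm_has_sup X).1.
move=> _ [v /= v1 <-]; apply: le_trans (h v) _.
by rewrite -[leRHS]mulr1 ler_wpM2l.
Qed.

Lemma spectral_norm_le_frobenius m n (X : 'M[R]_(m, n)) :
  spectral_norm X <= frobenius X.
Proof. by apply: spectral_norm_le; [exact: frobenius_ge0|exact: norm2_mul_frobenius]. Qed.

Lemma spectral_norm_gt0 m n (X : 'M[R]_(m, n)) : X != 0 -> 0 < spectral_norm X.
Proof.
move=> X0; rewrite lt0r spectral_norm_ge0 andbT; apply: contra X0 => /eqP X0.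
apply/eqP/matrixP => i j; rewrite !mxE.
have : norm2 (X *m delta_mx j 0) <= 0 by rewrite (le_trans (spectral_normP _ _))// X0 mul0r.
rewrite le_eqVlt ltNge norm2_ge0 orbF norm2_eq0 -colE => /eqP/matrixP/(_ i 0).
by rewrite !mxE.
Qed.

Lemma stable_rank_ge1 m n (X : 'M[R]_(m, n)) : X != 0 -> 1 <= stable_rank X.
Proof.
move=> X0; have X_gt0 := spectral_norm_gt0 X0.
rewrite /stable_rank ler_pdivlMr ?exprn_gt0// mul1r ler_sqr ?nnegrE ?frobenius_ge0 ?spectral_norm_ge0//.
exact: spectral_norm_le_frobenius.
Qed.

End euclidean.

(** * Singular values *)

Section thin_svd_facts.
Context {R : realType}.

(** Numbered from 0, unlike [sigma]: sigma_k and sigma_(k+1) become [nth0 s k.-1] and [nth0 s k].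
    The extension by 0 covers the case where [k] is the smaller dimension. *)
Definition nth0 r (s : 'rV[R]_r) (i : nat) : R := oapp (s 0) 0 (insub i).

Lemma nth0_ord r (s : 'rV[R]_r) (i : 'I_r) : nth0 s i = s 0 i.
Proof. by rewrite /nth0 valK. Qed.

Lemma nth0_oversize r (s : 'rV[R]_r) (i : nat) : (r <= i)%N -> nth0 s i = 0.
Proof. by move=> ri; rewrite /nth0 insubF// ltnNge ri. Qed.

Lemma trmx_first_cols n r k (V : 'M[R]_(n, r)) :
  (first_cols k V)^T = pid_mx k *m V^T.
Proof. by rewrite /first_cols trmx_mul tr_pid_mx. Qed.

Lemma first_cols_isometry n r k (V : 'M[R]_(n, r)) : (k <= r)%N ->
  V^T *m V = 1%:M -> (first_cols k V)^T *m first_cols k V = 1%:M.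
Proof.
move=> kr VV; rewrite trmx_first_cols /first_cols mulmxA -(mulmxA _ V^T) VV mulmx1.
by rewrite mul_pid_mx minnn (minn_idPr kr) pid_mx_1.
Qed.

Lemma dot_first_cols n r k (V : 'M[R]_(n, r)) x y : (k <= r)%N ->
  dot ((first_cols k V)^T *m x) ((first_cols k V)^T *m y) =
  \sum_(i < r | (i < k)%N) (V^T *m x) i 0 * (V^T *m y) i 0.
Proof.
move=> kr; rewrite trmx_first_cols -!mulmxA dotE (big_ord_narrow kr).
have E (z : 'cV[R]_n) (i : 'I_k) : (pid_mx k *m (V^T *m z)) i 0 = (V^T *m z) (widen_ord kr i) 0.
  rewrite [LHS]mxE (bigD1 (widen_ord kr i))//= big1 ?addr0.
    by rewrite mxE eqxx ltn_ord mul1r.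
  move=> j ji; rewrite mxE; case: eqP => [e|]; rewrite ?mul0r//.
  by case/eqP: ji; apply: val_inj.
by apply: eq_bigr => i _; rewrite !E.
Qed.

Context (m n : nat) (A : 'M[R]_(m, n)) (U : 'M[R]_(m, minn m n))
  (s : 'rV[R]_(minn m n)) (V : 'M[R]_(n, minn m n)).
Hypothesis svdA : thin_svd A U s V.

Let r := minn m n.

Lemma svd_ge0 i : 0 <= s 0 i. Proof. by case: svdA. Qed.

Lemma nth0_ge0 i : 0 <= nth0 s i.
Proof. by rewrite /nth0; case: insubP => //= *; exact: svd_ge0. Qed.

Lemma nth0_anti i j : (i <= j)%N -> nth0 s j <= nth0 s i.
Proof.
move=> ij; case: (ltnP j r) => jr; last by rewrite nth0_oversize// nth0_ge0.
rewrite -[j]/(val (Ordinal jr)) -[i]/(val (Ordinal (leq_ltn_trans ij jr))) !nth0_ord.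
by case: svdA => _ _ _ + _; apply.
Qed.

Lemma svd_dot x y :
  dot (A *m x) (A *m y) = \sum_i s 0 i ^+ 2 * ((V^T *m x) i 0 * (V^T *m y) i 0).
Proof.
case: svdA => UU VV _ _ ->; rewrite -!mulmxA (dot_isometry _ _ UU) dotE.
by apply: eq_bigr => i _; rewrite !mul_diag_mx !mxE; ring.
Qed.

Lemma svd_gram : A^T *m A = V *m diag_mx (\row_i s 0 i ^+ 2) *m V^T.
Proof.
case: svdA => UU VV _ _ ->; rewrite !trmx_mul trmxK tr_diag_mx.
rewrite !mulmxA -(mulmxA _ U^T U) UU mulmx1; congr (_ *m _).
rewrite -mulmxA; congr (_ *m _); by rewrite mulmx_diag; congr diag_mx.
Qed.

Context (k : nat).
Hypothesis kr : (k <= r)%N.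

Let Vk := first_cols k V.

Lemma first_cols_svd_isometry : Vk^T *m Vk = 1%:M.
Proof. by apply: first_cols_isometry => //; case: svdA. Qed.

Lemma svd_norm_ge x : (0 < k)%N ->
  nth0 s k.-1 ^+ 2 * dot (Vk^T *m x) (Vk^T *m x) <= dot (A *m x) (A *m x).
Proof.
move=> k0; rewrite svd_dot dot_first_cols// mulr_sumr big_mkcond/= ler_sum// => i _.
case: ifP => ik; last by rewrite -expr2 mulr_ge0 ?sqr_ge0.
rewrite -expr2 ler_wpM2r ?sqr_ge0// ler_sqr ?nnegrE ?svd_ge0 ?nth0_ge0//.
by rewrite -nth0_ord nth0_anti// -ltnS prednK.
Qed.

Lemma first_cols_perp (z : 'cV[R]_n) : Vk^T *m z = 0 ->
  forall i : 'I_r, (i < k)%N -> (V^T *m z) i 0 = 0.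
Proof.
move=> Vz i ik; have : dot (Vk^T *m z) (Vk^T *m z) = 0 by rewrite Vz dot0l.
rewrite dot_first_cols// => /eqP; rewrite psumr_eq0; last first.
  by move=> j _; rewrite -expr2 sqr_ge0.
by move=> /allP/(_ i (mem_index_enum _)); rewrite ik /= -expr2 sqrf_eq0 => /eqP.
Qed.

(** Only the coordinates from [k] on survive. A thin [V] need not be square, so passing from [V^T z]
    back to [z] is Bessel's inequality. When [k] is the smaller dimension the bound says that
    [A z = 0]. *)
Lemma svd_norm_le z : Vk^T *m z = 0 ->
  dot (A *m z) (A *m z) <= nth0 s k ^+ 2 * dot z z.
Proof.
move=> /first_cols_perp Vz; case: (svdA) => _ VV _ _ _; rewrite svd_dot.
apply: le_trans (_ : nth0 s k ^+ 2 * dot (V^T *m z) (V^T *m z) <= _); last first.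
  by rewrite ler_wpM2l ?sqr_ge0// bessel.
rewrite dotE mulr_sumr ler_sum// => i _.
case: (ltnP i k) => ik; first by rewrite Vz// !mul0r !mulr0.
by rewrite -expr2 ler_wpM2r ?sqr_ge0// ler_sqr ?nnegrE ?svd_ge0 ?nth0_ge0// -nth0_ord nth0_anti.
Qed.

Lemma svd_gram_norm_le (z : 'cV[R]_n) : Vk^T *m z = 0 ->
  norm2 (A^T *m (A *m z)) <= nth0 s k ^+ 2 * norm2 z.
Proof.
move=> /first_cols_perp Vz; case: (svdA) => _ VV _ _ _.
rewrite mulmxA svd_gram -!mulmxA norm2_isometry// norm2_le; last first.
  by apply: mulr_ge0; [exact: sqr_ge0|exact: norm2_ge0].
rewrite exprMn norm2_sqr.
apply: le_trans (_ : (nth0 s k ^+ 2) ^+ 2 * dot (V^T *m z) (V^T *m z) <= _); last first.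
  by rewrite ler_wpM2l ?sqr_ge0// bessel.
rewrite !dotE mulr_sumr ler_sum// => i _; rewrite mul_diag_mx [X in X * _]mxE !mxE.
case: (ltnP i k) => ik; first by have := Vz i ik; rewrite mxE => ->; rewrite !mulr0.
set p := \sum_j _; rewrite -expr2 exprMn -expr2 ler_wpM2r ?sqr_ge0//.
have sk := nth0_ge0 k; have si := svd_ge0 i.
by rewrite ler_sqr ?nnegrE ?sqr_ge0// ler_sqr ?nnegrE// -nth0_ord nth0_anti.
Qed.

Lemma svd_first_cols_eigen :
  A^T *m A *m Vk = Vk *m diag_mx (\row_(i < k) nth0 s i ^+ 2).
Proof.
case: svdA => _ VV _ _ _; rewrite svd_gram /Vk /first_cols !mulmxA -(mulmxA _ V^T) VV mulmx1.
rewrite -!mulmxA; congr (_ *m _); apply/matrixP => i j.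
rewrite mul_diag_mx mul_mx_diag !mxE mulrC.
case: eqP => [e|_]; last by rewrite !mul0r.
by rewrite -e nth0_ord.
Qed.

(** The columns of a thin [V] may fail to span the space, so the trailing coordinates capture only
    part of the residual. Adding the leading coordinates to both sides reduces the claim to Bessel's
    inequality for the whole of [V]. *)
Lemma last_cols_norm_le x : norm2 ((last_cols k V)^T *m x) <= norm2 (x - Vk *m (Vk^T *m x)).
Proof.
case: (svdA) => _ VV _ _ _.
have VkVk := first_cols_svd_isometry.
rewrite norm2_ler -(lerD2l (dot (Vk^T *m x) (Vk^T *m x))) -(dot_projection x VkVk).
apply: le_trans (bessel x VV); rewrite dot_first_cols// dotE [leRHS]dotE.
rewrite [leRHS](bigID (fun i : 'I_r => (i < k)%N))/= lerD2l.
have -> : \sum_i ((last_cols k V)^T *m x) i 0 * ((last_cols k V)^T *m x) i 0 =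
    \sum_(i < r - k) (V^T *m x) (Ordinal (last_cols_subproof i)) 0 *
                     (V^T *m x) (Ordinal (last_cols_subproof i)) 0.
  by apply: eq_bigr => i _; congr (_ * _); rewrite !mxE; apply: eq_bigr => j _; rewrite !mxE.
pose h (i : 'I_(r - k)) : 'I_r := Ordinal (last_cols_subproof i).
pose F (i : 'I_r) := (V^T *m x) i 0 * (V^T *m x) i 0.
have h_inj : injective h by move=> i j /(congr1 val) /= /addnI; exact: val_inj.
rewrite (_ : \sum_(i < r - k) _ = \sum_(i in h @: [set: 'I_(r - k)]%SET) F i); last first.
  by rewrite big_imset/=; [apply: eq_bigl => i; rewrite inE|move=> i j _ _; exact: h_inj].
rewrite !(big_mkcond (fun i => _ \in _)) (big_mkcond (fun i : 'I_r => ~~ _))/= ler_sum// => i _.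
case: ifP => [/imsetP[j _ ->]|_]; first by rewrite /= ltnNge leq_addr.
by case: ifP => // _; rewrite -expr2 sqr_ge0.
Qed.

End thin_svd_facts.

Lemma kernel_vector {R : realType} p q (X : 'M[R]_(p, q)) :
  (p < q)%N -> exists2 v : 'cV[R]_q, v != 0 & X *m v = 0.
Proof.
move=> pq; have : kermx X^T != 0.
  by rewrite kermx_eq0 -row_leq_rank -ltnNge (leq_ltn_trans (rank_leq_col _)).
move=> /rowV0Pn[u /sub_kermxP uX u0]; exists u^T; first by rewrite trmx_eq0.
by rewrite -[X]trmxK -trmx_mul uX trmx0.
Qed.

(** * Weyl's inequality for Gram matrices *)

Section perturbation.
Context {R : realType} (m1 m2 n : nat) (A : 'M[R]_(m1, n)) (B : 'M[R]_(m2, n)).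
Context (U : 'M[R]_(m1, minn m1 n)) (s : 'rV[R]_(minn m1 n)) (V : 'M[R]_(n, minn m1 n)).
Context (U' : 'M[R]_(m2, minn m2 n)) (s' : 'rV[R]_(minn m2 n)) (V' : 'M[R]_(n, minn m2 n)).
Hypotheses (svdA : thin_svd A U s V) (svdB : thin_svd B U' s' V').

Let E := B^T *m B - A^T *m A.

Lemma dot_gram_diff x : dot (B *m x) (B *m x) - dot (A *m x) (A *m x) = dot x (E *m x).
Proof. by rewrite !dot_mull !mulmxA -dotBr -mulmxBl. Qed.

Lemma gram_diff_ge x : - (spectral_norm E * dot x x) <= dot x (E *m x).
Proof.
rewrite lerNl -dotNl (le_trans (dot_le_norm2 _ _))// norm2N mulrC.
by rewrite -norm2_sqr expr2 mulrA ler_wpM2r ?norm2_ge0// spectral_normP.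
Qed.

(* The span of the top i+1 right singular vectors of A meets the orthogonal
   complement of the top i right singular vectors of B. *)
Lemma weyl i : (i < minn m1 n)%N -> (i <= minn m2 n)%N ->
  nth0 s i ^+ 2 - spectral_norm E <= nth0 s' i ^+ 2.
Proof.
move=> i1 i2; pose W := (first_cols i V')^T *m first_cols i.+1 V.
have [a a0 Wa] := kernel_vector W (ltnSn i).
have VV := first_cols_svd_isometry svdA i1.
set x := first_cols i.+1 V *m a.
have x_gt0 : 0 < dot x x by rewrite (dot_isometry _ _ VV) lt0r dot_eq0 a0 dot_ge0.
have Bx : dot (B *m x) (B *m x) <= nth0 s' i ^+ 2 * dot x x.
  by apply: (svd_norm_le svdB i2); rewrite mulmxA.
have Ax : nth0 s i ^+ 2 * dot x x <= dot (A *m x) (A *m x).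
  by have := svd_norm_ge svdA i1 x isT; rewrite [_^T *m x]mulmxA VV mul1mx (dot_isometry _ _ VV).
rewrite -(ler_pM2r x_gt0) mulrBl.
have := dot_gram_diff x; have := gram_diff_ge x; lra.
Qed.

End perturbation.

Section uniqueness.
Context {R : realType} (m n : nat) (A : 'M[R]_(m, n)).

Lemma spectral_norm0 p q : spectral_norm (0 : 'M[R]_(p, q)) = 0.
Proof.
apply/eqP; rewrite eq_le spectral_norm_ge0 andbT spectral_norm_le// => v.
by rewrite mul0mx norm2_0 mul0r.
Qed.

(** Between two decompositions of the same matrix the perturbation in [weyl] is zero, and the
    inequality can be read in both directions. *)
Lemma singular_values_uniq U s V U' s' V' :
  thin_svd A U s V -> thin_svd A U' s' V' -> s = s'.
Proof.
have le U1 s1 V1 U2 s2 V2 i : thin_svd A U1 s1 V1 -> thin_svd A U2 s2 V2 ->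
    s1 0 i <= s2 0 i.
  move=> h1 h2; have := weyl h1 h2 (ltn_ord i) (ltnW (ltn_ord i)).
  rewrite subrr spectral_norm0 subr0 !nth0_ord ler_sqr// nnegrE.
    exact: svd_ge0 h1 i.
  exact: svd_ge0 h2 i.
move=> h h'; apply/rowP => i; apply/eqP.
by rewrite eq_le (le _ _ _ _ _ _ _ h h') (le _ _ _ _ _ _ _ h' h).
Qed.

Lemma sigma_svd U s V i : thin_svd A U s V -> sigma A i = nth0 s i.-1.
Proof.
move=> svdA; rewrite /sigma -/(nth0 _ _); congr nth0; rewrite /singular_values.
case: xgetP => [_ -> [U' [V' h]]|/(_ s)]; first exact: singular_values_uniq h svdA.
by case; exists U, V.
Qed.

(** A nonzero value can come neither from the default of [xget] nor from an index out of range, so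
    the set of decompositions is inhabited. The strict gap at [k] makes one of sigma_k, sigma_(k+1)
    nonzero, which is how a decomposition of [A] is obtained. *)
Lemma sigma_gt0_svd i : sigma A i != 0 -> exists U s V, thin_svd A U s V.
Proof.
rewrite /sigma /singular_values; case: xgetP => [s _ [U [V h]] _|_]; first by exists U, s, V.
by case: insubP => [j _ _|_] /=; rewrite ?mxE eqxx.
Qed.

Lemma spectral_norm_svd U s V : thin_svd A U s V -> spectral_norm A = nth0 s 0.
Proof.
move=> svdA; apply/eqP; rewrite eq_le; apply/andP; split.
  apply: spectral_norm_le; first exact: nth0_ge0 svdA 0.
  move=> v; rewrite norm2_le ?mulr_ge0 ?norm2_ge0 ?(nth0_ge0 svdA)// exprMn norm2_sqr.
  (* With [k = 0], orthogonality to the leading subspace is an equation between matrices without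
     rows. *)
  apply: (svd_norm_le svdA (leq0n _)); apply/matrixP => i j; by case: i.
case: (ltnP 0 (minn m n)) => r0; last by rewrite nth0_oversize// spectral_norm_ge0.
have VV := first_cols_svd_isometry svdA r0.
(* The kernel of a matrix without rows: just a nonzero vector of dimension 1. *)
have [a a0 _] := @kernel_vector R 0 1 0 isT.
set x := first_cols 1 V *m a.
have x_gt0 : 0 < norm2 x by rewrite (norm2_isometry _ VV) norm2_gt0.
rewrite -(ler_pM2r x_gt0) (le_trans _ (spectral_normP A x))//.
rewrite -[leLHS]ger0_norm ?mulr_ge0 ?norm2_ge0 ?(nth0_ge0 svdA)// -ler_sqr ?nnegrE ?norm2_ge0//.
rewrite real_normK ?num_real// exprMn !norm2_sqr.
by have := svd_norm_ge svdA r0 x isT; rewrite [_^T *m x]mulmxA VV mul1mx (dot_isometry _ _ VV).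
Qed.

End uniqueness.

(** * The sine theorem *)

Section pseudo_inverse.
Context {R : realType}.

Lemma injective_unitmx k (X : 'M[R]_k) :
  (forall v : 'cV_k, X *m v = 0 -> v = 0) -> X \in unitmx.
Proof.
move=> X0; rewrite -unitmx_tr -row_free_unit -kermx_eq0.
apply/rowV0P => u /sub_kermxP uX; apply: trmx_inj; rewrite trmx0.
by apply: X0; rewrite -[X]trmxK -trmx_mul uX trmx0.
Qed.

(** For full column rank, [(X^T X)^-1 X^T] satisfies the Penrose equations, so [xget] does not fall
    back to its default. That the chosen matrix is a left inverse follows from [X Y X = X] by
    cancelling the injective [X]. *)
Lemma injective_penrose m k (X : 'M[R]_(m, k)) :
  (forall v : 'cV_k, X *m v = 0 -> v = 0) ->
  penrose X (Defs.pinv X) /\ Defs.pinv X *m X = 1%:M.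
Proof.
move=> X0; have Gu : X^T *m X \in unitmx.
  apply: injective_unitmx => v Gv; apply: X0; apply/eqP.
  by rewrite -dot_eq0 dot_mull mulmxA Gv dot0r.
have Xpinv : penrose X (Defs.pinv X).
  rewrite /Defs.pinv; apply: (xgetPex 0); exists (invmx (X^T *m X) *m X^T).
  have YX : invmx (X^T *m X) *m X^T *m X = 1%:M by rewrite -mulmxA mulVmx.
  split; rewrite ?YX ?mul1mx ?trmx1//.
    by rewrite -!mulmxA mulVmx ?mulmx1.
  by rewrite !trmx_mul trmxK trmx_inv !trmx_mul trmxK mulmxA.
split=> //; case: Xpinv => XYX _ _ _.
apply/subr0_eq/matrixP => i j; rewrite [RHS]mxE.
have: col j (Defs.pinv X *m X - 1%:M) = 0.
  by apply: X0; rewrite colE mulmxA mulmxBr mulmxA XYX mulmx1 subrr mul0mx.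
by move/matrixP/(_ i 0); rewrite !mxE.
Qed.

Context m n (X : 'M[R]_(m, n)) (Y : 'M[R]_(n, m)).
Hypothesis XY : penrose X Y.

Lemma penrose_normal (b : 'cV_m) : X^T *m (X *m Y *m b - b) = 0.
Proof.
case: XY => XYX _ XYt _; rewrite mulmxBr mulmxA -XYt -trmx_mul XYX subrr//.
Qed.

(** [X Y] is the orthogonal projection onto the column space, so [X Y b - b] is orthogonal to every
    image. Optimality of [Y b] and, at [y = 0], contractivity of the projection are read off. *)
Lemma penrose_pythagoras b y : dot (X *m y - b) (X *m y - b) =
  dot (X *m y - X *m Y *m b) (X *m y - X *m Y *m b) + dot (X *m Y *m b - b) (X *m Y *m b - b).
Proof.
set p := X *m y - X *m Y *m b; set q := X *m Y *m b - b.
have -> : X *m y - b = p + q by rewrite /p /q addrA subrK.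
have pq : dot p q = 0.
  by rewrite /p -mulmxA -mulmxBr dot_mull penrose_normal dot0r.
by move: p q pq => p q pq; rewrite dotDl !dotDr (dotC q p) pq addr0 add0r.
Qed.

Lemma penrose_min b y : norm2 (X *m Y *m b - b) <= norm2 (X *m y - b).
Proof. by rewrite norm2_ler [leRHS]penrose_pythagoras lerDr dot_ge0. Qed.

Lemma penrose_norm_le b : norm2 (X *m Y *m b) <= norm2 b.
Proof.
rewrite norm2_ler; have := penrose_pythagoras b 0.
by rewrite mulmx0 !sub0r !dotNl !dotNr !opprK => ->; rewrite lerDl dot_ge0.
Qed.

End pseudo_inverse.

(** The convention [0^-1 = 0] treats vanishing singular values correctly. This covers [A] itself,
    which may be rank deficient, and so describes the projection onto its column space in the fixed
    design model. *)
Lemma svd_penrose {R : realType} m n (A : 'M[R]_(m, n)) U s V :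
  thin_svd A U s V ->
  penrose A (V *m diag_mx (\row_i (s 0 i)^-1) *m U^T).
Proof.
case=> UU VV _ _ ->; set D := diag_mx s; set D' := diag_mx _.
have DD' : D *m D' = D' *m D by rewrite !mulmx_diag; congr diag_mx; apply/rowP => i; rewrite !mxE mulrC.
have DDD : D *m D' *m D = D.
  rewrite !mulmx_diag; congr diag_mx; apply/rowP => i; rewrite !mxE.
  by have [->|s0] := eqVneq (s 0 i) 0; rewrite ?mul0r ?divff ?mul1r.
have D'DD' : D' *m D *m D' = D'.
  rewrite !mulmx_diag; congr diag_mx; apply/rowP => i; rewrite !mxE.
  by have [->|s0] := eqVneq (s 0 i) 0; rewrite ?invr0 ?mul0r ?mulVf ?mul1r.
have DD't : (D *m D')^T = D *m D' by rewrite mulmx_diag tr_diag_mx.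
have XY : U *m D *m V^T *m (V *m D' *m U^T) = U *m (D *m D') *m U^T.
  by rewrite !mulmxA -(mulmxA _ V^T V) VV mulmx1.
have YX : V *m D' *m U^T *m (U *m D *m V^T) = V *m (D *m D') *m V^T.
  by rewrite DD' !mulmxA -(mulmxA _ U^T U) UU mulmx1.
split; rewrite ?XY ?YX.
- by rewrite !mulmxA -(mulmxA _ U^T U) UU mulmx1 -!mulmxA (mulmxA D) (mulmxA (D *m D')) DDD.
- by rewrite DD' !mulmxA -(mulmxA _ V^T V) VV mulmx1 -!mulmxA (mulmxA D') (mulmxA (D' *m D)) D'DD'.
- by rewrite !trmx_mul !trmxK -trmx_mul DD't mulmxA.
- by rewrite !trmx_mul !trmxK -trmx_mul DD't mulmxA.
Qed.

(** * Angle between the singular subspaces, and its consequences *)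

Section sin_theta.
Context {R : realType} (n m d : nat) (A : 'M[R]_(n, d)) (B : 'M[R]_(m, d)).
Context (U : 'M[R]_(n, minn n d)) (s : 'rV[R]_(minn n d)) (V : 'M[R]_(d, minn n d)).
Context (U' : 'M[R]_(m, minn m d)) (s' : 'rV[R]_(minn m d)) (V' : 'M[R]_(d, minn m d)).
Hypotheses (svdA : thin_svd A U s V) (svdB : thin_svd B U' s' V').
Context (k : nat) (nu : R).
Hypotheses (k_gt0 : (0 < k)%N) (kA : (k <= minn n d)%N) (kB : (k <= minn m d)%N).

Let E := B^T *m B - A^T *m A.
Context (Vk M : 'M[R]_(d, k)).
Hypotheses (VkE : Vk = first_cols k V) (ME : M = first_cols k V').
Let hi := nth0 s k.-1.
Let lo := nth0 s k.
Context (c : R).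
Hypothesis cE : c = nu * (Num.sqrt (1 + nu ^+ 2))^-1.

Hypotheses (gap_gt0 : lo < hi) (nu_gt0 : 0 < nu).
Hypothesis E_lt : spectral_norm E < c / (1 + c) * (hi ^+ 2 - lo ^+ 2).

Let VkVk : Vk^T *m Vk = 1%:M.
Proof. by rewrite VkE; exact: (first_cols_svd_isometry svdA kA). Qed.

Let MM : M^T *m M = 1%:M.
Proof. by rewrite ME; exact: (first_cols_svd_isometry svdB kB). Qed.

Let tail_norm_le z : Vk^T *m z = 0 -> dot (A *m z) (A *m z) <= lo ^+ 2 * dot z z.
Proof. by rewrite VkE; exact: (svd_norm_le svdA kA). Qed.

Let tail_gram_le (z : 'cV_d) : Vk^T *m z = 0 ->
  norm2 (A^T *m (A *m z)) <= lo ^+ 2 * norm2 z.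
Proof. by rewrite VkE; exact: (svd_gram_norm_le svdA kA). Qed.

Let eigenA : A^T *m A *m Vk = Vk *m diag_mx (\row_(i < k) nth0 s i ^+ 2).
Proof. by rewrite VkE; exact: (svd_first_cols_eigen svdA k). Qed.

Let eigenB : B^T *m B *m M = M *m diag_mx (\row_(i < k) nth0 s' i ^+ 2).
Proof. by rewrite ME; exact: (svd_first_cols_eigen svdB k). Qed.

Let lo_ge0 : 0 <= lo := nth0_ge0 svdA k.
Let hi_gt0 : 0 < hi := le_lt_trans lo_ge0 gap_gt0.

Let c_gt0 : 0 < c.
Proof. by rewrite cE mulr_gt0// invr_gt0 sqrtr_gt0 ltr_wpDr ?sqr_ge0. Qed.

Let sqr_c : c ^+ 2 * (1 + nu ^+ 2) = nu ^+ 2.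
Proof.
have h : 0 < 1 + nu ^+ 2 by rewrite ltr_wpDr ?sqr_ge0.
by rewrite cE exprMn exprVn sqr_sqrtr ?ltW// -mulrA mulVf ?mulr1// gt_eqF.
Qed.

Definition residual (x : 'cV[R]_d) := x - Vk *m (Vk^T *m x).

Lemma residual_perp x : Vk^T *m residual x = 0.
Proof. by rewrite /residual mulmxBr !mulmxA VkVk mul1mx subrr. Qed.

Let spectral_gap : hi ^+ 2 - spectral_norm E <= nth0 s' k.-1 ^+ 2.
Proof. by apply: (weyl svdA svdB); rewrite ?prednK// (leq_trans (leq_pred _)). Qed.

(** Projecting [B^T B M = M L] off the leading subspace of [A] gives the Sylvester equation
    [T L = (1 - Vk Vk^T) E M + A^T A T] for [T = (1 - Vk Vk^T) M]. As [L >= lam] and [A^T A] is at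
    most [lo^2] on the range of [T], it follows that [(lam - lo^2) |T| <= |E|]. *)
Lemma sin_theta y : norm2 (residual (M *m y)) <= c * norm2 y.
Proof.
set T := M - Vk *m (Vk^T *m M).
have Ty v : T *m v = residual (M *m v) by rewrite mulmxBl /residual !mulmxA.
have [lam lamE] : exists lam, lam = nth0 s' k.-1 ^+ 2 by eexists.
have sg := spectral_gap; rewrite -lamE in sg.
have E_ge0 := spectral_norm_ge0 E.
have gap2 : 0 < hi ^+ 2 - lo ^+ 2 by rewrite subr_gt0 ltr_sqr ?nnegrE// ltW.
have E_lt' : spectral_norm E * (1 + c) < c * (hi ^+ 2 - lo ^+ 2).
  by rewrite -ltr_pdivlMr ?addr_gt0// mulrAC.
have lam_lo : (hi ^+ 2 - lo ^+ 2) - spectral_norm E <= lam - lo ^+ 2 by lra.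
(* Needed to invert [L]; it holds because the accuracy keeps [|E|] below the gap that Weyl's
   inequality starts from. *)
have lam_gt0 : 0 < lam.
  have : 0 <= c * spectral_norm E by rewrite mulr_ge0// ltW.
  have : 0 <= lo ^+ 2 by rewrite sqr_ge0.
  have [//|lam0] := ltP 0 lam.
  move=> lo2 cE_ge0; have : c * (hi ^+ 2 - lo ^+ 2 - spectral_norm E) <= c * 0.
    by apply: ler_wpM2l; [exact: ltW|lra].
  by lra.
pose L := \row_(i < k) nth0 s' i ^+ 2.
have L_ge i : lam <= L 0 i.
  rewrite lamE mxE ler_sqr ?nnegrE ?(nth0_ge0 svdB)//; apply: (nth0_anti svdB).
  by rewrite -ltnS prednK.
have TL v : T *m (diag_mx L *m v) = residual (E *m (M *m v)) + A^T *m (A *m (T *m v)).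
  have ML : M *m (diag_mx L *m v) = B^T *m (B *m (M *m v)).
    by have := eigenB; rewrite !mulmxA => ->.
  rewrite Ty ML {1}/E mulmxBl -!mulmxA.
  have -> : T *m v = M *m v - Vk *m (Vk^T *m (M *m v)) by rewrite Ty.
  (* [A^T A] commutes with the projection [Vk Vk^T], by the eigenvector equation and its
     transpose. *)
  have AV w : A^T *m (A *m (Vk *m (Vk^T *m w))) = Vk *m (Vk^T *m (A^T *m (A *m w))).
    have e := eigenA; have et := congr1 trmx e; rewrite !trmx_mul trmxK tr_diag_mx in et.
    have -> : Vk^T *m (A^T *m (A *m w)) = diag_mx (\row_(i < k) nth0 s i ^+ 2) *m (Vk^T *m w).
      by rewrite !mulmxA -(mulmxA Vk^T) et.
    by rewrite !mulmxA e.
  rewrite [in RHS]mulmxBr [in RHS]mulmxBr AV /residual !mulmxBr.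
  by rewrite opprB addrACA [RHS]addrC; apply/eqP; rewrite -subr_eq0; apply/eqP/matrixP=> i j; rewrite !mxE; ring.
have T_ge0 := spectral_norm_ge0 T.
have Tbnd : spectral_norm T <= (spectral_norm E + lo ^+ 2 * spectral_norm T) / lam.
  apply: spectral_norm_le.
    by rewrite divr_ge0 ?(ltW lam_gt0)// addr_ge0// mulr_ge0 ?sqr_ge0.
  (* Every [v] is [L v'] with [lam |v'| <= |v|], so bounding [T L v'] bounds [T v]. *)
  move=> v; pose v' : 'cV_k := \col_i ((L 0 i)^-1 * v i 0).
  have Lv' : diag_mx L *m v' = v.
    apply/colP => i; rewrite mul_diag_mx !mxE mulVKf// gt_eqF// (lt_le_trans lam_gt0)//.
    by have := L_ge i; rewrite mxE.
  have v'_le : lam * norm2 v' <= norm2 v.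
    rewrite -ler_sqr ?nnegrE ?mulr_ge0 ?norm2_ge0 ?(ltW lam_gt0)//.
    rewrite exprMn !norm2_sqr !dotE mulr_sumr ler_sum// => i _.
    have -> : v i 0 = L 0 i * v' i 0 by rewrite -[in LHS]Lv' mul_diag_mx [LHS]mxE.
    rewrite -!expr2 exprMn ler_wpM2r ?sqr_ge0// ler_sqr ?nnegrE ?(ltW lam_gt0)//.
    exact: le_trans (ltW lam_gt0) (L_ge i).
  rewrite -{1}Lv' TL (le_trans (norm2D _ _))//.
  have h1 : norm2 (residual (E *m (M *m v'))) <= spectral_norm E * norm2 v'.
    apply: le_trans (_ : norm2 (E *m (M *m v')) <= _).
      by rewrite norm2_ler /residual [leRHS](dot_projection _ VkVk) lerDr dot_ge0.
    by rewrite (le_trans (spectral_normP _ _))// norm2_isometry.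
  have h2 : norm2 (A^T *m (A *m (T *m v'))) <= lo ^+ 2 * spectral_norm T * norm2 v'.
    apply: le_trans (tail_gram_le _) _; first by rewrite Ty residual_perp.
    by rewrite -mulrA ler_wpM2l ?sqr_ge0// spectral_normP.
  apply: le_trans (lerD h1 h2) _; rewrite -mulrDl -[leRHS]mulrA ler_wpM2l//.
    by rewrite addr_ge0// mulr_ge0 ?sqr_ge0.
  by rewrite mulrC ler_pdivlMr// mulrC.
rewrite -Ty (le_trans (spectral_normP _ _))// ler_wpM2r ?norm2_ge0//.
rewrite ler_pdivlMr// in Tbnd.
(* If [|T| > c], then [c (hi^2 - lo^2 - |E|) <= |T| (lam - lo^2) <= |E|], contradicting the accuracy
   hypothesis. *)
have [//|Tc] := leP (spectral_norm T) c.
have : c * (hi ^+ 2 - lo ^+ 2 - spectral_norm E) <= spectral_norm T * (lam - lo ^+ 2).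
  apply: ler_pM => //; [exact: ltW| |exact: ltW].
  rewrite subr_ge0 -(ler_pM2r c_gt0) mulrC; lra.
lra.
Qed.

(** With [a] and [z] the squared norms of the two components of [M y], the sine bound is
    [z <= c^2 (a + z)]; multiplying by [1 + nu^2] turns it into [z <= nu^2 a]. *)
Lemma tan_theta y :
  norm2 (residual (M *m y)) <= nu * norm2 (Vk^T *m (M *m y)).
Proof.
have := sin_theta y; rewrite norm2_le ?mulr_ge0 ?norm2_ge0 ?(ltW c_gt0)//.
rewrite norm2_le ?mulr_ge0 ?norm2_ge0 ?(ltW nu_gt0)//.
rewrite !exprMn !norm2_sqr -(dot_isometry y y MM) (dot_projection (M *m y) VkVk) -/(residual _).
set a := dot (_ *m _) _; set z := dot _ _ => h.
have : (1 + nu ^+ 2) * z <= (1 + nu ^+ 2) * (c ^+ 2 * (a + z)).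
  by apply: ler_wpM2l h => //; rewrite addr_ge0 ?sqr_ge0.
rewrite mulrA [_ * c ^+ 2]mulrC sqr_c; lra.
Qed.

(** The tangent is finite: a vector of the sketched subspace with no component along [Vk] has zero
    residual as well. *)
Lemma overlap_unit : Vk^T *m M \in unitmx.
Proof.
apply: injective_unitmx => y; rewrite -mulmxA => h.
apply/eqP; rewrite -dot_eq0 -(dot_isometry _ _ MM) (dot_projection _ VkVk) -/(residual _) h dot0r add0r.
have := tan_theta y; rewrite h norm2_0 mulr0 le_eqVlt ltNge norm2_ge0 orbF norm2_eq0.
by rewrite dot_eq0.
Qed.

Lemma residual_image_le y :
  norm2 (A *m residual (M *m y)) <= lo * nu * norm2 (Vk^T *m (M *m y)).
Proof.
apply: le_trans (_ : lo * norm2 (residual (M *m y)) <= _); last first.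
  by rewrite -mulrA ler_wpM2l// tan_theta.
rewrite norm2_le ?mulr_ge0 ?norm2_ge0// exprMn norm2_sqr.
by apply: tail_norm_le; rewrite residual_perp.
Qed.

Lemma norm2_first_cols_le x : hi * norm2 (Vk^T *m x) <= norm2 (A *m x).
Proof.
rewrite -ler_sqr ?nnegrE ?mulr_ge0 ?norm2_ge0 ?(ltW hi_gt0)// exprMn !norm2_sqr.
by rewrite VkE; exact: (svd_norm_ge svdA).
Qed.

Lemma top_injective (y : 'cV_k) : A *m Vk *m y = 0 -> y = 0.
Proof.
rewrite -mulmxA => h; have := norm2_first_cols_le (Vk *m y).
rewrite h norm2_0 mulmxA VkVk mul1mx pmulr_rle0// le_eqVlt ltNge norm2_ge0 orbF norm2_eq0.
by move/eqP.
Qed.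

Lemma sketch_injective (y : 'cV_k) : A *m M *m y = 0 -> y = 0.
Proof.
rewrite -mulmxA => h; have := norm2_first_cols_le (M *m y).
rewrite h norm2_0 pmulr_rle0// le_eqVlt ltNge norm2_ge0 orbF norm2_eq0 mulmxA => /eqP h'.
by rewrite -[y](mulKmx overlap_unit) h' mulmx0.
Qed.

(** Whichever minimiser [xget] selects, its residual norm is the distance from [b] to the range of
    [A Vk], which the pseudo-inverse attains. *)
Lemma pcr_solution_dist b : norm2 (A *m pcr_solution A V k b - b) =
  norm2 (A *m Vk *m Defs.pinv (A *m Vk) *m b - b).
Proof.
have [X _] := injective_penrose top_injective.
rewrite /pcr_solution -VkE; case: xgetP => [x _ [[y ->] h]|/(_ (Vk *m Defs.pinv (A *m Vk) *m b))].
  apply/eqP; rewrite eq_le mulmxA penrose_min// andbT -mulmxA.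
  by rewrite (le_trans (h (Defs.pinv (A *m Vk) *m b)))// !mulmxA.
case; split; first by exists (Defs.pinv (A *m Vk) *m b); rewrite mulmxA.
by move=> y; rewrite !mulmxA penrose_min.
Qed.

(** The two least-squares problems are compared by exchanging competitors: a vector of range [M] for
    its component in range [Vk], and a vector of range [Vk] for the vector of range [M] with that
    component. Each exchange moves the image under [A] by at most [lo * nu] times the norm of the
    component, which is itself at most [|b| / hi]. *)
Lemma sketched_approx_pcr b : nu < 2^-1 ->
  approx_pcr A V k b (lo / hi * nu)
    (nu / ((Num.sqrt (1 - nu ^+ 2) - nu) * hi)) (sketched_solution A M b).
Proof.
move=> nu2; have [pV _] := injective_penrose top_injective.
have [pM _] := injective_penrose sketch_injective.
have split_image y : A *m (M *m y) = A *m (Vk *m (Vk^T *m (M *m y))) + A *m residual (M *m y).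
  by rewrite -mulmxDr addrC subrK.
split.
  rewrite pcr_solution_dist /sketched_solution !mulmxA ler_distl; apply/andP; split.
    rewrite lerBlDr.
    set y := Defs.pinv (A *m M) *m b.
    apply: le_trans (penrose_min pV b (Vk^T *m (M *m y))) _.
    have -> : A *m Vk *m (Vk^T *m (M *m y)) - b = (A *m M *m y - b) - A *m residual (M *m y).
      by rewrite -[A *m M *m y]mulmxA split_image !mulmxA addrAC addrK.
    apply: le_trans (norm2B _ _) _; rewrite -[A *m M *m _ *m b]mulmxA lerD2l.
    apply: le_trans (residual_image_le y) _.
    rewrite [lo / hi * nu]mulrAC -[leRHS]mulrA ler_wpM2l ?mulr_ge0 ?(ltW nu_gt0)//.
    rewrite ler_pdivlMl// (le_trans (norm2_first_cols_le _))//.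
    by rewrite !mulmxA penrose_norm_le.
  set a := Defs.pinv (A *m Vk) *m b.
  pose y := invmx (Vk^T *m M) *m a.
  have ya : Vk^T *m (M *m y) = a by rewrite mulmxA mulKVmx// overlap_unit.
  apply: le_trans (penrose_min pM b y) _.
  have -> : A *m M *m y - b = (A *m Vk *m a - b) + A *m residual (M *m y).
    by rewrite -[A *m M *m y]mulmxA split_image ya !mulmxA addrAC.
  apply: le_trans (norm2D _ _) _; rewrite -[A *m Vk *m _ *m b]mulmxA lerD2l.
  apply: le_trans (residual_image_le y) _; rewrite ya.
  rewrite [lo / hi * nu]mulrAC -[leRHS]mulrA ler_wpM2l ?mulr_ge0 ?(ltW nu_gt0)//.
  have := norm2_first_cols_le (Vk *m a); rewrite mulmxA VkVk mul1mx => h.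
  by rewrite ler_pdivlMl// (le_trans h)// !mulmxA penrose_norm_le.
(* The tangent bound yields [nu / hi]; the stated constant is at least as large because this
   denominator lies between 0 and 1. *)
have den : 0 < Num.sqrt (1 - nu ^+ 2) - nu.
  have := mulr_gt0 nu_gt0 (_ : 0 < 2^-1 - nu); rewrite subr_gt0 => /(_ nu2) h.
  rewrite subr_gt0 -ltr_sqr ?nnegrE ?sqrtr_ge0 ?(ltW nu_gt0)// sqr_sqrtr; lra.
have den1 : Num.sqrt (1 - nu ^+ 2) - nu <= 1.
  apply: le_trans (_ : Num.sqrt (1 - nu ^+ 2) <= _); first by rewrite gerBl ltW.
  by rewrite -[leRHS]sqrtr1 ler_wsqrtr// gerBl sqr_ge0.
set y := Defs.pinv (A *m M) *m b.
rewrite /sketched_solution -!mulmxA -/y.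
apply: le_trans (last_cols_norm_le svdA kA _) _; rewrite -VkE.
apply: le_trans (tan_theta y) _.
rewrite -[leRHS]mulrA ler_wpM2l ?(ltW nu_gt0)// invfM.
have h : norm2 (Vk^T *m (M *m y)) <= hi^-1 * norm2 b.
  by rewrite ler_pdivlMl// (le_trans (norm2_first_cols_le _))// !mulmxA penrose_norm_le.
apply: le_trans h _; rewrite ler_wpM2r ?norm2_ge0//.
by rewrite ler_peMl ?invr_ge0 ?(ltW hi_gt0)// invf_ge1.
Qed.

(** The bias is the squared distance from [A x] to the range of [A M]. The competitor [M y] shares
    its [Vk] component with [x], so only residuals remain, and [A] scales these by at most [lo].
    Cauchy-Schwarz on [nu |a| + |residual x|] produces [1 + nu^2]. *)
Lemma sketch_bias x P : P = A *m M *m Defs.pinv (A *m M) ->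
  dot (P *m (A *m x) - A *m x) (P *m (A *m x) - A *m x) <=
  (1 + nu ^+ 2) * norm2 x ^+ 2 * lo ^+ 2.
Proof.
move=> PE; have [pM _] := injective_penrose sketch_injective.
pose a := Vk^T *m x; pose y := invmx (Vk^T *m M) *m a.
have ya : Vk^T *m (M *m y) = a by rewrite mulmxA mulKVmx// overlap_unit.
have := penrose_min pM (A *m x) y; rewrite norm2_ler -PE => /le_trans; apply.
have -> : A *m M *m y - A *m x = A *m (residual (M *m y) - residual x).
  by rewrite /residual ya -mulmxA -mulmxBr; congr (_ *m _); rewrite opprB addrA subrK.
apply: le_trans (tail_norm_le _) _; first by rewrite mulmxBr !residual_perp subrr.
rewrite mulrC ler_wpM2r ?sqr_ge0// -!norm2_sqr norm2_sqr -norm2_sqr.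
have h1 : norm2 (residual (M *m y) - residual x) <= nu * norm2 a + norm2 (residual x).
  by rewrite (le_trans (norm2B _ _))// lerD2r -ya tan_theta.
have h2 : norm2 x ^+ 2 = norm2 a ^+ 2 + norm2 (residual x) ^+ 2.
  by rewrite !norm2_sqr (dot_projection x VkVk).
apply: le_trans (_ : (nu * norm2 a + norm2 (residual x)) ^+ 2 <= _).
  by rewrite ler_sqr ?nnegrE ?addr_ge0 ?mulr_ge0 ?norm2_ge0// ltW.
rewrite h2; have := sqr_ge0 (norm2 a - nu * norm2 (residual x)); lra.
Qed.

(** Cyclicity of the trace replaces the projection by [pinv (A M) (A M)], the identity of size
    [k]. *)
Lemma sketch_trace : \tr (A *m M *m Defs.pinv (A *m M)) = k%:R.
Proof.
by have [_ e] := injective_penrose sketch_injective; rewrite mxtrace_mulC e mxtrace1.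
Qed.

Lemma sketch_penrose : penrose (A *m M) (Defs.pinv (A *m M)).
Proof. by have [] := injective_penrose sketch_injective. Qed.

End sin_theta.

(** * Independence *)

Section joint_law.
Context d {T : measurableType d} {R : realType} (P : probability T R).
Context (f g : {RV P >-> R}).

Definition joint_fun (w : T) : R * R := (f w, g w).

Lemma measurable_joint_fun : measurable_fun setT joint_fun.
Proof. exact: measurable_fun_pair. Qed.

HB.instance Definition _ :=
  isMeasurableFun.Build _ _ _ _ joint_fun measurable_joint_fun.

End joint_law.

Section independent_pair.
Local Open Scope ereal_scope.
Context d {T : measurableType d} {R : realType} (P : probability T R).
Context (f g : {RV P >-> R}).
Hypothesis fg_indep : forall A B : set R, measurable A -> measurable B ->
  P ((f @^-1` A) `&` (g @^-1` B)) = P (f @^-1` A) * P (g @^-1` B).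

Lemma joint_law_indep (A : set (R * R)) : measurable A ->
  (distribution P f \x distribution P g) A = distribution P (joint_fun f g) A.
Proof.
apply: (@product_measure_unique _ _ _ _ _ (distribution P f) (distribution P g)
  (distribution P (joint_fun f g))) => B C mB mC.
by rewrite /= /distribution /pushforward -fg_indep.
Qed.

Lemma ge0_integral_indep (h : R * R -> \bar R) : measurable_fun [set: R * R] h ->
  (forall x, 0 <= h x) ->
  \int[P]_w h (f w, g w) = \int[distribution P f]_x \int[distribution P g]_y h (x, y).
Proof.
move=> mh h0; rewrite -[RHS](@fubini_tonelli1 _ _ _ _ _ (distribution P f) (distribution P g) h mh h0).
rewrite (eq_measure_integral (distribution P (joint_fun f g))); last first.
  by move=> A mA _; exact: joint_law_indep.
by rewrite ge0_integral_distribution.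
Qed.

Lemma ge0_integral_indepM : (forall w, 0 <= f w)%R -> (forall w, 0 <= g w)%R ->
  \int[P]_w (f w * g w)%:E = (\int[P]_w (f w)%:E) * \int[P]_w (g w)%:E.
Proof.
move=> f0 g0.
have mabs : measurable_fun [set: R] (fun y : R => `|y|%:E).
  by apply/measurable_EFinP; exact: normr_measurable.
transitivity (\int[P]_w (fun z : R * R => `|z.1|%:E * `|z.2|%:E) (f w, g w)).
  by apply: eq_integral => w _ /=; rewrite !ger0_norm.
rewrite (ge0_integral_indep (h := fun z : R * R => `|z.1|%:E * `|z.2|%:E)); first last.
- by move=> x; rewrite mule_ge0.
- apply/measurable_EFinP/measurable_funM => /=.
    by apply: measurableT_comp; [exact: normr_measurable|exact: measurable_fst].
  by apply: measurableT_comp; [exact: normr_measurable|exact: measurable_snd].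
have e (k : {RV P >-> R}) : (forall w, 0 <= k w)%R ->
    \int[distribution P k]_y `|y|%:E = \int[P]_w (k w)%:E.
  move=> k0; rewrite ge0_integral_distribution//.
  by apply: eq_integral => w _ /=; rewrite ger0_norm.
under eq_integral => x _ do rewrite /= ge0_integralZl//.
rewrite ge0_integralZr//; first by rewrite !e.
by apply: integral_ge0 => y _; rewrite lee_fin.
Qed.

End independent_pair.

Section independent_pair_integrable.
Local Open Scope ereal_scope.
Context d {T : measurableType d} {R : realType} (P : probability T R).
Context (f g : {RV P >-> R}).
Hypothesis fg_indep : forall A B : set R, measurable A -> measurable B ->
  P ((f @^-1` A) `&` (g @^-1` B)) = P (f @^-1` A) * P (g @^-1` B).
Hypotheses (fi : P.-integrable setT (EFin \o f)) (gi : P.-integrable setT (EFin \o g)).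

Let mh : measurable_fun [set: R * R] (fun z : R * R => (z.1 * z.2)%:E).
Proof.
by apply/measurable_EFinP/measurable_funM; [exact: measurable_fst|exact: measurable_snd].
Qed.

Let mabs : measurable_fun [set: R] (fun y : R => `|y|%:E).
Proof. by apply/measurable_EFinP; exact: normr_measurable. Qed.

Let absi (k : {RV P >-> R}) : \int[distribution P k]_y `|y|%:E = \int[P]_w `|(k w)%:E|.
Proof. by rewrite ge0_integral_distribution. Qed.

Let idi (k : {RV P >-> R}) : P.-integrable setT (EFin \o k) ->
  \int[distribution P k]_y y%:E = \int[P]_w (k w)%:E.
Proof. by move=> ki; rewrite integral_distribution. Qed.

(** Tonelli on absolute values factors the mean of [|f g|]; this is the integrability that Fubini
    requires in [integral_indepM]. *)
Lemma integrable_indepM : P.-integrable setT (EFin \o (fun w => f w * g w)%R).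
Proof.
apply/integrableP; split; first by apply/measurable_EFinP; exact: measurable_funM.
rewrite [ltLHS](_ : _ = \int[P]_w (fun z : R * R => `|(z.1 * z.2)%:E|) (f w, g w))//.
rewrite (ge0_integral_indep fg_indep (h := fun z => `|(z.1 * z.2)%:E|))//; last exact: measurableT_comp.
under eq_integral => x _.
  under eq_integral do rewrite /= normrM EFinM.
  rewrite ge0_integralZl//.
  over.
rewrite ge0_integralZr//; last exact: integral_ge0.
rewrite !absi lte_mul_pinfty//.
- exact: integral_ge0.
- by apply: integrable_fin_num => //; exact: integrable_abse.
- by case/integrableP: gi.
Qed.

Lemma integral_indepM :
  \int[P]_w (f w * g w)%:E = (\int[P]_w (f w)%:E) * \int[P]_w (g w)%:E.
Proof.
have hi : (distribution P f \x distribution P g).-integrable setT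
    (fun z : R * R => (z.1 * z.2)%:E).
  apply/integrableP; split => //.
  rewrite fubini_tonelli1//; last exact: measurableT_comp.
  rewrite -(ge0_integral_indep fg_indep (h := fun z => `|(z.1 * z.2)%:E|))//; last exact: measurableT_comp.
  by case/integrableP: integrable_indepM.
have fgi : P.-integrable setT ((fun z : R * R => (z.1 * z.2)%:E) \o joint_fun f g).
  exact: integrable_indepM.
transitivity (\int[distribution P (joint_fun f g)]_z (z.1 * z.2)%:E).
  by rewrite integral_distribution.
rewrite (eq_measure_integral (distribution P f \x distribution P g)); last first.
  by move=> A mA _; exact: (esym (joint_law_indep fg_indep mA)).
rewrite -integral12_prod_meas1//=.
have gi' : (distribution P g).-integrable setT (fun y => y%:E).
  by apply/integrableP; split; [exact/measurable_EFinP|rewrite absi; case/integrableP: gi].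
have fi' : (distribution P f).-integrable setT (fun y => y%:E).
  by apply/integrableP; split; [exact/measurable_EFinP|rewrite absi; case/integrableP: fi].
have gfin : \int[P]_w (g w)%:E \is a fin_num by exact: integrable_fin_num.
transitivity (\int[distribution P f]_x (x%:E * \int[P]_w (g w)%:E)).
  apply: eq_integral => x _; rewrite /fubini_F /=.
  by under eq_integral do rewrite EFinM; rewrite integralZl// idi.
by rewrite -(fineK gfin) integralZr// idi// fineK.
Qed.

End independent_pair_integrable.

(** * Independence of functions of disjoint families of variables *)

Section independent_blocks.
Local Open Scope ereal_scope.
Context d {T : measurableType d} {R : realType} (P : probability T R).
Context (I : finType) (Y : I -> {RV P >-> R}).
Hypothesis Y_indep : mutually_independent Y.

(** A pi-system generating the sigma-algebra of the variables [Y i] with [i] in [J]. *)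
Definition cylinder (J : {set I}) : set (set T) :=
  [set C | exists2 B : I -> set R, (forall i, measurable (B i)) &
    C = [set w | forall i, i \in J -> B i (Y i w)]].

(** The sample space with that sigma-algebra: measurability on [block J] expresses that a function
    is determined by the [Y i] with [i] in [J]. *)
Definition block (J : {set I}) : measurableType _ := g_sigma_algebraType (cylinder J).

Lemma measurable_box (B : I -> set R) : (forall i, measurable (B i)) ->
  measurable [set w | forall i, B i (Y i w)].
Proof.
move=> mB; rewrite (_ : [set _ | _] = \big[setI/setT]_(i : I) (Y i @^-1` B i)).
  apply: bigsetI_measurable => i _; rewrite -[X in measurable X]setTI.
  exact: measurable_funP.
rewrite -bigcap_seq_cond; apply/seteqP; split => w /=.
  by move=> h i _; exact: h.
by move=> h i; apply: h; rewrite /= mem_index_enum.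
Qed.

Let widen (J : {set I}) (B : I -> set R) i := if i \in J then B i else setT.

Let widenE (J : {set I}) (B : I -> set R) : [set w | forall i, i \in J -> B i (Y i w)] =
  [set w | forall i, widen J B i (Y i w)].
Proof.
apply/seteqP; split => w /= h i; first by rewrite /widen; case: ifP => // /h.
by move=> iJ; have := h i; rewrite /widen iJ.
Qed.

Let measurable_widen (J : {set I}) (B : I -> set R) i : (forall i, measurable (B i)) -> measurable (widen J B i).
Proof. by rewrite /widen; case: ifP. Qed.

Lemma measurable_cylinder J C : cylinder J C -> measurable C.
Proof.
case=> B mB ->; rewrite widenE; apply: measurable_box => i; exact: measurable_widen.
Qed.

Lemma setI_closed_cylinder J : setI_closed (cylinder J).
Proof.
move=> _ _ [B mB ->] [B' mB' ->]; exists (fun i => B i `&` B' i).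
  by move=> i; exact: measurableI.
apply/seteqP; split => w /=; first by move=> [h h'] i iJ; split; [exact: h|exact: h'].
by move=> h; split => i /h [].
Qed.

Lemma cylinderT J : cylinder J setT.
Proof. by exists (fun=> setT) => //; apply/seteqP; split. Qed.

Lemma block_measurable J C : <<s cylinder J >> C -> measurable C.
Proof. by apply: smallest_sub; [exact: sigma_algebra_measurable|exact: measurable_cylinder]. Qed.

(** Both cylinders and their intersection become boxes over all indices, free outside [J] and [J'].
    By disjointness each index is constrained by at most one of them, so the product rule for the
    intersection splits factor by factor. *)
Lemma cylinder_indep (J J' : {set I}) C D : [disjoint J & J']%B -> cylinder J C -> cylinder J' D ->
  P (C `&` D) = P C * P D.
Proof.
move=> JJ' [B mB ->] [B' mB' ->]; rewrite !widenE.
rewrite (_ : _ `&` _ = [set w | forall i, (widen J B i `&` widen J' B' i) (Y i w)]); last first.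
  apply/seteqP; split => w /=; first by move=> [h h'] i; split.
  by move=> h; split => i; have [] := h i.
have mW : forall (K : {set I}) (E : I -> set R), (forall i, measurable (E i)) ->
    forall i, measurable (widen K E i) by move=> *; exact: measurable_widen.
rewrite (Y_indep (mW J B mB)) (Y_indep (mW J' B' mB')).
rewrite (@Y_indep (fun i => widen J B i `&` widen J' B' i)); last first.
  by move=> i; apply: measurableI; exact: mW.
rewrite -big_split/=; apply: eq_bigr => i _.
have PT : P [set w | [set: R] (Y i w)] = 1.
  by rewrite -[RHS](probability_setT P); congr (P _); apply/seteqP; split.
have widenT (K : {set I}) (E : I -> set R) : (i \in K) = false -> widen K E i = setT.
  by rewrite /widen => ->.
have [iJ|/negbTE iJ] := boolP (i \in J).
  rewrite (widenT J') ?(disjointFr JJ' iJ)// PT mule1; congr (P _).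
  by apply/seteqP; split => w //= -[].
rewrite (widenT J)// PT mul1e; congr (P _).
by apply/seteqP; split => w //= -[].
Qed.

(** For fixed [D], the events satisfying the product rule form a Dynkin system, and [G] is a
    pi-system. *)
Lemma block_indep_event (G : set (set T)) D :
  setI_closed G -> G setT -> (forall C, G C -> measurable C) -> measurable D ->
  (forall C, G C -> P (C `&` D) = P C * P D) ->
  forall C, <<s G >> C -> P (C `&` D) = P C * P D.
Proof.
move=> GI GT Gm mD GD C sC.
have sm E : <<s G >> E -> measurable E.
  by apply: smallest_sub; [exact: sigma_algebra_measurable|exact: Gm].
apply: (@dynkin_induction _ (g_sigma_algebraType G) G (fun E => P (E `&` D) = P E * P D)) sC => //.
- exact: GD.
- move=> E /= /sm mE PE; rewrite probability_setC// muleBl ?fin_num_measure// mul1e -PE.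
  rewrite setIC -setDE measureD//; last by rewrite ltey_eq fin_num_measure.
  by rewrite setIC.
- move=> F /= mF tF PF; have mF' n := sm _ (mF n).
  rewrite setI_bigcupl !measure_bigcup//.
    rewrite [RHS]muleC -(@fineK _ (P D)) ?fin_num_measure// -nneseriesZl//.
    by apply: eq_eseriesr => n _; rewrite fineK ?fin_num_measure// [RHS]muleC; exact: PF.
  - by move=> n _; exact: measurableI.
  - exact: trivIset_setIr.
Qed.

(** The one-variable extension is used twice: for the first event with [D] fixed, and then, for each
    cylinder [E], for the second event with [E] fixed. *)
Lemma block_indep (J J' : {set I}) C D : [disjoint J & J']%B ->
  <<s cylinder J >> C -> <<s cylinder J' >> D -> P (C `&` D) = P C * P D.
Proof.
move=> JJ' sC sD; move: sC; apply: block_indep_event.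
- exact: setI_closed_cylinder.
- exact: cylinderT.
- exact: measurable_cylinder.
- exact: block_measurable sD.
move=> E cE; rewrite setIC muleC; move: sD; apply: block_indep_event.
- exact: setI_closed_cylinder.
- exact: cylinderT.
- exact: measurable_cylinder.
- exact: measurable_cylinder cE.
by move=> F cF; rewrite setIC muleC; exact: cylinder_indep cE cF.
Qed.

Lemma measurable_block_coord (J : {set I}) i : i \in J ->
  measurable_fun [set: block J] (Y i : block J -> R).
Proof.
move=> iJ _ B mB; rewrite setTI; apply: sub_gen_smallest.
exists (fun j => if j == i then B else setT); first by move=> j; case: ifP.
apply/seteqP; split => w /=; first by move=> h j _; case: eqP => [->|].
by move=> /(_ i iJ); rewrite eqxx.
Qed.

Lemma measurable_block_fun J (f : T -> R) :
  measurable_fun [set: block J] (f : block J -> R) -> measurable_fun setT f.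
Proof.
by move=> mf _ B mB; apply: (@block_measurable J); exact: mf.
Qed.

Lemma cylinderS (J J' : {set I}) : J \subset J' -> cylinder J `<=` cylinder J'.
Proof.
move=> JJ' _ [B mB ->]; exists (widen J B); first by move=> i; exact: measurable_widen.
rewrite widenE; apply/seteqP; split => w /= h i //.
by have [/h//|iJ'] := boolP (i \in J'); rewrite /widen ifN//; apply: contra iJ'; exact: (fintype.subsetP JJ').
Qed.

Lemma measurable_blockS (J J' : {set I}) (f : T -> R) : J \subset J' ->
  measurable_fun [set: block J] (f : block J -> R) ->
  measurable_fun [set: block J'] (f : block J' -> R).
Proof.
move=> JJ' mf _ B mB; have := mf measurableT _ mB.
exact: (sub_sigma_algebra2 (cylinderS JJ')).
Qed.

Lemma integral_blocksM (J J' : {set I}) (f g : T -> R) : [disjoint J & J']%B ->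
  (forall w, 0 <= f w)%R -> (forall w, 0 <= g w)%R ->
  measurable_fun [set: block J] (f : block J -> R) ->
  measurable_fun [set: block J'] (g : block J' -> R) ->
  \int[P]_w (f w * g w)%:E = (\int[P]_w (f w)%:E) * \int[P]_w (g w)%:E.
Proof.
move=> JJ' f0 g0 mf mg.
have mf' := measurable_block_fun mf; have mg' := measurable_block_fun mg.
pose f' : {RV P >-> R} := HB.pack f (isMeasurableFun.Build _ _ _ _ f mf').
pose g' : {RV P >-> R} := HB.pack g (isMeasurableFun.Build _ _ _ _ g mg').
apply: (@ge0_integral_indepM _ _ _ P f' g') => // A B mA mB /=.
apply: (block_indep JJ'); first by rewrite -[X in <<s _ >> X]setTI; exact: mf.
by rewrite -[X in <<s _ >> X]setTI; exact: mg.
Qed.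

(** Induction on the list: the head block is disjoint from the union of the other blocks, on which
    the remaining product is measurable. *)
Lemma integral_prod_blocks (L : eqType) (s : seq L) (J : L -> {set I}) (f : L -> T -> R) :
  uniq s -> (forall l l', l != l' -> [disjoint J l & J l']%B) ->
  (forall l w, 0 <= f l w)%R ->
  (forall l, measurable_fun [set: block (J l)] (f l : block (J l) -> R)) ->
  \int[P]_w (\prod_(l <- s) f l w)%:E = \prod_(l <- s) \int[P]_w (f l w)%:E.
Proof.
move=> + dJ f0 mf; elim: s => [_|a s IH /= /andP[as_ us]].
  under eq_integral do rewrite big_nil.
  rewrite big_nil integral_cst// mul1e; exact: probability_setT.
under eq_integral do rewrite big_cons.
rewrite big_cons -IH//.
apply: (@integral_blocksM (J a) (\bigcup_(l <- s) J l)%SET) => //.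
- rewrite disjoint_sym finset.disjoints_subset; elim: s as_ {us IH} => [_|b s IH].
    by rewrite big_nil finset.sub0set.
  rewrite inE negb_or big_cons finset.subUset => /andP[ab /IH ->]; rewrite andbT.
  by rewrite -finset.disjoints_subset dJ// eq_sym.
- by move=> w; apply: prodr_ge0.
- apply: measurable_prod => l ls; apply: measurable_blockS (mf l).
  by rewrite (big_rem l)//= finset.subsetUl.
Qed.

End independent_blocks.

(** * Measurability and means *)

Section measurable_spectral_norm.
Context {R : realType}.

Lemma norm2_le_entries n (u : 'cV[R]_n) (e : R) : 0 <= e ->
  (forall i, `|u i 0| <= e) -> norm2 u <= n%:R * e.
Proof.
move=> e0 ue; rewrite norm2_le ?mulr_ge0// dotE.
apply: le_trans (_ : \sum_(i < n) e ^+ 2 <= _).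
  apply: ler_sum => i _; rewrite -expr2 -real_normK ?num_real//.
  by rewrite ler_sqr ?nnegrE// ue.
rewrite sumr_const card_ord -[leLHS]mulr_natl exprMn ler_wpM2r ?sqr_ge0//.
by rewrite -natrX ler_nat; case: n {u ue} => // n; rewrite -mulnn leq_pmulr.
Qed.

Lemma rational_approx n (v : 'cV[R]_n) (e : R) : 0 < e ->
  exists q : 'cV[rat]_n, norm2 (v - map_mx ratr q) <= e.
Proof.
move=> e0; have e1 : 0 < e / n.+1%:R by rewrite divr_gt0.
have h i : {q : rat | `|v i 0 - ratr q| <= e / n.+1%:R}.
  apply: cid; have : v i 0 - e / n.+1%:R < v i 0 + e / n.+1%:R.
    by rewrite ltrBlDr -addrA ltrDl addr_gt0.
  move=> /rat_in_itvoo[q]; rewrite in_itv/= => /andP[q1 q2]; exists q.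
  by rewrite ler_distl; apply/andP; split; rewrite ?lerBlDr ltW// -?ltrBlDr.
exists (\col_i sval (h i)); apply: le_trans (norm2_le_entries (ltW e1) _) _.
  by move=> i; rewrite !mxE; exact: svalP (h i).
by rewrite mulrCA ler_piMr ?(ltW e0)// ler_pdivrMr ?mul1r ?ler_nat.
Qed.

(** Density of the rational vectors turns the supremum into countably many conditions, which makes
    the spectral norm of a random matrix measurable. *)
Lemma spectral_norm_le_rational m n (X : 'M[R]_(m, n)) (c : R) : 0 <= c ->
  (forall q : 'cV[rat]_n, norm2 (X *m map_mx ratr q) <= c * norm2 (map_mx ratr q : 'cV[R]_n)) ->
  spectral_norm X <= c.
Proof.
move=> c0 h; apply: spectral_norm_le => // v; apply/ler_addgt0Pr => e e0.
(* Rounding [v] costs at most [spectral_norm X + c] times the rounding error; the extra 1 keeps the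
   divisor positive. *)
have K0 : 0 < spectral_norm X + c + 1 by rewrite ltr_wpDl// addr_ge0// spectral_norm_ge0.
have [q hq] := rational_approx v (divr_gt0 e0 K0).
have -> : X *m v = X *m map_mx ratr q + X *m (v - map_mx ratr q) by rewrite -mulmxDr addrC subrK.
apply: le_trans (norm2D _ _) _.
apply: le_trans (lerD (h q) (spectral_normP X _)) _.
have hq' : norm2 (map_mx ratr q) <= norm2 v + norm2 (v - map_mx ratr q).
  rewrite -{1}(subrK v (map_mx ratr q)) addrC (le_trans (norm2D _ _))// norm2_distC//.
have : c * norm2 (map_mx ratr q) <= c * (norm2 v + norm2 (v - map_mx ratr q)) by rewrite ler_wpM2l.
rewrite mulrDr => h1; apply: le_trans (lerD h1 (lexx _)) _.
rewrite -addrA lerD2l -mulrDl.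
apply: le_trans (_ : (spectral_norm X + c + 1) * (e / (spectral_norm X + c + 1)) <= _).
  apply: ler_pM; rewrite ?norm2_ge0 ?addr_ge0 ?spectral_norm_ge0//.
  by rewrite addrC lerDl.
by rewrite mulrC divfK// gt_eqF.
Qed.

Context d (T : measurableType d) (m n : nat) (X : T -> 'M[R]_(m, n)).
Hypothesis mX : forall i j, measurable_fun setT (fun w => X w i j).

Lemma measurable_norm2_mul (v : 'cV[R]_n) (c : R) : 0 <= c ->
  measurable [set w | norm2 (X w *m v) <= c].
Proof.
move=> c0; rewrite (_ : [set _ | _] =
    (fun w => \sum_i (\sum_j X w i j * v j 0) ^+ 2) @^-1` `]-oo, c ^+ 2]); last first.
  have E w : dot (X w *m v) (X w *m v) = \sum_i (\sum_j X w i j * v j 0) ^+ 2.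
    by rewrite dotE; apply: eq_bigr => i _; rewrite -expr2 mxE.
  by apply/seteqP; split=> w /=; rewrite norm2_le// E in_itv.
rewrite -[X in measurable X]setTI; apply: measurable_sum => // i.
apply: measurable_funX; apply: measurable_sum => j.
by apply: measurable_funM.
Qed.

Lemma measurable_spectral_norm_le (c : R) :
  measurable [set w | spectral_norm (X w) <= c].
Proof.
have [c0|c0] := leP 0 c; last first.
  rewrite (_ : [set _ | _] = set0); first exact: measurable0.
  by apply/seteqP; split => w //=; rewrite leNgt (lt_le_trans c0)// spectral_norm_ge0.
(* An enumeration of all rational vectors; numbers that encode none repeat the zero vector. *)
pose q (i : nat) : 'cV[rat]_n := odflt 0 (unpickle i).
rewrite (_ : [set _ | _] = \bigcap_i [set w |
    norm2 (X w *m map_mx ratr (q i)) <= c * norm2 (map_mx ratr (q i) : 'cV[R]_n)]); last first.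
  apply/seteqP; split => w /=.
    by move=> h i _ /=; rewrite (le_trans (spectral_normP _ _))// ler_wpM2r// norm2_ge0.
  move=> h; apply: spectral_norm_le_rational => // p.
  by have := h (pickle p) I; rewrite /= /q pickleK.
by apply: bigcapT_measurable => i; apply: measurable_norm2_mul; rewrite mulr_ge0// norm2_ge0.
Qed.

Lemma measurable_spectral_norm_ge (c : R) :
  measurable [set w | c <= spectral_norm (X w)].
Proof.
rewrite (_ : [set _ | _] = ~` \bigcup_i [set w | spectral_norm (X w) <= c - i.+1%:R^-1]).
  apply: measurableC; apply: bigcupT_measurable => i; exact: measurable_spectral_norm_le.
apply/seteqP; split => w /=.
  by move=> h [i _] /=; apply/negP; rewrite -ltNge (lt_le_trans _ h)// gtrBl invr_gt0.
move=> h; rewrite leNgt; apply/negP => lt; apply: h.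
have /ltr_add_invr [i hi] := lt.
by exists i => //=; rewrite lerBrDr ltW.
Qed.

End measurable_spectral_norm.

(** * Means and second moments *)

Section mean_calculus.
Local Open Scope ereal_scope.
Context d {T : measurableType d} {R : realType} (P : probability T R).

(** Integrability is carried along with the value because additivity of the integral requires it. *)
Definition has_mean (f : T -> R) (v : R) :=
  P.-integrable setT (EFin \o f) /\ \int[P]_w (f w)%:E = v%:E.

Lemma has_mean_cst c : has_mean (fun=> c) c.
Proof.
split; first exact: finite_measure_integrable_cst.
by rewrite integral_cst// [X in _ * X](@probability_setT _ _ _ P) mule1.
Qed.

Lemma has_meanD f g u v : has_mean f u -> has_mean g v ->
  has_mean (fun w => f w + g w)%R (u + v)%R.
Proof.
move=> [fi fE] [gi gE]; split; first exact: (integrableD measurableT fi gi).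
by under eq_integral do rewrite EFinD; rewrite integralD//= fE gE.
Qed.

Lemma has_meanZ c f u : has_mean f u -> has_mean (fun w => c * f w)%R (c * u)%R.
Proof.
move=> [fi fE]; split; first exact: (integrableZl measurableT c fi).
by under eq_integral do rewrite EFinM; rewrite integralZl//= fE.
Qed.

Lemma has_mean_sum (I : Type) (s : seq I) (f : I -> T -> R) (u : I -> R) :
  (forall i, has_mean (f i) (u i)) ->
  has_mean (fun w => \sum_(i <- s) f i w)%R (\sum_(i <- s) u i)%R.
Proof.
move=> h; elim: s => [|i s IH].
  rewrite big_nil; have := has_mean_cst 0; congr has_mean.
  by apply/funext => w; rewrite big_nil.
rewrite big_cons; have := has_meanD (h i) IH; congr has_mean.
by apply/funext => w; rewrite big_cons.
Qed.

Lemma has_mean_eq f g u : (forall w, f w = g w) -> has_mean f u -> has_mean g u.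
Proof. by move=> fg; rewrite (_ : f = g)//; exact/funext. Qed.

Lemma has_mean_expectation f u : has_mean f u -> 'E_P[f] = u%:E.
Proof. by move=> [_ fE]; rewrite unlock. Qed.

Lemma has_mean_indepM (f g : {RV P >-> R}) u v :
  (forall A B : set R, measurable A -> measurable B ->
    P ((f @^-1` A) `&` (g @^-1` B)) = P (f @^-1` A) * P (g @^-1` B)) ->
  has_mean f u -> has_mean g v -> has_mean (fun w => f w * g w)%R (u * v)%R.
Proof.
move=> ind [fi fE] [gi gE]; split; first exact: integrable_indepM.
by rewrite integral_indepM// fE gE.
Qed.

(** The integral is the difference of those of the positive and negative parts, and is finite only
    if both are. *)
Lemma mean_fin_has_mean (f : T -> R) v : measurable_fun setT f ->
  \int[P]_w (f w)%:E = v%:E -> has_mean f v.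
Proof.
move=> mf fE; split=> //; apply/integrableP; split; first exact/measurable_EFinP.
by rewrite integral_fin_num_abs// fE.
Qed.

Lemma mutually_independent_pair (I : finType) (Y : I -> {RV P >-> R}) i j :
  mutually_independent Y -> i != j ->
  forall A B : set R, measurable A -> measurable B ->
    P ((Y i @^-1` A) `&` (Y j @^-1` B)) = P (Y i @^-1` A) * P (Y j @^-1` B).
Proof.
move=> Yi ij A B mA mB; apply: (block_indep Yi (J := [set i]%SET) (J' := [set j]%SET)).
- by rewrite finset.disjoints1 inE.
- rewrite -[X in <<s _ >> X]setTI.
  by apply: (measurable_block_coord (P := P)) => //; rewrite inE.
- rewrite -[X in <<s _ >> X]setTI.
  by apply: (measurable_block_coord (P := P)) => //; rewrite inE.
Qed.

Lemma standardized_moments (X : T -> R) v : measurable_fun setT X ->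
  'E_P[X] = 0 -> 'V_P[X] = v%:E ->
  has_mean X 0 /\ has_mean (fun w => X w * X w)%R v.
Proof.
move=> mX E0 V; have m1 : has_mean X 0.
  by apply: mean_fin_has_mean => //; move: E0; rewrite unlock.
split=> //; apply: mean_fin_has_mean; first exact: measurable_funM.
rewrite -V /variance covariance.unlock E0 expectation.unlock; apply: eq_integral => w _ /=.
by rewrite !fctE /= !subr0.
Qed.

Lemma white_noise_moments n (xi : 'I_n -> {RV P >-> R}) sd : white_noise xi sd ->
  (forall i, has_mean (xi i) 0) /\
  forall i j, has_mean (fun w => xi i w * xi j w)%R ((i == j)%:R * sd ^+ 2)%R.
Proof.
case=> ind E0 V; have m i := standardized_moments (@measurable_funP _ _ _ _ _ (xi i)) (E0 i) (V i).
split=> [i|i j]; first by have [] := m i.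
have [<-|ij] := eqVneq; first by rewrite mul1r; have [] := m i.
rewrite mul0r -[X in has_mean _ X](mulr0 0%R); apply: has_mean_indepM.
- exact: mutually_independent_pair.
- by have [] := m i.
- by have [] := m j.
Qed.

End mean_calculus.

Section mean_affine_norm.
Context d {T : measurableType d} {R : realType} (P : probability T R).

(** In the expanded square the linear term is centred and uncorrelated noise keeps only the diagonal
    of [G^T G]. With [G = - 1] this computes the loss; with [G] a projection it is the bias-variance
    decomposition. *)
Lemma mean_affine_norm m n (xi : 'I_n -> {RV P >-> R}) sd (u : 'cV[R]_m) (G : 'M[R]_(m, n)) :
  white_noise xi sd ->
  has_mean P (fun w => norm2 (u + G *m (\col_i xi i w)) ^+ 2)%R
    (norm2 u ^+ 2 + sd ^+ 2 * \tr (G^T *m G))%R.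
Proof.
move=> /white_noise_moments[m1 m2].
have := has_meanD (has_meanD (has_mean_cst P (norm2 u ^+ 2))
  (has_meanZ 2 (has_mean_sum (index_enum _) (fun j => has_meanZ ((G^T *m u) j 0) (m1 j)))))
  (has_mean_sum (index_enum _) (fun i => has_mean_sum (index_enum _)
    (fun j => has_meanZ ((G^T *m G) i j) (m2 i j)))).
set a := (\sum_(i <- _) _ * 0)%R.
have -> : a = 0%R by apply: big1 => i _; rewrite mulr0.
rewrite mulr0 addr0.
have -> : (\sum_i \sum_j (G^T *m G) i j * ((i == j)%:R * sd ^+ 2) = sd ^+ 2 * \tr (G^T *m G))%R.
  rewrite /mxtrace mulr_sumr; apply: eq_bigr => i _.
  rewrite (bigD1 i)//= eqxx mul1r mulrC big1 ?addr0// => j ji.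
  by rewrite eq_sym (negbTE ji) mul0r mulr0.
apply: has_mean_eq => w; set x := \col_i _.
have -> : norm2 (u + G *m x) ^+ 2 =
    norm2 u ^+ 2 + 2 * dot (G^T *m u) x + dot x (G^T *m G *m x).
  by rewrite !norm2_sqr dotDl !dotDr -mulmxA -dot_mull [dot u (G *m x)]dotC dot_mull [dot x _]dotC; ring.
congr (_ + _ * _ + _); rewrite dotE; apply: eq_bigr => i _; rewrite [x i 0]mxE//.
rewrite [(_ *m x) i 0]mxE mulr_sumr.
by apply: eq_bigr => j _; rewrite [x j 0]mxE; ring.
Qed.

End mean_affine_norm.

(** * Left sketching *)

Section fixed_design.
Context {R : realType} (n d : nat) (A : 'M[R]_(n, d)).
Context (Y : 'M[R]_(d, n)).
Hypothesis AY : penrose A Y.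
Context dX (TX : measurableType dX) (PX : probability TX R).
Context (f : 'cV[R]_n) (xi : 'I_n -> {RV PX >-> R}) (sd : R).
Hypotheses (n_gt0 : (0 < n)%N) (noise : white_noise xi sd).

Let b := response f xi.
Let x := min_norm_optimum PX A b.
Let n_gt0r : 0 < n%:R :> R. Proof. by rewrite ltr0n. Qed.

Lemma responseE w : b w = f + \col_i xi i w.
Proof. by apply/colP => i; rewrite !mxE. Qed.

Lemma mean_lossE y :
  mean_loss PX A b y = ((norm2 (A *m y - f) ^+ 2 + sd ^+ 2 * n%:R) / n%:R)%:E.
Proof.
rewrite /mean_loss; apply: has_mean_expectation.
have := has_meanZ n%:R^-1 (mean_affine_norm (A *m y - f) (- 1%:M) noise).
have -> : (- 1%:M)^T *m (- 1%:M) = 1%:M :> 'M[R]_n.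
  by rewrite [_^T]linearN /= trmx1 mulNmx mul1mx opprK.
rewrite mxtrace1 mulrC.
apply: has_mean_eq => w; rewrite mulrC mulNmx mul1mx responseE.
by rewrite opprD addrA.
Qed.

Lemma mean_loss_leE y z :
  (mean_loss PX A b y <= mean_loss PX A b z)%E = (norm2 (A *m y - f) <= norm2 (A *m z - f)).
Proof.
rewrite !mean_lossE lee_fin ler_pM2r ?invr_gt0// lerD2r.
by rewrite ler_sqr ?nnegrE ?norm2_ge0.
Qed.

Lemma mean_loss_minE y : (forall z, (mean_loss PX A b y <= mean_loss PX A b z)%E) <->
  A *m y = A *m (Y *m f).
Proof.
split=> [h|Ay z].
  have := h (Y *m f); rewrite mean_loss_leE norm2_ler (penrose_pythagoras AY f y) !mulmxA.
  rewrite gerDr => h0; apply/subr0_eq/eqP; rewrite -dot_eq0 eq_le h0 dot_ge0//.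
by rewrite mean_loss_leE Ay mulmxA penrose_min.
Qed.

(** Only the image [A x] matters later, but [xget] needs a witness. It is [Y f]: every minimiser [y]
    satisfies [Y f = Y A y], the projection of [y] onto the range of [Y], hence is at least as
    long. *)
Lemma min_norm_optimumP : A *m x = A *m (Y *m f).
Proof.
apply/mean_loss_minE; rewrite /x /min_norm_optimum.
case: xgetP => [x' _ [h _]//|/(_ (Y *m f))]; case; split.
  exact/mean_loss_minE.
move=> y /mean_loss_minE Ay.
have YA : penrose Y A by case: AY => h1 h2 h3 h4; split.
have -> : Y *m f = Y *m A *m y.
  by rewrite -[RHS]mulmxA Ay !mulmxA; case: AY => _ ->.
exact: penrose_norm_le.
Qed.

(** The part of [f] orthogonal to the columns of [A] is killed by [Q], whose range lies in that
    column space; hence [Q f = Q A x], and the constant part of the error is pure bias. *)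
Lemma excess_risk_penrose k (M : 'M[R]_(d, k)) :
  penrose (A *m M) (Defs.pinv (A *m M)) ->
  let Q := A *m M *m Defs.pinv (A *m M) in
  excess_risk PX A b (fun w => sketched_solution A M (b w)) =
  (dot (Q *m (A *m x) - A *m x) (Q *m (A *m x) - A *m x) / n%:R + sd ^+ 2 * \tr Q / n%:R)%:E.
Proof.
move=> pM Q; rewrite /excess_risk; apply: has_mean_expectation.
have QQ : Q^T *m Q = Q.
  by case: pM => XYX _ Qt _; rewrite Qt {2}/Q (mulmxA Q) XYX.
have Qf : Q *m f = Q *m (A *m x).
  rewrite min_norm_optimumP; apply/subr0_eq; rewrite -mulmxBr.
  case: pM => _ _ Qt _; rewrite -[Q]Qt /Q -mulmxA trmx_mul trmx_mul -!mulmxA.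
  have := penrose_normal AY f; rewrite -[A *m Y *m f]mulmxA => h.
  by rewrite -[f - _]opprB !mulmxN h !mulmx0 oppr0.
have := has_meanZ n%:R^-1 (mean_affine_norm (Q *m f - A *m x) Q noise).
rewrite QQ Qf norm2_sqr mulrDr ![n%:R^-1 * _]mulrC.
apply: has_mean_eq => w; rewrite mulrC -Qf; congr (norm2 _ ^+ 2 / _).
by rewrite responseE /sketched_solution !mulmxA -/Q mulmxDr addrAC.
Qed.

End fixed_design.

(** The denominator [sigma_1^2] of the relative gap cancels against the squared spectral norm. *)
Lemma sketch_accuracy_svd {R : realType} n d (A : 'M[R]_(n, d)) U s V k nu :
  thin_svd A U s V -> sigma A k.+1 < sigma A k ->
  sketch_accuracy A k nu * spectral_norm A ^+ 2 =
  nu * (Num.sqrt (1 + nu ^+ 2))^-1 / (1 + nu * (Num.sqrt (1 + nu ^+ 2))^-1) *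
  (nth0 s k.-1 ^+ 2 - nth0 s k ^+ 2).
Proof.
move=> svdA; rewrite /sketch_accuracy /gap !(sigma_svd _ svdA) (spectral_norm_svd svdA)/= => h.
have s0 : 0 < nth0 s 0.
  apply: lt_le_trans (nth0_anti svdA (leq0n k.-1)).
  exact: le_lt_trans (nth0_ge0 svdA k) h.
by rewrite -mulrA divfK// expf_neq0// gt_eqF.
Qed.

(** Guards against [first_cols] padding with zeros when the sketch has too few rows. A kernel vector
    [x] of [B] in the leading subspace of [A] would satisfy
    [sigma_k^2 |x|^2 <= |A x|^2 <= |E| |x|^2]. *)
Lemma gram_close_rank {R : realType} n m d (A : 'M[R]_(n, d)) (B : 'M[R]_(m, d)) U s V k :
  thin_svd A U s V -> (0 < k <= minn n d)%N ->
  spectral_norm (B^T *m B - A^T *m A) < nth0 s k.-1 ^+ 2 -> (k <= minn m d)%N.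
Proof.
move=> svdA /andP[k0 kA] h.
suff : row_free (B *m first_cols k V)^T.
  move=> /eqP rk; have : (\rank (B *m first_cols k V)^T <= \rank B)%N.
    by rewrite mxrank_tr mxrankM_maxl.
  by rewrite rk => /leq_trans; apply; rewrite leq_min rank_leq_row rank_leq_col.
rewrite -kermx_eq0; apply/rowV0P => u /sub_kermxP uX; apply/eqP/negP => /negP u0.
have VV := first_cols_svd_isometry svdA kA.
set x := first_cols k V *m u^T.
have x_gt0 : 0 < dot x x by rewrite (dot_isometry _ _ VV) lt0r dot_eq0 dot_ge0 trmx_eq0 u0.
have Bx : B *m x = 0 by apply: trmx_inj; rewrite mulmxA trmx_mul trmxK uX trmx0.
have Ax : nth0 s k.-1 ^+ 2 * dot x x <= dot (A *m x) (A *m x).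
  by have := svd_norm_ge svdA kA x k0; rewrite [_^T *m x]mulmxA VV mul1mx (dot_isometry _ _ VV).
have := dot_gram_diff A B x; rewrite Bx dot0l sub0r => e.
have := gram_diff_ge A B x; rewrite -e lerN2 => /(le_trans Ax).
by rewrite ler_pM2r// leNgt h.
Qed.

Lemma rank_le_min {R : realType} n d (A : 'M[R]_(n, d)) : (\rank A <= minn n d)%N.
Proof. by rewrite leq_min rank_leq_row rank_leq_col. Qed.

Lemma measurable_gram_diff {R : realType} dS (TS : measurableType dS) (PS : probability TS R)
  s n d (S : random_matrix PS s n) (A : 'M[R]_(n, d)) i j :
  measurable_fun setT (fun w => (A^T *m (mx_at S w)^T *m mx_at S w *m A - A^T *m A) i j).
Proof.
rewrite (_ : (fun w => _) = (fun w => \sum_l (\sum_p A p i * S l p w) *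
    (\sum_p S l p w * A p j) - (A^T *m A) i j)).
  apply: measurable_funB => //; apply: measurable_sum => l; apply: measurable_funM.
    by apply: measurable_sum => p; apply: measurable_funM.
  by apply: measurable_sum => p; apply: measurable_funM.
apply/funext => w; rewrite [LHS]mxE [X in _ + X]mxE; congr (_ - _).
rewrite -mulmxA [LHS]mxE; apply: eq_bigr => l _.
by rewrite !mxE; congr (_ * _); apply: eq_bigr => p _; rewrite !mxE.
Qed.

(** The complement of the bad Gram event serves as the measurable inner event; on it the whole
    conclusion is deterministic. *)
Lemma left_sketching {R : realType} (n d : nat) (A : 'M[R]_(n, d)) (k : nat) (nu delta : R) :
  (1 <= k <= \rank A)%N -> sigma A k.+1 < sigma A k ->
  0 < nu < 2^-1 -> 0 < delta < 2^-1 ->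
  forall (dS : measure_display) (TS : measurableType dS)
    (PS : probability TS R) (s : nat) (S : random_matrix PS s n)
    (dX : measure_display) (TX : measurableType dX) (PX : probability TX R)
    (f : 'cV[R]_n) (xi : 'I_n -> {RV PX >-> R}) (sd : R),
  white_noise xi sd ->
  gram_property S A (sketch_accuracy A k nu) delta ->
  forall U sv V, thin_svd A U sv V ->
  let b := response f xi in
  with_prob_ge PS (1 - delta) [set w | (k <= minn s d)%N /\
    forall U' sv' V', thin_svd (mx_at S w *m A) U' sv' V' ->
    let M := first_cols k V' in
    (forall w', approx_pcr A V k (b w') (sigma A k.+1 / sigma A k * nu)
       (nu / ((Num.sqrt (1 - nu ^+ 2) - nu) * sigma A k))
       (sketched_solution A M (b w'))) /\
    (excess_risk PX A b (fun w' => sketched_solution A M (b w')) <=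
     ((1 + nu) * norm2 (min_norm_optimum PX A b) ^+ 2 * sigma A k.+1 ^+ 2
        / n%:R + sd ^+ 2 * k%:R / n%:R)%:E)%E].
Proof.
move=> /andP[k0 krk] gap_gt0 /andP[nu0 nu2] _ dS TS PS m S dX TX PX f xi sd noise.
set eps := sketch_accuracy A k nu => gramS U s V svdA b.
have kA : (k <= minn n d)%N := leq_trans krk (rank_le_min A).
have n0 : (0 < n)%N by rewrite (leq_trans k0)// (leq_trans kA)// geq_minl.
pose G w := A^T *m (mx_at S w)^T *m mx_at S w *m A - A^T *m A.
have mG i j : measurable_fun setT (fun w => G w i j) by exact: measurable_gram_diff.
pose Bad := [set w | eps * spectral_norm A ^+ 2 <= spectral_norm (G w)].
have mBad : measurable Bad by exact: measurable_spectral_norm_ge.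
exists (~` Bad); split; first exact: measurableC.
  move=> w /= /negP; rewrite -ltNge => Gw.
  have BBE : G w = (mx_at S w *m A)^T *m (mx_at S w *m A) - A^T *m A.
    by rewrite /G trmx_mul !mulmxA.
  rewrite BBE (sketch_accuracy_svd _ svdA)// in Gw.
  have sk1 : sigma A k.+1 = nth0 s k by rewrite (sigma_svd _ svdA).
  have sk : sigma A k = nth0 s k.-1 by rewrite (sigma_svd _ svdA).
  rewrite sk1 sk in gap_gt0 *.
  set c := nu * _ in Gw.
  have c0 : 0 < c by rewrite mulr_gt0// invr_gt0 sqrtr_gt0 ltr_wpDr ?sqr_ge0.
  have lo0 := nth0_ge0 svdA k.
  have hi0 := le_lt_trans lo0 gap_gt0.
  have kB : (k <= minn m d)%N.
    apply: (gram_close_rank svdA); first by rewrite k0.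
    apply: lt_le_trans Gw _.
    apply: le_trans (_ : 1 * nth0 s k.-1 ^+ 2 <= _); last by rewrite mul1r.
    apply: ler_pM.
    - by rewrite divr_ge0 ?addr_ge0 ?(ltW c0).
    - by rewrite subr_ge0 ler_sqr ?nnegrE ?(ltW gap_gt0)// ltW.
    - by rewrite ler_pdivrMr ?mul1r ?lerDr ?addr_gt0.
    - by rewrite gerBl sqr_ge0.
  split=> // U' s' V' svdB; pose M := first_cols k V'; split=> [w'|].
    by apply: (sketched_approx_pcr svdA svdB k0 kA kB erefl erefl erefl gap_gt0 nu0 Gw).
  have pM := sketch_penrose svdA svdB k0 kA kB erefl erefl erefl gap_gt0 nu0 Gw.
  rewrite (excess_risk_penrose (svd_penrose svdA) f n0 noise pM) lee_fin.
  rewrite (sketch_trace svdA svdB k0 kA kB erefl erefl erefl gap_gt0 nu0 Gw) lerD2r.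
  rewrite ler_pM2r ?invr_gt0 ?ltr0n//.
  apply: le_trans (sketch_bias svdA svdB k0 kA kB erefl erefl erefl gap_gt0 nu0 Gw _ erefl) _.
  rewrite ler_wpM2r ?sqr_ge0// ler_wpM2r ?sqr_ge0// lerD2l expr2 ler_piMr ?(ltW nu0)//.
  by apply: ltW (lt_trans nu2 _); rewrite invf_lt1 ?ltr1n.
rewrite probability_setC// EFinB leeB//.
Qed.

(** * CountSketch *)

Section sign_average.
Context {R : realType} (s n : nat).
Hypothesis s_gt0 : (0 < s)%N.

(** Row and sign of the nonzero entry of each column: the finite sample space of a CountSketch. *)
Definition configuration := {ffun 'I_n -> 'I_s * bool}.

Definition configuration_mx (p : configuration) : 'M[R]_(s, n) :=
  \matrix_(i, j) ((-1) ^+ (p j).2 * (i == (p j).1)%:R).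

Definition gram_error (p : configuration) (i j : 'I_n) : R :=
  ((configuration_mx p)^T *m configuration_mx p - 1%:M) i j.

Lemma gram_errorE p i j : gram_error p i j =
  (i != j)%:R * ((-1) ^+ (p i).2 * (-1) ^+ (p j).2 * ((p i).1 == (p j).1)%:R).
Proof.
have e : ((configuration_mx p)^T *m configuration_mx p) i j =
    (-1) ^+ (p i).2 * (-1) ^+ (p j).2 * ((p i).1 == (p j).1)%:R.
  rewrite mxE (bigD1 (p i).1)//= big1 ?addr0.
    by rewrite !mxE eqxx mulr1 mulrA.
  by move=> l li; rewrite !mxE (negbTE li) mulr0 mul0r.
rewrite /gram_error [LHS]mxE e [X in _ + X]mxE [X in _ - X]mxE.
have [->|ij] := eqVneq i j; last by rewrite subr0 mul1r.
by rewrite eqxx mulr1 mul0r -expr2 sqrr_sign subrr.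
Qed.

Definition flip (l : 'I_n) (p : configuration) : configuration :=
  [ffun j => if j == l then ((p j).1, ~~ (p j).2) else p j].

Lemma flipK l : involutive (flip l).
Proof.
by move=> p; apply/ffunP => j; rewrite !ffunE; case: eqP => //= _; rewrite negbK; case: (p j).
Qed.

Lemma gram_error_flip l p i j : gram_error (flip l p) i j =
  (-1) ^+ (i == l) * (-1) ^+ (j == l) * gram_error p i j.
Proof.
rewrite !gram_errorE !ffunE.
have h k : (-1) ^+ (if k == l then ((p k).1, ~~ (p k).2) else p k).2 =
    (-1) ^+ (k == l) * (-1) ^+ (p k).2 :> R.
  by case: eqP => _; rewrite /= ?mul1r// expr1 signrN mulN1r.
have h' k : (if k == l then ((p k).1, ~~ (p k).2) else p k).1 = (p k).1 by case: ifP.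
by rewrite !h !h'; ring.
Qed.

Let corr (a b : 'I_n * 'I_n) : R :=
  \sum_p gram_error p a.1 a.2 * gram_error p b.1 b.2.

Let swap (a : 'I_n * 'I_n) := (a.2, a.1).

(** When the two index pairs differ as unordered pairs of distinct columns, some column occurs an
    odd number of times among the four indices. Flipping its sign is a bijection of configurations
    that negates every term of the sum. *)
Lemma gram_error_corr0 a b : b != a -> b != (a.2, a.1) -> corr a b = 0.
Proof.
case: a b => [i j] [i' j'] /= ba bs.
have [ij|ij] := eqVneq i j.
  by rewrite /corr big1// => p _; rewrite gram_errorE ij eqxx !mul0r.
have [ij'|ij'] := eqVneq i' j'.
  by rewrite /corr big1// => p _; rewrite mulrC gram_errorE ij' eqxx !mul0r.
have odd_flip l : (-1) ^+ (i == l) * (-1) ^+ (j == l) * ((-1) ^+ (i' == l) * (-1) ^+ (j' == l)) = -1 :> R ->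
    corr (i, j) (i', j') = 0.
  move=> hl; have : corr (i, j) (i', j') = - corr (i, j) (i', j').
    rewrite {1}/corr (reindex_inj (inv_inj (flipK l)))/= -mulN1r mulr_sumr.
    apply: eq_bigr => p _; rewrite !gram_error_flip /=.
    by rewrite mulrACA hl.
  by move=> h; lra.
have [ii'|ii'] := eqVneq i' i; [|have [ji'|ji'] := eqVneq i' j].
- apply: (odd_flip j); rewrite ii' eqxx (negbTE ij).
  have -> : (j' == j) = false by apply/negbTE; apply: contra ba => /eqP ->; rewrite ii'.
  by rewrite !mulr1 mul1r.
- apply: (odd_flip i); rewrite ji' eqxx [j == i]eq_sym (negbTE ij).
  have -> : (j' == i) = false by apply/negbTE; apply: contra bs => /eqP ->; rewrite ji'.
  by rewrite !mulr1.
- apply: (odd_flip i'); rewrite eqxx ![_ == i']eq_sym (negbTE ii') (negbTE ji') (negbTE ij').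
  by rewrite !mulr1 !mul1r.
Qed.

Let N : R := (s%:R * 2) ^+ n.

(** Splitting a collision by its common row makes each summand a product over columns, so the sum
    over configurations factors. [N] is the number of configurations. *)
Lemma collision_count i j : i != j ->
  \sum_(p : configuration) ((p i).1 == (p j).1)%:R = N / s%:R :> R.
Proof.
move=> ij; have sR : s%:R != 0 :> R by rewrite pnatr_eq0 -lt0n.
pose F (a : 'I_s) (l : 'I_n) (x : 'I_s * bool) : R :=
  if (l == i) || (l == j) then (x.1 == a)%:R else 1.
transitivity (\sum_(a : 'I_s) \sum_(p : configuration) \prod_l F a l (p l)).
  rewrite exchange_big/=; apply: eq_bigr => p _.
  have FE a : \prod_l F a l (p l) = ((p i).1 == a)%:R * ((p j).1 == a)%:R.
    rewrite (bigD1 i)//= (bigD1 j)/=; last by rewrite eq_sym.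
    rewrite big1; last first.
      by move=> l /andP[li lj]; rewrite /F (negbTE li) (negbTE lj).
    by rewrite /F !eqxx orbT /= mulr1.
  under eq_bigr do rewrite FE.
  rewrite (bigD1 (p i).1)//= eqxx mul1r big1 ?addr0; first by rewrite eq_sym.
  by move=> a ai; rewrite eq_sym (negbTE ai) mul0r.
transitivity (\sum_(a : 'I_s) N / s%:R ^+ 2); last first.
  by rewrite sumr_const card_ord -[LHS]mulr_natr expr2 invfM -!mulrA mulVf// mulr1.
apply: eq_bigr => a _; rewrite -bigA_distr_bigA/=.
have FE l : \sum_x F a l x = (s%:R * 2) * ((if l == i then s%:R^-1 else 1) * (if l == j then s%:R^-1 else 1)).
  rewrite /F; case: (eqVneq l i) => [->|li]; rewrite ?(negbTE ij) ?mulr1/=.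
    rewrite [RHS]mulrAC mulfV// mul1r.
    rewrite (_ : \sum_x _ = \sum_b \sum_(e : bool) (b == a)%:R :> R); last by rewrite pair_big.
    rewrite (bigD1 a)//= eqxx [X in _ + X]big1 ?addr0; first by rewrite sumr_const card_bool.
    by move=> b ba; rewrite (negbTE ba) sumr_const mul0rn.
  case: (eqVneq l j) => [_|_] /=; rewrite mul1r ?mulr1.
    rewrite [RHS]mulrAC mulfV// mul1r.
    rewrite (_ : \sum_x _ = \sum_b \sum_(e : bool) (b == a)%:R :> R); last by rewrite pair_big.
    rewrite (bigD1 a)//= eqxx [X in _ + X]big1 ?addr0; first by rewrite sumr_const card_bool.
    by move=> b ba; rewrite (negbTE ba) sumr_const mul0rn.
  by rewrite sumr_const card_prod card_ord card_bool natrM.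
under eq_bigr do rewrite FE.
have prod1 (k : 'I_n) : \prod_l (if l == k then s%:R^-1 else 1) = s%:R^-1 :> R.
  by rewrite (bigD1 k)//= eqxx big1 ?mulr1// => l /negbTE ->.
by rewrite big_split/= prodr_const card_ord big_split/= !prod1 expr2 invfM.
Qed.

Lemma gram_error_corr a b : `|corr a b| <= N / s%:R * ((b == a)%:R + (b == swap a)%:R).
Proof.
have N0 : 0 <= N / s%:R by rewrite divr_ge0// exprn_ge0// mulr_ge0.
have [/andP[ba bs]|] := boolP ((b != a) && (b != swap a)).
  by rewrite gram_error_corr0// normr0 (negbTE ba) (negbTE bs) addr0 mulr0.
rewrite negb_and !negbK => h.
apply: le_trans (_ : N / s%:R * 1 <= _); last first.
  by rewrite ler_wpM2l//; case/orP: h => ->; rewrite ?lerDl ?lerDr.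
rewrite mulr1; have [ij|ij] := eqVneq a.1 a.2.
  by rewrite /corr big1 ?normr0// => p _; rewrite gram_errorE ij eqxx !mul0r.
rewrite -(collision_count ij); apply: le_trans (ler_norm_sum _ _ _) _.
apply: ler_sum => p _; rewrite !gram_errorE !normrM !normrX !normrN1 !expr1n !mul1r !normr_nat.
have h2 (x y : bool) : x%:R * y%:R <= 1 :> R by case: x; case: y; rewrite ?mulr0 ?mul0r ?mulr1.
rewrite ij mul1r ler_piMr//; exact: h2.
Qed.

(** A Schur test: [c a * c b] is at most the mean of the two squares, and each row of the
    correlation matrix has absolute sum at most [2 * (N / s)], since a pair correlates only with
    itself and its swap. *)
Lemma gram_error_average (c : 'I_n * 'I_n -> R) :
  \sum_p (\sum_a gram_error p a.1 a.2 * c a) ^+ 2 <= 2 * (N / s%:R) * \sum_a c a ^+ 2.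
Proof.
have -> : \sum_p (\sum_a gram_error p a.1 a.2 * c a) ^+ 2 =
    \sum_a \sum_b c a * c b * corr a b.
  rewrite /corr; under [RHS]eq_bigr do under eq_bigr do rewrite mulr_sumr.
  under [RHS]eq_bigr do rewrite exchange_big.
  rewrite [RHS]exchange_big/=; apply: eq_bigr => p _.
  rewrite expr2 mulr_suml; apply: eq_bigr => a _; rewrite mulr_sumr.
  by apply: eq_bigr => b _; ring.
have N0 : 0 <= N / s%:R by rewrite divr_ge0// exprn_ge0// mulr_ge0.
have corrC a b : corr a b = corr b a by apply: eq_bigr => p _; rewrite mulrC.
apply: le_trans (_ : \sum_a \sum_b (2^-1 * (c a ^+ 2 * `|corr a b|) + 2^-1 * (c b ^+ 2 * `|corr b a|)) <= _).
  apply: ler_sum => a _; apply: ler_sum => b _; rewrite (corrC b a).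
  apply: le_trans (ler_norm _) _; rewrite normrM -mulrDr -mulrDl mulrA ler_wpM2r// normrM.
  have := sqr_ge0 (`|c a| - `|c b|).
  rewrite -[c a ^+ 2]real_normK ?num_real// -[c b ^+ 2]real_normK ?num_real//; lra.
under eq_bigr do rewrite big_split/=.
rewrite big_split/= [X in _ + X]exchange_big/= -big_split/= mulr_sumr.
apply: ler_sum => a _; rewrite -mulr_sumr -mulrDl -mulr_sumr.
have -> : 2^-1 + 2^-1 = 1 :> R by lra.
rewrite mul1r [leRHS]mulrC ler_wpM2l ?sqr_ge0//.
apply: le_trans (ler_sum _ (fun b _ => gram_error_corr a b)) _.
have one x : \sum_(b : 'I_n * 'I_n) (b == x)%:R = 1 :> R.
  by rewrite (bigD1 x)//= eqxx big1 ?addr0// => b /negbTE ->.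
by rewrite -mulr_sumr big_split/= !one mulrC.
Qed.

End sign_average.

(** Entry [(a, b)] of the error is a linear form in the entries of [S^T S - 1] with coefficients
    [A i a * A j b], whose squares sum over all indices to [|A|_F^4]. *)
Lemma frobenius_average {R : realType} (s n d : nat) (A : 'M[R]_(n, d)) : (0 < s)%N ->
  \sum_p frobenius (A^T *m (configuration_mx p : 'M[R]_(s, n))^T *m configuration_mx p *m A
    - A^T *m A) ^+ 2 <= 2 * ((s%:R * 2) ^+ n / s%:R) * (frobenius A ^+ 2) ^+ 2.
Proof.
move=> s0.
have E p : frobenius (A^T *m (configuration_mx p : 'M[R]_(s, n))^T *m configuration_mx p *m A
    - A^T *m A) ^+ 2 =
    \sum_a \sum_b (\sum_c gram_error p c.1 c.2 * (A c.1 a * A c.2 b)) ^+ 2.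
  rewrite frobenius_sqr; apply: eq_bigr => a _; apply: eq_bigr => b _; congr (_ ^+ 2).
  have -> : A^T *m (configuration_mx p : 'M[R]_(s, n))^T *m configuration_mx p *m A - A^T *m A =
      A^T *m ((configuration_mx p : 'M[R]_(s, n))^T *m configuration_mx p - 1%:M) *m A.
    by rewrite mulmxBr mulmxBl mulmx1 !mulmxA.
  rewrite mxE (eq_bigr (fun j => \sum_i gram_error p i j * (A i a * A j b))); last first.
    move=> j _; rewrite [X in X * _]mxE mulr_suml; apply: eq_bigr => i _.
    by rewrite [_^T a i]mxE /gram_error; ring.
  by rewrite exchange_big/= pair_big.
under eq_bigr do rewrite E.
rewrite exchange_big/=; under eq_bigr do rewrite exchange_big/=.
apply: le_trans (ler_sum _ (fun a _ => ler_sum _ (fun b _ => gram_error_average s0 _))) _.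
under eq_bigr do rewrite -mulr_sumr.
rewrite -mulr_sumr ler_wpM2l//.
have E2 a b : \sum_(c : 'I_n * 'I_n) (A c.1 a * A c.2 b) ^+ 2 =
    (\sum_i A i a ^+ 2) * (\sum_i A i b ^+ 2).
  rewrite -(pair_big xpredT xpredT (fun i j => (A i a * A j b) ^+ 2))/= mulr_suml.
  by apply: eq_bigr => i _; rewrite mulr_sumr; apply: eq_bigr => j _; rewrite exprMn.
under eq_bigr do under eq_bigr do rewrite E2.
under eq_bigr do rewrite -mulr_sumr.
by rewrite -mulr_suml frobenius_sqr exchange_big/= -expr2.
Qed.

Lemma sketch_accuracy_bounds {R : realType} n d (A : 'M[R]_(n, d)) k nu :
  (0 < k)%N -> sigma A k.+1 < sigma A k -> 0 < nu < 2^-1 ->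
  [/\ 0 < gap k A, gap k A <= 1, nu * gap k A / 2 <= sketch_accuracy A k nu &
      sketch_accuracy A k nu <= 1].
Proof.
move=> k0 gap_gt0 /andP[nu0 nu2].
have [U [s [V svdA]]] : exists U s V, thin_svd A U s V.
  have [k1|] := eqVneq (sigma A k) 0; last exact: sigma_gt0_svd.
  by apply: (@sigma_gt0_svd _ _ _ A k.+1); rewrite lt_eqF// -k1.
move: gap_gt0; rewrite /sketch_accuracy /gap !(sigma_svd _ svdA)/=.
set lo := nth0 s k; set hi := nth0 s k.-1; set top := nth0 s 0 => gap_gt0.
have lo0 : 0 <= lo := nth0_ge0 svdA k.
have hi0 : 0 < hi := le_lt_trans lo0 gap_gt0.
have hitop : hi <= top := nth0_anti svdA (leq0n k.-1).
have top0 : 0 < top := lt_le_trans hi0 hitop.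
have lohi : lo ^+ 2 < hi ^+ 2 by rewrite ltr_sqr ?nnegrE// ltW.
have hitop2 : hi ^+ 2 <= top ^+ 2 by rewrite ler_sqr ?nnegrE// ltW.
set g := _ / top ^+ 2.
have g0 : 0 < g by rewrite divr_gt0 ?subr_gt0// exprn_gt0.
have g1 : g <= 1.
  by rewrite ler_pdivrMr ?exprn_gt0// mul1r (le_trans _ hitop2)// gerBl sqr_ge0.
set r := Num.sqrt _.
have r0 : 0 < r by rewrite sqrtr_gt0 ltr_wpDr ?sqr_ge0.
have nunu : nu ^+ 2 < 4^-1.
  have := mulr_gt0 nu0 (_ : 0 < 2^-1 - nu); rewrite subr_gt0 => /(_ nu2); lra.
have r1 : 1 <= r by rewrite -[leLHS]sqrtr1 ler_wsqrtr// lerDl sqr_ge0.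
(* Together with [nu < 1/2] this gives [r + nu <= 2], the source of the factor 1/2 in the lower
   bound [nu * gap / 2]. *)
have r32 : r <= 3 / 2.
  rewrite -[leRHS]ger0_norm ?divr_ge0// -sqrtr_sqr ler_wsqrtr//; lra.
have E : nu / r / (1 + nu / r) = nu / (r + nu).
  have r_neq0 : r != 0 by rewrite gt_eqF.
  by rewrite -[X in X + nu / r](divff r_neq0) -mulrDl invf_div mulrA divfK.
rewrite E; split=> //.
  rewrite mulrAC ler_pM2r// ler_pM2l// lef_pV2 ?posrE ?addr_gt0//; lra.
have h : nu / (r + nu) <= 1 by rewrite ler_pdivrMr ?addr_gt0// mul1r lerDr ltW.
rewrite -[leRHS]mulr1; apply: ler_pM => //; last exact: ltW.
by rewrite divr_ge0 ?addr_ge0 ?(ltW nu0) ?(ltW r0).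
Qed.

Section countsketch_probability.
Local Open Scope ereal_scope.
Context {R : realType} (s n : nat) d (T : measurableType d) (P : probability T R)
  (S : random_matrix P s n).
Hypothesis S_cs : countsketch S.

Let E (p : configuration s n) := [set w | mx_at S w = configuration_mx p].

Let EE p : E p = [set w | forall j i, [set configuration_mx p i j] (S i j w)].
Proof.
apply/seteqP; split => w /=.
  by move=> /matrixP h j i; have := h i j; rewrite mxE.
by move=> h; apply/matrixP => i j; rewrite mxE h.
Qed.

Let mE p : measurable (E p).
Proof.
rewrite EE (_ : [set _ | _] =
    \big[setI/setT]_(j : 'I_n) \big[setI/setT]_(i : 'I_s) (S i j @^-1` [set configuration_mx p i j])).
  apply: bigsetI_measurable => j _; apply: bigsetI_measurable => i _.
  by rewrite -[X in measurable X]setTI; exact: measurable_funP.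
rewrite -bigcap_seq_cond; apply/seteqP; split => w /= h j.
  by move=> _; rewrite -bigcap_seq_cond => i _; exact: h.
move=> i; have := h j; rewrite /= mem_index_enum => /(_ isT).
by rewrite -bigcap_seq_cond => /(_ i); rewrite /= mem_index_enum; exact.
Qed.

Let PE p : P (E p) = ((s%:R * 2) ^- n)%:E.
Proof.
case: S_cs => s0 ind law; rewrite EE (ind (fun i j => [set configuration_mx p i j])); last first.
  by move=> i j; exact: measurable_set1.
rewrite (eq_bigr (fun=> (s%:R^-1 * 2^-1)%:E)).
  rewrite prodEFin prodr_const card_ord -exprVn invfM//.
move=> j _; rewrite -(law j (p j).1 (p j).2); congr (P _); apply/seteqP; split => w /=.
  move=> h; apply/matrixP => i e; rewrite !mxE [e]ord1 eqxx andbT mulrC.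
  by rewrite h mxE mulrC.
move=> h i; have := congr1 (fun M : 'cV_s => M i 0%R) h.
by rewrite !mxE eqxx andbT => ->.
Qed.

Lemma configuration_mx_inj : injective (@configuration_mx R s n).
Proof.
move=> p q /matrixP pq; apply/ffunP => j.
have := pq (p j).1 j; rewrite !mxE eqxx mulr1.
have [e|_] := eqVneq (p j).1 (q j).1; last first.
  by move/eqP; rewrite mulr0 signr_eq0.
rewrite mulr1 => /eqP; rewrite (inj_eq (@signr_inj _)) => /eqP e'.
by rewrite [p j]surjective_pairing [q j]surjective_pairing e e'.
Qed.

Let tE : trivIset setT E.
Proof.
apply/trivIsetP => p q _ _ pq; apply/seteqP; split => w //= -[]; rewrite /E /= => -> h.
by case/eqP: pq; exact: configuration_mx_inj.
Qed.

Let P_union (Q : pred (configuration s n)) :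
  P (\bigcup_(p in [set p | Q p]) E p) = ((\sum_(p | Q p) (s%:R * 2) ^- n)%R)%:E.
Proof.
rewrite measure_fin_bigcup//; [|exact: finite_finset|exact: sub_trivIset tE].
rewrite -sumEFin -[RHS]big_filter.
rewrite (_ : [set p | Q p] = [set` [seq p <- index_enum _ | Q p]]); last first.
  by apply/seteqP; split => p /=; rewrite mem_filter mem_index_enum andbT.
rewrite -fsbig_seq ?filter_uniq ?index_enum_uniq//.
by apply: eq_bigr => p _; exact: PE.
Qed.

(** The atoms of the configurations are disjoint with masses summing to one, so what lies outside
    them is a null set. *)
Lemma countsketch_event (Bad : set 'M[R]_(s, n)) :
  measurable [set w | Bad (mx_at S w)] ->
  P [set w | Bad (mx_at S w)] <=
  ((\sum_(p : configuration s n | `[< Bad (configuration_mx p) >]) (s%:R * 2) ^- n)%R)%:E.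
Proof.
case: S_cs => s0 _ _ mB; rewrite -P_union.
pose U := \bigcup_(p in [set p : configuration s n | xpredT p]) E p.
have mU : measurable U by apply: fin_bigcup_measurable => //; exact: finite_finset.
have PU : P (~` U) = 0.
  rewrite probability_setC// P_union sumr_const card_ffun card_prod card_ord card_bool card_ord.
  rewrite -[X in _ - X%:E]mulr_natl natrX natrM divff ?subee//.
  by rewrite expf_neq0// mulf_neq0// pnatr_eq0 -lt0n.
set V := \bigcup_(p in _) _.
have mV : measurable V by apply: fin_bigcup_measurable => //; exact: finite_finset.
rewrite -[leRHS](measureU0 mV (measurableC mU) PU); apply: le_measure.
- by rewrite inE.
- by rewrite inE; apply: measurableU => //; exact: measurableC.
move=> w /= Bw; have [[p _ Ep]|nU] := pselect (U w); last by right.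
by left; exists p => //=; apply/asboolP; rewrite -Ep.
Qed.

End countsketch_probability.

Lemma rank_gt0_neq0 {R : realType} n d (A : 'M[R]_(n, d)) k : (1 <= k <= \rank A)%N -> A != 0.
Proof. by case/andP => k0 kr; rewrite -mxrank_eq0 -lt0n (leq_trans k0). Qed.

Lemma countsketch_gram {R : realType} : exists2 C : R, 0 < C &
  forall (n d : nat) (A : 'M[R]_(n, d)) (k : nat) (nu delta : R),
    (1 <= k <= \rank A)%N -> sigma A k.+1 < sigma A k ->
    0 < nu < 2^-1 -> 0 < delta < 2^-1 ->
  forall (dS : measure_display) (TS : measurableType dS)
    (PS : probability TS R) (s : nat) (S : random_matrix PS s n),
    countsketch S ->
    C * (stable_rank A ^+ 2 / (gap k A ^+ 2 * nu ^+ 2 * delta)) <= s%:R ->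
    gram_property S A (sketch_accuracy A k nu) delta.
Proof.
(* 8 is 2, from the second moment of the Gram error, times 4, from squaring
   [eps >= nu * gap / 2]. *)
exists 8 => // n d A k nu delta kr gap_gt0 nu01 /andP[delta0 _] dS TS PS s S S_cs s_ge.
have s0 : (0 < s)%N by case: S_cs.
have sR : 0 < s%:R :> R by rewrite ltr0n.
have A0 := rank_gt0_neq0 kr; have A_gt0 := spectral_norm_gt0 A0.
have /andP[k0 _] := kr; have /andP[nu0 _] := nu01.
rewrite /gram_property; move: s_ge (sketch_accuracy_bounds k0 gap_gt0 nu01).
move: (sketch_accuracy A k nu) (gap k A) => eps g s_ge [g0 _ eps_ge _].
have ng0 : 0 < nu * g by exact: mulr_gt0.
have eps0 : 0 < eps by apply: lt_le_trans eps_ge; exact: divr_gt0.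
pose D (M : 'M[R]_(s, n)) := A^T *m M^T *m M *m A - A^T *m A.
pose t := eps * spectral_norm A ^+ 2.
have t0 : 0 < t by rewrite mulr_gt0// exprn_gt0.
apply: le_trans (countsketch_event S_cs (Bad := [set M | t <= spectral_norm (D M)]) _) _.
  by apply: measurable_spectral_norm_ge => i j; exact: measurable_gram_diff.
rewrite lee_fin.
have N0 : 0 < (s%:R * 2) ^+ n :> R by rewrite exprn_gt0// mulr_gt0.
apply: le_trans (_ : \sum_p (s%:R * 2) ^- n * (frobenius (D (configuration_mx p)) ^+ 2 / t ^+ 2) <= _).
  rewrite big_mkcond/=; apply: ler_sum => p _; case: asboolP => /= h.
    rewrite ler_peMr ?invr_ge0 ?(ltW N0)// ler_pdivlMr ?exprn_gt0// mul1r.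
    rewrite ler_sqr ?nnegrE ?frobenius_ge0 ?(ltW t0)//.
    exact: le_trans h (spectral_norm_le_frobenius _).
  by rewrite mulr_ge0 ?invr_ge0 ?(ltW N0)// divr_ge0 ?sqr_ge0.
rewrite -mulr_sumr -mulr_suml.
have := frobenius_average A s0; rewrite -/(D _) => avg.
apply: le_trans (_ : (s%:R * 2) ^- n *
  (2 * ((s%:R * 2) ^+ n / s%:R) * (frobenius A ^+ 2) ^+ 2 / t ^+ 2) <= _).
  by rewrite ler_wpM2l ?invr_ge0 ?(ltW N0)// ler_wpM2r// invr_ge0 sqr_ge0.
have -> : (s%:R * 2) ^- n * (2 * ((s%:R * 2) ^+ n / s%:R) * (frobenius A ^+ 2) ^+ 2 / t ^+ 2) =
    2 * stable_rank A ^+ 2 / (s%:R * eps ^+ 2).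
  rewrite /stable_rank /t; field.
  by rewrite ?gt_eqF// ?exprn_gt0.
rewrite ler_pdivrMr ?mulr_gt0 ?exprn_gt0//.
move: s_ge; rewrite mulrA ler_pdivrMr; last by apply: mulr_gt0 => //; apply: mulr_gt0; exact: exprn_gt0.
move=> s_ge.
have eps2 : (nu * g / 2) ^+ 2 <= eps ^+ 2.
  by rewrite ler_sqr ?nnegrE ?(ltW eps0)//; apply: divr_ge0 => //; exact: ltW.
have : delta * s%:R * (nu * g / 2) ^+ 2 <= delta * s%:R * eps ^+ 2.
  by rewrite ler_wpM2l// mulr_ge0// ltW.
lra.
Qed.

(** * Exponential moments *)

Section exponential_inequalities.
Context {R : realType}.
Implicit Types x y : R.

Lemma expR_le_quadratic x : x <= 2^-1 -> expR x <= 1 + x + 2 * x ^+ 2.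
Proof.
move=> x2; have h : 1 - x <= expR (- x) by rewrite expR_ge1Dx.
have x1 : 0 < 1 - x by lra.
have : expR x <= (1 - x)^-1.
  by rewrite -[x]opprK expRN lef_pV2 ?posrE ?expR_gt0// opprK.
move=> /le_trans; apply; rewrite -[leRHS]divr1 ler_pdivlMr// ler_pdivrMl//.
have := mulr_ge0 (sqr_ge0 x) (_ : 0 <= 1 - 2 * x); rewrite subr_ge0 => /(_ _) h2.
have : 0 <= x ^+ 2 * (1 - 2 * x) by apply: h2; lra.
lra.
Qed.

(** For a centred variable the bare linear term has mean zero, leaving the exponential of a
    square. *)
Lemma expR_le_id_sqr x : expR x <= x + expR (2 * x ^+ 2).
Proof.
have h2 := expR_ge1Dx (2 * x ^+ 2).
have [x2|x2] := leP x 2^-1; first by have := expR_le_quadratic x2; lra.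
have : expR x <= expR (2 * x ^+ 2).
  rewrite ler_expR; have := mulr_ge0 (_ : 0 <= x) (_ : 0 <= 2 * x - 1).
  have -> : (0 <= x) by lra. have -> : 0 <= 2 * x - 1 by lra.
  move=> /(_ isT isT); lra.
lra.
Qed.

(** The chord of the exponential: its tangent at [l * x], evaluated at [x] and at [0], averaged with
    weights [l] and [1 - l]. It replaces a small power by something linear in [expR x], whose mean
    is under control. *)
Lemma expR_scale_le (l x : R) : 0 <= l <= 1 -> expR (l * x) <= 1 + l * (expR x - 1).
Proof.
move=> /andP[l0 l1].
have h1 : expR (l * x) * (1 + (1 - l) * x) <= expR x.
  rewrite -[x in leRHS](_ : l * x + (1 - l) * x = x); last by ring.
  by rewrite expRD ler_wpM2l ?expR_ge0// expR_ge1Dx.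
have h2 : expR (l * x) * (1 - l * x) <= 1.
  rewrite -[leRHS](expRxMexpNx_1 (l * x)) ler_wpM2l ?expR_ge0//.
  by rewrite expR_ge1Dx.
have := lerD (ler_wpM2l l0 h1) (ler_wpM2l (_ : 0 <= 1 - l) h2).
rewrite subr_ge0 => /(_ l1); lra.
Qed.

Lemma sqr_le_expR x : 0 <= x -> x ^+ 2 / 2 <= expR x.
Proof.
move=> x0; have := expR_ge1Dxn 1 x0; rewrite /= => h.
by apply: le_trans h; rewrite (_ : 2`! = 2)//  lerDr.
Qed.

Lemma expR_le_tangent x : expR x <= 1 + x + 4 * x ^+ 2 * expR `|x|.
Proof.
have e1 : 1 <= expR `|x| by rewrite (le_trans _ (expR_ge1Dx _))// lerDl.
have [x2|x2] := leP x 2^-1.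
  apply: le_trans (expR_le_quadratic x2) _; rewrite lerD2l.
  apply: le_trans (_ : 4 * x ^+ 2 * 1 <= _); first by have := sqr_ge0 x; lra.
  by rewrite ler_wpM2l// mulr_ge0 ?sqr_ge0.
have x0 : 0 < x by lra.
rewrite gtr0_norm//; apply: le_trans (_ : 4 * x ^+ 2 * expR x <= _); last by lra.
rewrite -[leLHS]mul1r ler_wpM2r ?expR_ge0//.
have : 0 <= (x - 2^-1) * (x + 2^-1) by apply: mulr_ge0; lra.
lra.
Qed.

End exponential_inequalities.

Section mean_upper_bounds.
Context d {T : measurableType d} {R : realType} (P : probability T R).

Definition mean_le (f : T -> R) (v : R) :=
  P.-integrable setT (EFin \o f) /\ (\int[P]_w (f w)%:E <= v%:E)%E.

Lemma has_mean_le f v : has_mean P f v -> mean_le f v.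
Proof. by move=> [fi fE]; split=> //; rewrite fE. Qed.

Lemma mean_leD f g u v : mean_le f u -> mean_le g v -> mean_le (fun w => f w + g w) (u + v).
Proof.
move=> [fi fE] [gi gE]; split; first exact: (integrableD measurableT fi gi).
by under eq_integral do rewrite EFinD; rewrite integralD//= EFinD leeD.
Qed.

Lemma mean_leZ c f u : 0 <= c -> mean_le f u -> mean_le (fun w => c * f w) (c * u).
Proof.
move=> c0 [fi fE]; split; first exact: (integrableZl measurableT c fi).
by under eq_integral do rewrite EFinM; rewrite integralZl//= EFinM lee_wpmul2l.
Qed.

Lemma mean_le_ge0 (f g : T -> R) u : measurable_fun setT f -> (forall w, 0 <= f w) ->
  (forall w, f w <= g w) -> mean_le g u -> mean_le f u.
Proof.
move=> mf f0 fg [gi gE]; have fi : P.-integrable setT (EFin \o f).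
  apply: le_integrable gi => //; first exact/measurable_EFinP.
  by move=> w _ /=; rewrite lee_fin !ger0_norm// (le_trans (f0 w)).
by split=> //; apply: le_trans gE; apply: le_integral => // w _; rewrite lee_fin.
Qed.

Lemma mean_le_trans f u v : mean_le f u -> u <= v -> mean_le f v.
Proof. by move=> [fi fE] uv; split=> //; rewrite (le_trans fE)// lee_fin. Qed.

Lemma mean_le_eq f g u : (forall w, f w = g w) -> mean_le f u -> mean_le g u.
Proof. by move=> fg; rewrite (_ : f = g)//; exact/funext. Qed.

Lemma mean_leP (f : T -> R) u : measurable_fun setT f -> (forall w, 0 <= f w) ->
  (\int[P]_w (f w)%:E <= u%:E)%E -> mean_le f u.
Proof.
move=> mf f0 fu; split=> //; apply/integrableP; split; first exact/measurable_EFinP.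
under eq_integral do rewrite gee0_abs ?lee_fin//.
by rewrite (le_lt_trans fu)// ltry.
Qed.

Lemma mean_le_sum (I : eqType) (r : seq I) (f : I -> T -> R) (u : I -> R) :
  (forall i, i \in r -> mean_le (f i) (u i)) ->
  mean_le (fun w => \sum_(i <- r) f i w) (\sum_(i <- r) u i).
Proof.
elim: r => [_|i r IH h].
  rewrite big_nil; apply: mean_le_eq (has_mean_le (has_mean_cst P 0)) => w.
  by rewrite big_nil.
rewrite big_cons; have hi := h i (mem_head _ _).
have {}IH := IH (fun j jr => h j (mem_behead (s := i :: r) jr)).
by apply: mean_le_eq (mean_leD hi IH) => w; rewrite big_cons.
Qed.

Lemma markov_mean_le (f : T -> R) (u t : R) : measurable_fun setT f ->
  (forall w, 0 <= f w) -> mean_le f u -> 0 < t ->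
  (P [set w | (t <= f w)%R] <= (u / t)%:E)%E.
Proof.
move=> mf f0 [fi fu] t0.
rewrite EFinM lee_pdivlMr//; apply: le_trans fu; rewrite muleC.
have mt : measurable [set w | (t <= f w)%R].
  rewrite (_ : [set _ | _] = f @^-1` `[t, +oo[); last first.
    by apply/seteqP; split => w /=; rewrite in_itv/= andbT.
  by rewrite -[X in measurable X]setTI; exact: mf.
have -> : P [set w | t <= f w] = (\int[P]_w (\1_[set w | t <= f w] w)%:E)%E.
  by rewrite integral_indic// setIT.
rewrite -ge0_integralZl_EFin//; last 2 first.
- by apply/measurable_EFinP; exact: measurable_indic.
- exact: ltW.
apply: ge0_le_integral => //.
- by move=> w _; rewrite mule_ge0// lee_fin// ltW.
- by apply/measurable_EFinP; apply: measurable_funM => //; exact: measurable_indic.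
- exact/measurable_EFinP.
move=> w _; rewrite -EFinM lee_fin indicE.
by case: (boolP (_ \in _)) => [|_]; rewrite ?mulr1 ?mulr0// inE.
Qed.

End mean_upper_bounds.

(** The geometric series with first term [2 * expR (1/2)] and ratio [expR (- 1/2)]. *)
Definition tail_constant {R : realType} : R :=
  2 * expR 2^-1 / (1 - expR (- 2^-1)).

Lemma tail_constant_ge1 {R : realType} : 1 <= tail_constant :> R.
Proof.
have h : expR (- 2^-1) < 1 :> R by rewrite expR_lt1 oppr_lt0.
rewrite /tail_constant ler_pdivlMr ?subr_gt0// mul1r.
have := expR_ge1Dx (2^-1 : R); have := expR_gt0 (- 2^-1 : R); lra.
Qed.

(** Layering by unit steps: [expR (U / 2)] is at most the sum over [m] of [expR ((m + 1) / 2)] on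
    the events [m <= U], and the tail bound makes the integrated series geometric. *)
Lemma exp_tail_mean {R : realType} d (T : measurableType d) (P : probability T R) (U : T -> R) :
  measurable_fun setT U -> (forall w, 0 <= U w) ->
  (forall t, 0 <= t -> (P [set w | (t <= U w)%R] <= (2 * expR (- t))%:E)%E) ->
  mean_le P (fun w => expR (2^-1 * U w)) tail_constant.
Proof.
move=> mU U0 tail.
have mexp : measurable_fun setT (fun w => expR (2^-1 * U w)).
  by apply: measurableT_comp => //; apply: measurable_funM.
apply: mean_leP => //.
pose L m := [set w | (m%:R <= U w)%R].
have mL m : measurable (L m).
  rewrite (_ : L m = U @^-1` `[m%:R, +oo[); last first.
    by apply/seteqP; split => w /=; rewrite in_itv/= andbT.
  by rewrite -[X in measurable X]setTI; exact: mU.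
pose g m w := (expR (2^-1 * m.+1%:R) * \1_(L m) w : R).
have g0 m w : 0 <= g m w by rewrite mulr_ge0 ?expR_ge0.
have mg m : measurable_fun setT (g m) by apply: measurable_funM => //; exact: measurable_indic.
apply: (@le_trans _ _ (\int[P]_w (\sum_(m <oo) (g m w)%:E))%E).
  apply: ge0_le_integral => //.
  - exact/measurable_EFinP.
  - by apply: ge0_emeasurable_sum => [m w _ _|m _]; [rewrite lee_fin|exact/measurable_EFinP].
  move=> w _; set m := Num.truncn (U w).
  have /andP[m1 m2] := truncn_itv (U0 w).
  apply: le_trans (nneseries_lim_ge m.+1 _); last by move=> k _ _; rewrite lee_fin.
  rewrite big_mkord big_ord_recr/= -[leLHS]add0e; apply: leeD.
    by apply: sume_ge0 => i _; rewrite lee_fin.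
  rewrite lee_fin /g indicE mem_set ?mulr1//.
  by rewrite ler_expR ler_wpM2l// ltW.
rewrite integral_nneseries//; last 2 first.
- by move=> m; exact/measurable_EFinP.
- by move=> m w _; rewrite lee_fin.
apply: lime_le; first by apply: is_cvg_nneseries => m _ _; apply: integral_ge0 => w _; rewrite lee_fin.
apply: nearW => N.
apply: (@le_trans _ _ (\sum_(0 <= m < N) (2 * expR 2^-1 * expR (- 2^-1) ^+ m)%:E)%E).
  apply: lee_sum => m _.
  have -> : (\int[P]_w (g m w)%:E = (expR (2^-1 * m.+1%:R))%:E * P (L m))%E.
    under eq_integral do rewrite EFinM.
    rewrite ge0_integralZl_EFin//; last first.
      by apply/measurable_EFinP; exact: measurable_indic.
    by rewrite integral_indic// setIT.
  apply: (@le_trans _ _ ((expR (2^-1 * m.+1%:R))%:E * (2 * expR (- m%:R))%:E)%E).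
    by rewrite lee_wpmul2l ?lee_fin ?expR_ge0//; exact: tail.
  rewrite -EFinM lee_fin -expRM_natr mulrCA -mulrA -!expRD ler_wpM2l// ler_expR.
  by rewrite -[m.+1%:R]natr1; lra.
rewrite sumEFin lee_fin.
have h : `|expR (- 2^-1) : R| < 1 by rewrite ger0_norm ?expR_ge0// expR_lt1 oppr_lt0.
have := geometric_le_lim N (_ : 0 <= 2 * expR 2^-1) (expR_gt0 (- 2^-1)) h.
by apply; rewrite mulr_ge0 ?expR_ge0.
Qed.

Section square_exponential.
Context {R : realType} d (T : measurableType d) (P : probability T R).
Implicit Types (X : T -> R) (K : R).

Definition subgaussian_tail X K := forall t, 0 <= t ->
  (P [set w | (t <= `|X w|)%R] <= (2 * expR (- (t ^+ 2 / K ^+ 2)))%:E)%E.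

Lemma subgaussian_square_exp X K : measurable_fun setT X -> 0 < K -> subgaussian_tail X K ->
  mean_le P (fun w => expR (2^-1 * (X w ^+ 2 / K ^+ 2))) tail_constant.
Proof.
move=> mX K0 tailX; apply: exp_tail_mean.
- by apply: measurable_funM => //; exact: measurable_funX.
- by move=> w; rewrite divr_ge0 ?sqr_ge0.
move=> t t0; rewrite (_ : [set _ | _] = [set w | (Num.sqrt t * K <= `|X w|)%R]).
  apply: le_trans (tailX _ _) _; first by rewrite mulr_ge0 ?sqrtr_ge0// ltW.
  by rewrite exprMn sqr_sqrtr// mulfK// expf_neq0// gt_eqF.
apply/seteqP; split => w /=; rewrite ler_pdivlMr ?exprn_gt0//.
  by rewrite -{1}(sqr_sqrtr t0) -exprMn -[X in _ <= X]real_normK ?num_real// ler_sqr ?nnegrE ?mulr_ge0 ?sqrtr_ge0 ?(ltW K0).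
by rewrite -{2}(sqr_sqrtr t0) -exprMn -[X in _ -> _ <= X]real_normK ?num_real// ler_sqr ?nnegrE ?mulr_ge0 ?sqrtr_ge0 ?(ltW K0).
Qed.

Definition mgf_constant K := K ^+ 2 * (4 * tail_constant + 1).

Lemma mgf_constant_gt0 K : 0 < K -> 0 < mgf_constant K.
Proof.
move=> K0; rewrite mulr_gt0 ?exprn_gt0//.
have := @tail_constant_ge1 R; lra.
Qed.

(** Two regimes. If [l <= 1], centring removes the linear term and the scaled exponential of the
    square gives [1 + l B]. If [l > 1], the inequality [t X <= K^2 t^2 + X^2 / (2 K^2)] suffices,
    the factor [B] being absorbed into [expR (l B)]. *)
Lemma subgaussian_mgf X K t : measurable_fun setT X -> 0 < K ->
  has_mean P X 0 -> subgaussian_tail X K ->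
  mean_le P (fun w => expR (t * X w)) (expR (mgf_constant K * t ^+ 2)).
Proof.
move=> mX K0 X0 tailX; have sq := subgaussian_square_exp mX K0 tailX.
have B1 := @tail_constant_ge1 R; set B := tail_constant in sq B1.
have mexp : measurable_fun setT (fun w => expR (t * X w)).
  by apply: measurableT_comp => //; exact: measurable_funM.
have K2 : 0 < K ^+ 2 by rewrite exprn_gt0.
(* Chosen so that [2 (t X)^2] is [l] times the exponent whose mean [sq] bounds. *)
pose l := 4 * K ^+ 2 * t ^+ 2.
have l0 : 0 <= l by rewrite /l -mulrA -exprMn mulr_ge0 ?sqr_ge0.
have l1e : mgf_constant K * t ^+ 2 = l * B + K ^+ 2 * t ^+ 2 by rewrite /mgf_constant /l -/B; ring.
have KK : 0 <= K ^+ 2 * t ^+ 2 by rewrite mulr_ge0 ?sqr_ge0.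
have [l1|l1] := leP l 1.
  apply: mean_le_trans (mean_le_ge0 mexp _ _ (mean_leD (mean_leD (has_mean_le (has_meanZ t X0))
    (has_mean_le (has_mean_cst P (1 - l)))) (mean_leZ l0 sq))) _.
  - by move=> w; exact: expR_ge0.
  - move=> w; apply: le_trans (expR_le_id_sqr _) _; rewrite -addrA lerD2l.
    have -> : 2 * (t * X w) ^+ 2 = l * (2^-1 * (X w ^+ 2 / K ^+ 2)).
      by rewrite /l; field; rewrite gt_eqF.
    apply: le_trans (expR_scale_le _ _) _; first by rewrite l0.
    by lra.
  - apply: le_trans (_ : 1 + l * B <= _); first by lra.
    by apply: le_trans (expR_ge1Dx _) _; rewrite ler_expR l1e lerDl.
apply: mean_le_trans (mean_le_ge0 mexp _ _ (mean_leZ (expR_ge0 (K ^+ 2 * t ^+ 2)) sq)) _.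
- by move=> w; exact: expR_ge0.
- move=> w; rewrite -expRD ler_expR.
  have := sqr_ge0 (K * t - X w / K).
  have -> : (K * t - X w / K) ^+ 2 = K ^+ 2 * t ^+ 2 - 2 * (t * X w) + X w ^+ 2 / K ^+ 2.
    by field; rewrite gt_eqF.
  lra.
rewrite l1e [l * B + _]addrC expRD ler_wpM2l ?expR_ge0//.
apply: le_trans (_ : 1 + l * B <= _); last exact: expR_ge1Dx.
have := mulr_ge0 (_ : 0 <= l - 1) (_ : 0 <= B).
rewrite subr_ge0 => /(_ (ltW l1) (le_trans ler01 B1)); lra.
Qed.

Lemma mgf_tail X K : measurable_fun setT X -> 0 < K ->
  (forall t, mean_le P (fun w => expR (t * X w)) (expR (K * t ^+ 2))) ->
  subgaussian_tail X (2 * Num.sqrt K).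
Proof.
move=> mX K0 mgf t t0.
have mS (e : bool) : measurable [set w | (t <= (-1) ^+ e * X w)%R].
  rewrite (_ : [set _ | _] = (fun w => (-1) ^+ e * X w) @^-1` `[t, +oo[); last first.
    by apply/seteqP; split => w /=; rewrite in_itv/= andbT.
  by rewrite -[X in measurable X]setTI; apply: measurable_funM.
have one_sided (e : bool) : (P [set w | (t <= (-1) ^+ e * X w)%R] <=
    (expR (- (t ^+ 2 / (2 * Num.sqrt K) ^+ 2)))%:E)%E.
  rewrite exprMn sqr_sqrtr ?(ltW K0)//.
  have [t00|t_neq0] := eqVneq t 0.
    rewrite [X in (_ <= X)%E](_ : _ = 1%E); first exact: probability_le1 (mS e).
    by rewrite t00 expr0n/= mul0r oppr0 expR0.
  (* The Chernoff parameter minimising [K r^2 - r t]; [K] is here the constant of the moment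
     generating function. *)
  pose r := t / (2 * K).
  have r0 : 0 < r by rewrite divr_gt0 ?mulr_gt0// lt0r t_neq0.
  have mexp : measurable_fun setT (fun w => expR (r * (-1) ^+ e * X w)).
    by apply: measurableT_comp => //; apply: measurable_funM; [exact: measurable_cst|].
  have := markov_mean_le mexp (fun w => expR_ge0 _) (mgf (r * (-1) ^+ e)) (expR_gt0 (r * t)).
  rewrite -expRN -expRD exprMn sqrr_sign mulr1.
  have -> : K * r ^+ 2 + - (r * t) = - (t ^+ 2 / (2 ^+ 2 * K)).
    by rewrite /r; field; rewrite gt_eqF.
  congr (P _ <= _)%E; apply/seteqP; split => w /=; rewrite ler_expR -mulrA ler_pM2l//.
rewrite (_ : [set _ | _] = [set w | (t <= (-1) ^+ false * X w)%R] `|` [set w | (t <= (-1) ^+ true * X w)%R]); last first.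
  by apply/seteqP; split => w /=; rewrite expr0 expr1 mul1r mulN1r ler_normr => /orP.
apply: (le_trans (measureU2 P (mS false) (mS true))).
set x := expR _; rewrite (_ : 2 * x = x + x); last by ring.
by rewrite EFinD; apply: leeD; exact: one_sided.
Qed.

End square_exponential.

(** * Bernstein-type bounds for products of row forms *)

Section quadratic_form.
Context {R : realType} d (T : measurableType d) (P : probability T R).
Context (s n : nat) (Y : 'I_s * 'I_n -> {RV P >-> R}) (K : R).
Hypotheses (Y_indep : mutually_independent Y) (K_gt0 : 0 < K).
Hypothesis Y_mean : forall ij, has_mean P (Y ij) 0.
Hypothesis Y_var : forall ij, has_mean P (fun w => Y ij w * Y ij w) 1.
Hypothesis Y_tail : forall ij, subgaussian_tail P (Y ij) K.

Let kappa := mgf_constant K.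
Let kappa_gt0 : 0 < kappa := mgf_constant_gt0 K_gt0.

Definition row_form (l : 'I_s) (u : 'cV[R]_n) (w : T) : R := \sum_i u i 0 * Y (l, i) w.

Lemma measurable_row_form_block (J : {set 'I_s * 'I_n}) l u : (forall i, (l, i) \in J) ->
  measurable_fun [set: block Y J] (row_form l u : block Y J -> R).
Proof.
move=> lJ; apply: measurable_sum => i; apply: measurable_funM => //.
exact: (measurable_block_coord (P := P)).
Qed.

Lemma measurable_row_form l u : measurable_fun setT (row_form l u).
Proof. by apply: measurable_sum => i; exact: measurable_funM. Qed.

Lemma mean_le_prod_blocks (L : finType) (J : L -> {set 'I_s * 'I_n}) (f : L -> T -> R) (v : L -> R) :
  (forall l l', l != l' -> [disjoint J l & J l']%B) ->
  (forall l w, 0 <= f l w) ->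
  (forall l, measurable_fun [set: block Y (J l)] (f l : block Y (J l) -> R)) ->
  (forall l, mean_le P (f l) (v l)) ->
  mean_le P (fun w => \prod_l f l w) (\prod_l v l).
Proof.
move=> dJ f0 mf fv; apply: mean_leP.
- by apply: measurable_prod => l _; exact: measurable_block_fun (mf l).
- by move=> w; exact: prodr_ge0.
rewrite (integral_prod_blocks Y_indep (index_enum_uniq _) dJ f0 mf).
have ffin l : (\int[P]_w (f l w)%:E)%E = (fine (\int[P]_w (f l w)%:E)%E)%:E.
  by rewrite fineK//; apply: integrable_fin_num => //; case: (fv l).
rewrite (eq_bigr _ (fun l _ => ffin l)) prodEFin lee_fin; apply: ler_prod => l _; rewrite fine_ge0/=; last first.
  by apply: integral_ge0 => w _; rewrite lee_fin.
by rewrite -lee_fin -ffin; case: (fv l).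
Qed.

Lemma row_form_mgf l u t :
  mean_le P (fun w => expR (t * row_form l u w)) (expR (kappa * dot u u * t ^+ 2)).
Proof.
have := @mean_le_prod_blocks _ (fun i => [set (l, i)]%SET)
  (fun i w => expR (t * u i 0 * Y (l, i) w)) (fun i => expR (kappa * (t * u i 0) ^+ 2)).
move=> /(_ _ _ _ _); rewrite -expR_sum.
have -> : \sum_i kappa * (t * u i 0) ^+ 2 = kappa * dot u u * t ^+ 2.
  by rewrite dotE -mulr_sumr -mulrA mulr_suml; congr (_ * _); apply: eq_bigr => i _; ring.
move=> h; apply: mean_le_eq (h _ _ _ _).
- move=> w; rewrite -expR_sum /row_form mulr_sumr; congr expR.
  by apply: eq_bigr => i _; rewrite mulrA.
- by move=> i j ij; rewrite finset.disjoints1 inE xpair_eqE eqxx.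
- by move=> i w; exact: expR_ge0.
- move=> i; apply: measurableT_comp => //; apply: measurable_funM => //.
  by apply: (measurable_block_coord (P := P)); rewrite inE.
- by move=> i; apply: subgaussian_mgf.
Qed.

Let q := (2 * Num.sqrt kappa) ^+ 2.
Let q_gt0 : 0 < q.
Proof. by rewrite exprn_gt0// mulr_gt0// sqrtr_gt0. Qed.

(** Tails do not multiply over independent coordinates but moment generating functions do; hence the
    detour through [row_form_mgf] and back to a tail. *)
Lemma row_form_square_exp l u : dot u u <= 1 ->
  mean_le P (fun w => expR (2^-1 * (row_form l u w ^+ 2 / q))) tail_constant.
Proof.
move=> u1; apply: subgaussian_square_exp; first exact: measurable_row_form.
  by rewrite mulr_gt0// sqrtr_gt0.
apply: mgf_tail; [exact: measurable_row_form|exact: kappa_gt0|] => t.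
apply: mean_le_trans (row_form_mgf l u t) _; rewrite ler_expR ler_wpM2r ?sqr_ge0//.
by rewrite ler_piMr// ltW.
Qed.

Definition row_error l u v (w : T) : R := row_form l u w * row_form l v w - dot u v.

Lemma row_error_mean l u v : has_mean P (row_error l u v) 0.
Proof.
have YY i j : has_mean P (fun w => Y (l, i) w * Y (l, j) w) (i == j)%:R.
  have [<-|ij] := eqVneq; first exact: Y_var.
  rewrite -[X in has_mean _ _ X](mulr0 0); apply: has_mean_indepM => //.
  by apply: mutually_independent_pair => //; rewrite xpair_eqE eqxx.
have := has_meanD (has_mean_sum (index_enum _) (fun i => has_mean_sum (index_enum _)
  (fun j => has_meanZ (u i 0 * v j 0) (YY i j)))) (has_mean_cst P (- dot u v)).
rewrite (_ : \sum_i \sum_j u i 0 * v j 0 * (i == j)%:R = dot u v) ?subrr.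
  apply: has_mean_eq => w; rewrite /row_error /row_form mulr_suml; congr (_ - _).
  apply: eq_bigr => i _; rewrite mulr_sumr; apply: eq_bigr => j _; ring.
rewrite dotE; apply: eq_bigr => i _; rewrite (bigD1 i)//= eqxx mulr1 big1 ?addr0//.
by move=> j; rewrite eq_sym => /negbTE ->; rewrite mulr0.
Qed.

Definition error_scale : R := (2 * q)^-1.
(** With [c] the scale, the Taylor remainder [4 (t z)^2] equals [32 t^2 / c^2] times
    [(c |z| / 2)^2 / 2], and the latter is at most [expR (c |z| / 2)]. *)
Definition error_constant : R := 32 * (expR error_scale * tail_constant) / error_scale ^+ 2.

Lemma error_scale_gt0 : 0 < error_scale.
Proof. by rewrite invr_gt0 mulr_gt0. Qed.

Lemma error_constant_gt0 : 0 < error_constant.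
Proof.
apply: divr_gt0; last by rewrite exprn_gt0 ?error_scale_gt0.
apply: mulr_gt0 => //; apply: mulr_gt0; first exact: expR_gt0.
exact: lt_le_trans ltr01 tail_constant_ge1.
Qed.

(** The product of two forms is at most the mean of their squares. At half the admissible exponent
    this gives a product [x * y], bounded by [(x^2 + y^2) / 2], so no joint law of the two forms
    enters. *)
Lemma row_error_abs_exp l u v : dot u u <= 1 -> dot v v <= 1 ->
  mean_le P (fun w => expR (error_scale * `|row_error l u v w|))
    (expR error_scale * tail_constant).
Proof.
move=> u1 v1; have mu := row_form_square_exp l u1; have mv := row_form_square_exp l v1.
have half : 0 <= expR error_scale / 2 :> R by rewrite divr_ge0 ?expR_ge0.
apply: mean_le_trans (mean_le_ge0 _ _ _ (mean_leZ half (mean_leD mu mv))) _; last by lra.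
- apply: measurableT_comp => //; apply: measurable_funM => //.
  apply: measurableT_comp; first exact: normr_measurable.
  by apply: measurable_funB => //; apply: measurable_funM; exact: measurable_row_form.
- by move=> w; exact: expR_ge0.
move=> w; set a := row_form l u w; set b := row_form l v w.
have uv : `|dot u v| <= 1.
  apply: le_trans (normr_dot_le u v) _.
  by apply: mulr_ile1; rewrite ?norm2_ge0// norm2_le// expr1n.
have ab : `|row_error l u v w| <= (a ^+ 2 + b ^+ 2) / 2 + 1.
  apply: le_trans (ler_normB _ _) _; apply: lerD => //; rewrite normrM.
  have := sqr_ge0 (`|a| - `|b|).
  by rewrite -[a ^+ 2]real_normK ?num_real// -[b ^+ 2]real_normK ?num_real//; lra.
pose x := expR (4^-1 * (a ^+ 2 / q)); pose y := expR (4^-1 * (b ^+ 2 / q)).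
have xE : expR (2^-1 * (a ^+ 2 / q)) = x ^+ 2 by rewrite /x [RHS]expr2 -expRD; congr expR; lra.
have yE : expR (2^-1 * (b ^+ 2 / q)) = y ^+ 2 by rewrite /y [RHS]expr2 -expRD; congr expR; lra.
rewrite xE yE; apply: le_trans (_ : expR error_scale * (x * y) <= _); last first.
  have := mulr_ge0 (expR_ge0 error_scale) (sqr_ge0 (x - y)); lra.
rewrite -!expRD ler_expR.
apply: le_trans (ler_wpM2l (ltW error_scale_gt0) ab) _.
rewrite mulrDr mulr1 addrC lerD2l le_eqVlt; apply/orP; left; apply/eqP.
by rewrite /error_scale; field; rewrite gt_eqF.
Qed.

(** The error is subexponential, hence behaves like a subgaussian variable only for small [t]. Half
    of [error_scale] goes to the remainder exponential [expR |t z|], the other half to the square in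
    front of it. *)
Lemma row_error_mgf l u v t : dot u u <= 1 -> dot v v <= 1 -> `|t| <= error_scale / 2 ->
  mean_le P (fun w => expR (t * row_error l u v w)) (expR (error_constant * t ^+ 2)).
Proof.
move=> u1 v1 ht; have c0 := error_scale_gt0; set c := error_scale in ht c0.
have t0 : 0 <= 32 * t ^+ 2 / c ^+ 2 by rewrite -mulrA -expr_div_n mulr_ge0 ?sqr_ge0.
apply: mean_le_trans (mean_le_ge0 _ _ _ (mean_leD (mean_leD (has_mean_le (has_mean_cst P 1))
  (has_mean_le (has_meanZ t (row_error_mean l u v))))
  (mean_leZ t0 (row_error_abs_exp l u1 v1)))) _.
- apply: measurableT_comp => //; apply: measurable_funM => //.
  by apply: measurable_funB => //; apply: measurable_funM; exact: measurable_row_form.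
- by move=> w; exact: expR_ge0.
- move=> w; set z := row_error l u v w; apply: le_trans (expR_le_tangent _) _; rewrite lerD2l.
  have z0 : 0 <= c * `|z| / 2 by rewrite divr_ge0// mulr_ge0// ltW.
  have h1 := sqr_le_expR z0.
  have h2 : expR `|t * z| <= expR (c * `|z| / 2).
    by rewrite ler_expR normrM mulrAC ler_wpM2r.
  have -> : expR (c * `|z|) = expR (c * `|z| / 2) * expR (c * `|z| / 2).
    by rewrite -expRD; congr expR; lra.
  apply: le_trans (_ : 4 * (t * z) ^+ 2 * expR (c * `|z| / 2) <= _).
    by rewrite ler_wpM2l// mulr_ge0 ?sqr_ge0.
  rewrite [leRHS]mulrA ler_wpM2r ?expR_ge0//.
  have -> : 4 * (t * z) ^+ 2 = 32 * t ^+ 2 / c ^+ 2 * ((c * `|z| / 2) ^+ 2 / 2).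
    rewrite !exprMn real_normK ?num_real//; field; by rewrite gt_eqF.
  by rewrite ler_wpM2l.
apply: le_trans (expR_ge1Dx _); rewrite mulr0 addr0 lerD2l /error_constant -/c.
by rewrite le_eqVlt; apply/orP; left; apply/eqP; field; rewrite gt_eqF.
Qed.

(** Homogeneity reduces to vectors of norm at most 1 with parameter [t * rho^2]; the rows are
    independent blocks, so the bounds multiply. *)
Lemma quadratic_form_mgf (rho : R) u v t : 0 < rho ->
  dot u u <= rho ^+ 2 -> dot v v <= rho ^+ 2 -> `|t| * rho ^+ 2 <= error_scale / 2 ->
  mean_le P (fun w => expR (t * \sum_l row_error l u v w))
    (expR (error_constant * (t * rho ^+ 2) ^+ 2 * s%:R)).
Proof.
move=> rho0 hu hv ht; have rho2 : 0 < rho ^+ 2 by rewrite exprn_gt0.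
have unit x : dot x x <= rho ^+ 2 -> dot (rho^-1 *: x) (rho^-1 *: x) <= 1 :> R.
  by move=> hx; rewrite dotZl dotZr mulrA -expr2 exprVn ler_pdivrMl// mulr1.
have scale (l : 'I_s) (x : 'cV[R]_n) w : row_form l x w = rho * row_form l (rho^-1 *: x) w.
  rewrite /row_form mulr_sumr; apply: eq_bigr => i _.
  by rewrite mxE !mulrA mulfV ?mul1r// gt_eqF.
have scale_error l w : t * row_error l u v w =
    t * rho ^+ 2 * row_error l (rho^-1 *: u) (rho^-1 *: v) w.
  rewrite /row_error (scale l u) (scale l v) dotZl dotZr; field; by rewrite gt_eqF.
have := @mean_le_prod_blocks _ (fun l => [set ij : 'I_s * 'I_n | ij.1 == l]%SET)
  (fun l w => expR (t * row_error l u v w)) (fun=> expR (error_constant * (t * rho ^+ 2) ^+ 2)).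
rewrite prodr_const card_ord -expRM_natr => h.
apply: mean_le_eq (h _ _ _ _).
- by move=> w; rewrite mulr_sumr expR_sum.
- move=> l l' ll'; rewrite -finset.setI_eq0; apply/eqP/finset.setP => ij; rewrite !inE.
  by apply/negbTE; apply: contra ll' => /andP[/eqP <- /eqP <-].
- by move=> l w; exact: expR_ge0.
- move=> l; apply: measurableT_comp => //; apply: measurable_funM => //.
  by apply: measurable_funB => //; apply: measurable_funM;
    apply: measurable_row_form_block => i; rewrite inE.
- move=> l; apply: mean_le_eq (fun w => congr1 expR (esym (scale_error l w))) _.
  by apply: row_error_mgf; rewrite ?unit// normrM (ger0_norm (ltW rho2)).
Qed.

End quadratic_form.

(** * Discrete Gaussians on a lattice *)

Section finite_sums.
Context {R : realType}.

(** The tangent of the exponential at the mean, averaged. *)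
Lemma jensen_expR (I : Type) (r : seq I) (p a : I -> R) :
  (forall i, 0 <= p i) -> \sum_(i <- r) p i = 1 ->
  expR (\sum_(i <- r) p i * a i) <= \sum_(i <- r) p i * expR (a i).
Proof.
move=> p0 p1; set m := \sum_(i <- r) p i * a i.
have -> : expR m = \sum_(i <- r) p i * (expR m * (1 + (a i - m))).
  rewrite (eq_bigr (fun i => expR m * (p i * a i) + expR m * (1 - m) * p i)); last first.
    by move=> i _; ring.
  by rewrite big_split/= -!mulr_sumr p1 -/m; ring.
apply: ler_sum => i _; apply: ler_wpM2l => //.
rewrite -[a i in leRHS](subrK m) [in leRHS]addrC expRD ler_wpM2l ?expR_ge0//.
exact: expR_ge1Dx.
Qed.

Lemma ler_sum_subseq (T : eqType) (r1 r2 : seq T) (F : T -> R) :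
  uniq r1 -> uniq r2 -> {subset r1 <= r2} -> (forall x, 0 <= F x) ->
  \sum_(x <- r1) F x <= \sum_(x <- r2) F x.
Proof.
move=> u1 u2 r12 F0; rewrite (perm_big [seq x <- r2 | x \in r1])/=.
  by rewrite big_filter big_mkcond/=; apply: ler_sum => x _; case: ifP.
apply: uniq_perm => //; first exact: filter_uniq.
by move=> x; rewrite mem_filter; case: (boolP (x \in r1)) => //= /r12.
Qed.

Lemma sum_half (f : nat -> R) m : \sum_(i < m.*2) f (i./2) = 2 * \sum_(i < m) f i.
Proof.
elim: m => [|m IH]; first by rewrite !big_ord0 mulr0.
rewrite doubleS !big_ord_recr/= IH doubleK uphalf_double; ring.
Qed.

End finite_sums.

Section grid.
Context {R : realType} (D : nat) (b : R).
Hypotheses (D_gt0 : (0 < D)%N) (b_gt0 : 0 < b).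

Definition grid_point N (k : 'I_(N.*2.+1)) : R := ((k : nat)%:R - N%:R) / D%:R.

Let D_gt0R : 0 < D%:R :> R. Proof. by rewrite ltr0n. Qed.

Lemma grid_point_rev N (k : 'I_(N.*2.+1)) : grid_point (rev_ord k) = - grid_point k.
Proof.
rewrite /grid_point /= subSS natrB; last by rewrite -ltnS ltn_ord.
have -> : N.*2%:R = N%:R + N%:R :> R by rewrite -addnn natrD.
by field; rewrite gt_eqF.
Qed.

Lemma grid_point_inj N : injective (@grid_point N).
Proof.
move=> k l /eqP; rewrite /grid_point -subr_eq0 -mulrBl mulf_eq0 invr_eq0 (gt_eqF D_gt0R) orbF.
by rewrite opprB addrA subrK subr_eq0 eqr_nat => /eqP; exact: val_inj.
Qed.

Lemma grid_sum N (G : R -> R) :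
  \sum_k G (@grid_point N k ^+ 2) =
  \sum_(m < N) G ((m.+1%:R / D%:R) ^+ 2) + \sum_(m < N.+1) G ((m%:R / D%:R) ^+ 2).
Proof.
rewrite -(big_mkord xpredT (fun k => G (((k%:R - N%:R) / D%:R) ^+ 2))).
rewrite (big_cat_nat (n := N))//=; last by rewrite -addnn -addnS leq_addr.
congr (_ + _).
  rewrite big_nat_rev/= add0n -(big_mkord xpredT (fun m => G ((m.+1%:R / D%:R) ^+ 2))).
  rewrite !big_nat; apply: eq_bigr => m /andP[_ mN]; congr G.
  by rewrite natrB// addrAC subrr add0r mulNr sqrrN.
rewrite -{1}[N]add0n big_addn -addnn -addnS addKn big_mkord.
apply: eq_bigr => m _; congr G; rewrite natrD addrK//.
Qed.

Definition gauss (x : R) := expR (- (b * x ^+ 2)).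
Definition grid_mass N := \sum_k gauss (@grid_point N k).

Let g (m : nat) := gauss (m%:R / D%:R).

Let grid_massE N : grid_mass N = \sum_(m < N) g m.+1 + \sum_(m < N.+1) g m.
Proof. exact: (grid_sum N (fun y => expR (- (b * y)))). Qed.

Lemma grid_mass_ge1 N : 1 <= grid_mass N.
Proof.
rewrite grid_massE big_ord_recl /g mul0r /gauss expr0n/= mulr0 oppr0 expR0 addrCA lerDl.
by rewrite addr_ge0// sumr_ge0// => i _; exact: expR_ge0.
Qed.

Lemma gauss_mean0 N : \sum_k grid_point k * gauss (@grid_point N k) = 0.
Proof.
set S := \sum_k _; suff : S = - S by move=> h; lra.
rewrite {1}/S (reindex_inj rev_ord_inj)/= -sumrN; apply: eq_bigr => k _.
by rewrite grid_point_rev /gauss sqrrN mulNr.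
Qed.

(** Half of the exponent absorbs the square, at the price [2 / b]. What remains is compared with the
    mass by sending [m] to its integer half, each value being hit twice. No comparison with an
    integral occurs, so the bound is uniform in mesh and range. *)
Lemma gauss_second_moment N :
  \sum_k grid_point k ^+ 2 * gauss (@grid_point N k) <= 8 / b * grid_mass N.
Proof.
pose h (y : R) := expR (- (b * y / 2)).
have yh y : 0 <= y -> y * expR (- (b * y)) <= 2 / b * h y.
  move=> y0; have -> : expR (- (b * y)) = h y * h y by rewrite /h -expRD; congr expR; lra.
  rewrite mulrA ler_wpM2r ?expR_ge0// /h expRN ler_pdivrMr ?expR_gt0//.
  rewrite mulrAC ler_pdivlMr//.
  have := expR_ge1Dx (b * y / 2); lra.
apply: le_trans (_ : \sum_k 2 / b * h (@grid_point N k ^+ 2) <= _).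
  by apply: ler_sum => k _; apply: yh; exact: sqr_ge0.
rewrite -mulr_sumr (grid_sum N h).
have -> : 8 / b = 2 / b * 4 by lra.
rewrite -[leRHS]mulrA ler_wpM2l ?divr_ge0 ?(ltW b_gt0)//.
have h0 y : 0 <= h y by exact: expR_ge0.
have g0 m : 0 <= g m by exact: expR_ge0.
have hg m : h ((m%:R / D%:R) ^+ 2) <= g (m./2).
  rewrite /h /g /gauss ler_expR lerN2 -mulrA ler_wpM2l ?(ltW b_gt0)//.
  rewrite ler_pdivlMr// !expr_div_n mulrAC ler_wpM2r ?invr_ge0 ?sqr_ge0//.
  rewrite -natrX -natrM -natrX ler_nat.
  rewrite -{2}(odd_double_half m); case: (odd m) => /=; nia.
have H : \sum_(m < N.+1) h ((m%:R / D%:R) ^+ 2) <= 2 * \sum_(m < N.+1) g m.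
  apply: le_trans (_ : \sum_(m < N.+1) g (m./2) <= _); first by apply: ler_sum.
  rewrite -sum_half -!(big_mkord xpredT (fun m => g (m./2))).
  rewrite [leRHS](big_cat_nat (n := N.+1))//=; last by rewrite -addnn leq_addr.
  by rewrite lerDl sumr_ge0.
have H1 : \sum_(m < N) h ((m.+1%:R / D%:R) ^+ 2) <= \sum_(m < N.+1) h ((m%:R / D%:R) ^+ 2).
  by rewrite [leRHS]big_ord_recl lerDr.
apply: le_trans (_ : 4 * \sum_(m < N.+1) g m <= _); first by lra.
by rewrite ler_wpM2l// grid_massE lerDr sumr_ge0.
Qed.

Lemma grid_mass_extend L K : grid_mass (L + K) <= grid_mass L + 2 * K%:R * g L.
Proof.
have gL m : (L <= m)%N -> g m <= g L.
  move=> Lm; rewrite /g /gauss ler_expR lerN2 ler_wpM2l ?(ltW b_gt0)//.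
  by rewrite ler_sqr ?nnegrE ?divr_ge0// ler_wpM2r ?invr_ge0// ler_nat.
elim: K => [|K IH]; first by rewrite addn0 mulr0 mul0r addr0.
have -> : grid_mass (L + K.+1) = grid_mass (L + K) + 2 * g (L + K).+1.
  by rewrite !grid_massE addnS big_ord_recr/= [\sum_(m < (L + K).+2) _]big_ord_recr/=; ring.
have := gL (L + K).+1 (leq_trans (leq_addr K L) (leqnSn _)).
rewrite -[K.+1%:R]natr1; lra.
Qed.

(** Shifting the noise enlarges the box by [K] steps; far enough out the added mass is negligible,
    because the tail terms vanish while the mass stays above 1. *)
Lemma grid_mass_ratio (e : R) K : 0 < e -> exists L, grid_mass (L + K) <= (1 + e) * grid_mass L.
Proof.
move=> e0; pose c := b / D%:R ^+ 2.
have c0 : 0 < c by rewrite divr_gt0// exprn_gt0.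
pose y := 2 * K%:R / e / c; have y0 : 0 <= y.
  by apply: divr_ge0 (ltW c0); apply: divr_ge0 (ltW e0); exact: mulr_ge0.
exists (Num.truncn y).+1; set L := _.+1.
apply: le_trans (grid_mass_extend L K) _; rewrite [leRHS]mulrDl mul1r lerD2l.
apply: le_trans (_ : e * 1 <= _); last by rewrite ler_wpM2l ?grid_mass_ge1// ltW.
have yL : y < L%:R by have /andP[] := truncn_itv y0.
have L1 : 1 <= L%:R :> R by rewrite ler1n.
have LL : y <= L%:R ^+ 2.
  by apply: le_trans (ltW yL) _; rewrite expr2 ler_peMr.
rewrite mulr1 /g /gauss expRN ler_pdivrMr ?expR_gt0// [leRHS]mulrC -ler_pdivrMr//.
apply: le_trans (expR_ge1Dx _).
have -> : b * (L%:R / D%:R) ^+ 2 = c * L%:R ^+ 2 by rewrite expr_div_n /c; ring.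
apply: le_trans (_ : c * y <= _); last first.
  by apply: le_trans (ler_wpM2l (ltW c0) LL) _; rewrite lerDr.
by rewrite /y [leRHS]mulrC divfK// gt_eqF.
Qed.

Context (d : nat).

Definition lattice N : seq 'cV[R]_d :=
  [seq \col_i grid_point (t i) | t : {ffun 'I_d -> 'I_(N.*2.+1)}].

Lemma latticeP N (x : 'cV[R]_d) :
  reflect (forall i, exists k : 'I_(N.*2.+1), x i 0 = grid_point k) (x \in lattice N).
Proof.
apply: (iffP idP) => [/mapP[t _ ->] i|h]; first by exists (t i); rewrite mxE.
have /fin_all_exists [t xt] := h.
by apply/mapP; exists [ffun i => t i]; rewrite ?mem_enum//; apply/colP => i; rewrite mxE ffunE xt.
Qed.

Lemma lattice_uniq N : uniq (lattice N).
Proof.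
rewrite map_inj_uniq ?enum_uniq// => t u /colP tu; apply/ffunP => i.
by have := tu i; rewrite !mxE => /grid_point_inj.
Qed.

Lemma latticeD N K x y : x \in lattice N -> y \in lattice K -> x + y \in lattice (N + K).
Proof.
move=> /latticeP hx /latticeP hy; apply/latticeP => i.
have [k kx] := hx i; have [l ly] := hy i.
have kl : (k + l < (N + K).*2.+1)%N.
  rewrite ltnS doubleD leq_add// -ltnS ltn_ord//.
exists (Ordinal kl); rewrite mxE kx ly /grid_point /= !natrD -mulrDl; congr (_ / _); ring.
Qed.

Lemma latticeN N x : x \in lattice N -> - x \in lattice N.
Proof.
by move=> /latticeP hx; apply/latticeP => i; have [k kx] := hx i; exists (rev_ord k); rewrite mxE kx grid_point_rev.
Qed.

Lemma lattice_sum_prod N (F : 'I_d -> R -> R) :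
  \sum_(x <- lattice N) \prod_i F i (x i 0) = \prod_i \sum_k F i (@grid_point N k).
Proof.
rewrite big_map big_enum/= bigA_distr_bigA/=; apply: eq_bigr => t _.
by apply: eq_bigr => i _; rewrite mxE.
Qed.

Definition weight (x : 'cV[R]_d) : R := expR (- (b * dot x x)).

Lemma weight_prod x : weight x = \prod_i gauss (x i 0).
Proof. by rewrite /weight dotE mulr_sumr -sumrN expR_sum. Qed.

Definition lattice_mass N := \sum_(x <- lattice N) weight x.

Lemma lattice_massE N : lattice_mass N = grid_mass N ^+ d.
Proof.
rewrite /lattice_mass; under eq_bigr do rewrite weight_prod.
by rewrite (lattice_sum_prod N (fun=> gauss)) prodr_const card_ord.
Qed.

Lemma lattice_mass_gt0 N : 0 < lattice_mass N.
Proof. by rewrite lattice_massE exprn_gt0// (lt_le_trans ltr01)// grid_mass_ge1. Qed.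

Lemma lattice_cross N i j : i != j ->
  \sum_(x <- lattice N) x i 0 * x j 0 * weight x = 0.
Proof.
move=> ij; pose F l (z : R) := (if l == i then z else 1) * (if l == j then z else 1) * gauss z.
have FE (x : 'cV[R]_d) : x i 0 * x j 0 * weight x = \prod_l F l (x l 0).
  have pick (k : 'I_d) : \prod_l (if l == k then x l 0 else 1) = x k 0.
    by rewrite (bigD1 k)//= eqxx big1 ?mulr1// => l /negbTE ->.
  by rewrite big_split/= big_split/= !pick weight_prod.
under eq_bigr do rewrite FE.
rewrite lattice_sum_prod (bigD1 i)//= /F eqxx (negbTE ij).
under eq_bigr do rewrite mulr1.
by rewrite gauss_mean0 mul0r.
Qed.

Lemma lattice_square N i :
  \sum_(x <- lattice N) x i 0 * x i 0 * weight x <= 8 / b * lattice_mass N.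
Proof.
pose F l (z : R) := (if l == i then z ^+ 2 else 1) * gauss z.
have FE (x : 'cV[R]_d) : x i 0 * x i 0 * weight x = \prod_l F l (x l 0).
  have pick : \prod_l (if l == i then x l 0 ^+ 2 else 1) = x i 0 ^+ 2.
    by rewrite (bigD1 i)//= eqxx big1 ?mulr1// => l /negbTE ->.
  by rewrite big_split/= pick weight_prod expr2.
under eq_bigr do rewrite FE.
rewrite lattice_sum_prod (bigD1 i)//= lattice_massE.
have -> : \prod_(l < d | l != i) \sum_k F l (@grid_point N k) = grid_mass N ^+ #|predC1 i|.
  rewrite -prodr_const; apply: eq_bigr => l /negbTE li.
  by apply: eq_bigr => k _; rewrite /F li mul1r.
under eq_bigr do rewrite /F eqxx.
have -> : grid_mass N ^+ d = grid_mass N * grid_mass N ^+ #|predC1 i|.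
  by rewrite -exprS cardC1 card_ord prednK// (leq_ltn_trans _ (ltn_ord i)).
rewrite mulrA ler_wpM2r ?exprn_ge0 ?(le_trans ler01 (grid_mass_ge1 N))//.
exact: gauss_second_moment.
Qed.

End grid.

(** * Lattice points as a net of the unit ball *)

Section lattice_net.
Context {R : realType} (d D : nat).
Hypothesis D_large : (4 * d < D)%N.

Let D_gt0 : (0 < D)%N := leq_ltn_trans (leq0n _) D_large.
Let D_gt0R : 0 < D%:R :> R. Proof. by rewrite ltr0n. Qed.

(** Rounding each coordinate towards zero keeps the point in the unit ball; the error is at most
    [d / D], whence [4 * d < D]. *)
Lemma lattice_round (v : 'cV[R]_d) : norm2 v <= 1 ->
  exists x : 'cV[R]_d, [/\ x \in lattice D d D, norm2 x <= 1 & norm2 (v - x) <= 4^-1].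
Proof.
move=> v1; have vi i : `|v i 0| <= 1.
  apply: le_trans v1; rewrite -ler_sqr ?nnegrE ?norm2_ge0// real_normK ?num_real//.
  rewrite norm2_sqr dotE (bigD1 i)//= expr2 lerDl sumr_ge0// => j _.
  by rewrite -expr2 sqr_ge0.
pose z i := Num.truncn (D%:R * `|v i 0|).
have zP i : (z i)%:R <= D%:R * `|v i 0| < (z i).+1%:R.
  by apply: truncn_itv; rewrite mulr_ge0.
have zD i : (z i <= D)%N.
  rewrite -(ler_nat R); have /andP[h _] := zP i; apply: le_trans h _.
  by rewrite ler_piMr.
have kD i : ((if (v i 0 < 0)%R then D - z i else D + z i) < D.*2.+1)%N.
  by have := zD i; case: ifP => _; rewrite -addnn; lia.
pose x : 'cV[R]_d := \col_i grid_point D (Ordinal (kD i)).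
have xE i : x i 0 = if v i 0 < 0 then - ((z i)%:R / D%:R) else (z i)%:R / D%:R.
  rewrite mxE /grid_point /=; case: ifP => _.
    by rewrite natrB// addrAC subrr add0r mulNr.
  by rewrite natrD addrAC subrr add0r.
have zd i : (z i)%:R / D%:R <= `|v i 0|.
  by rewrite ler_pdivrMr// mulrC; have /andP[] := zP i.
have zd0 i : 0 <= (z i)%:R / D%:R :> R by rewrite divr_ge0.
have dz i : `|v i 0| - (z i)%:R / D%:R <= D%:R^-1.
  rewrite lerBlDr -[X in X + _]mul1r -mulrDl ler_pdivlMr// mulrC.
  by have /andP[_ /ltW] := zP i; rewrite -natr1 addrC.
exists x; split.
- by apply/latticeP => i; exists (Ordinal (kD i)); rewrite mxE.
- apply: le_trans v1; rewrite norm2_ler !dotE; apply: ler_sum => i _.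
  rewrite -!expr2 -[leRHS]real_normK ?num_real// -[leLHS]real_normK ?num_real//.
  rewrite ler_sqr ?nnegrE// xE; by case: ifP => _; rewrite ?normrN (ger0_norm (zd0 i)).
apply: (@le_trans _ _ (d%:R * D%:R^-1)).
  apply: norm2_le_entries => [|i]; first by rewrite invr_ge0.
  rewrite mxE [(- x) i 0]mxE xE.
  have := dz i; have := zd i; case: ltrP => vi0.
    rewrite (ltr0_norm vi0) opprK => h1 h2; rewrite ler0_norm; lra.
  by rewrite (ger0_norm vi0) => h1 h2; rewrite ger0_norm// subr_ge0.
rewrite ler_pdivrMr// mulrC ler_pdivlMr// -natrM ler_nat mulnC.
exact: ltnW.
Qed.

(** Rounding both arguments of the bilinear form costs [K / 4] each, so [K <= t + K / 2]. *)
Lemma spectral_norm_lattice (M : 'M[R]_d) (t : R) :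
  (forall x y, x \in lattice D d D -> y \in lattice D d D -> norm2 x <= 1 -> norm2 y <= 1 ->
    dot x (M *m y) <= t) -> spectral_norm M <= 2 * t.
Proof.
move=> h; set K := spectral_norm M; have K0 : 0 <= K := spectral_norm_ge0 M.
have t0 : 0 <= t.
  have [|x [xL x1 _]] := @lattice_round 0; first by rewrite norm2_0.
  have := h (- x) x (latticeN D_gt0 xL) xL; have := h x x xL xL x1 x1.
  rewrite norm2N dotNl => h1 /(_ x1 x1); lra.
suff : K <= t + K / 2 by lra.
apply: ge_sup; first exact: (spectral_norm_has_sup M).1.
move=> _ [v /= v1 <-].
have [Mv0|Mv0] := eqVneq (M *m v) 0; first by rewrite Mv0 norm2_0 addr_ge0// divr_ge0.
rewrite -norm2_gt0 in Mv0.
pose u := (norm2 (M *m v))^-1 *: (M *m v).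
have u1 : norm2 u <= 1 by rewrite norm2Z ger0_norm ?invr_ge0 ?(ltW Mv0)// mulVf// gt_eqF.
have uMv : dot u (M *m v) = norm2 (M *m v).
  by rewrite dotZl -norm2_sqr expr2 mulrA mulVf ?mul1r// gt_eqF.
have [x [xL x1 ux]] := lattice_round u1; have [y [yL y1 vy]] := lattice_round v1.
have bound p r : norm2 p * norm2 r <= 4^-1 -> dot p (M *m r) <= K / 4.
  move=> pr; apply: le_trans (dot_le_norm2 _ _) _.
  apply: le_trans (ler_wpM2l (norm2_ge0 p) (spectral_normP M r)) _.
  by rewrite mulrCA ler_wpM2l.
have := bound (u - x) v; have := bound x (v - y); have := h x y xL yL x1 y1.
rewrite -uMv mulmxBr dotBr dotBl => h1 h2 h3.
have {}h2 := h2 (_ : norm2 x * norm2 (v - y) <= 4^-1).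
have {}h3 := h3 (_ : norm2 (u - x) * norm2 v <= 4^-1).
have e2 : norm2 x * norm2 (v - y) <= 4^-1.
  by rewrite -[4^-1]mul1r; apply: ler_pM; rewrite ?norm2_ge0.
have e3 : norm2 (u - x) * norm2 v <= 4^-1.
  by rewrite -[4^-1]mulr1; apply: ler_pM; rewrite ?norm2_ge0.
have := h2 e2; have := h3 e3; lra.
Qed.

End lattice_net.

(** * Averaging over truncated lattice noise *)

Section gibbs.
Context {R : realType} (n d D : nat) (A : 'M[R]_(n, d)) (a b : R).
Hypotheses (D_gt0 : (0 < D)%N) (a_gt0 : 0 < a) (b_gt0 : 0 < b).
Hypothesis A_le : forall x, norm2 (A *m x) <= a * norm2 x.
Hypothesis b_large : 16 * frobenius A ^+ 2 <= b * a ^+ 2.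
Context (L : nat).

(** Truncated at [a], so that adding a lattice point of the unit ball stays in [bounded_lattice],
    with its doubled radius and larger box. *)
Definition small_noise : seq 'cV[R]_d := [seq x <- lattice D d L | norm2 (A *m x) <= a].
Definition bounded_lattice : seq 'cV[R]_d :=
  [seq x <- lattice D d (L + D) | norm2 (A *m x) <= 2 * a].
Definition noise_mass := \sum_(x <- small_noise) weight b x.

Lemma lattice_image_moment :
  \sum_(x <- lattice D d L) dot (A *m x) (A *m x) * weight b x <=
  8 / b * frobenius A ^+ 2 * lattice_mass D b d L.
Proof.
have E (x : 'cV[R]_d) : dot (A *m x) (A *m x) * weight b x =
    \sum_l \sum_i \sum_j A l i * A l j * (x i 0 * x j 0 * weight b x).
  rewrite dotE mulr_suml; apply: eq_bigr => l _; rewrite !mxE mulr_suml mulr_suml.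
  apply: eq_bigr => i _; rewrite mulr_sumr mulr_suml; apply: eq_bigr => j _; ring.
under eq_bigr do rewrite E.
rewrite exchange_big/= frobenius_sqr mulrAC mulr_sumr; apply: ler_sum => l _.
rewrite exchange_big/= mulr_sumr; apply: ler_sum => i _.
rewrite exchange_big/= (bigD1 i)//= [X in _ + X]big1 ?addr0; last first.
  by move=> j ji; rewrite -mulr_sumr lattice_cross ?mulr0// eq_sym.
by rewrite -mulr_sumr -expr2 mulrC ler_wpM2r ?sqr_ge0// lattice_square.
Qed.

(** Under the lattice weight the mean of [|A x|^2] is at most [8 / b * |A|_F^2 <= a^2 / 2], so by
    Markov's inequality truncation keeps at least half of the mass. *)
Lemma noise_mass_ge : lattice_mass D b d L <= 2 * noise_mass.
Proof.
have a2 : 0 < a ^+ 2 by rewrite exprn_gt0.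
have split_mass : lattice_mass D b d L = noise_mass +
    \sum_(x <- lattice D d L | ~~ (norm2 (A *m x) <= a)) weight b x.
  by rewrite /lattice_mass (bigID (fun x => norm2 (A *m x) <= a))/= /noise_mass big_filter.
have m0 : 0 <= lattice_mass D b d L by exact: ltW (lattice_mass_gt0 _ _ _ _).
suff : \sum_(x <- lattice D d L | ~~ (norm2 (A *m x) <= a)) weight b x <=
    lattice_mass D b d L / 2 by lra.
apply: le_trans (_ : \sum_(x <- lattice D d L) dot (A *m x) (A *m x) * weight b x / a ^+ 2 <= _).
  rewrite big_mkcond/=; apply: ler_sum => x _; case: ifP => [|_].
    rewrite -ltNge => h; rewrite ler_pdivlMr// mulrC ler_wpM2r ?expR_ge0//.
    by rewrite -norm2_sqr ler_sqr ?nnegrE ?norm2_ge0 ?(ltW a_gt0)// ltW.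
  by rewrite divr_ge0 ?sqr_ge0// mulr_ge0 ?dot_ge0 ?expR_ge0.
rewrite -mulr_suml ler_pdivrMr//; apply: le_trans lattice_image_moment _.
have h : 8 / b * frobenius A ^+ 2 <= a ^+ 2 / 2.
  by rewrite mulrAC ler_pdivrMr//; have := b_large; lra.
by apply: le_trans (ler_wpM2r m0 h) _; lra.
Qed.

Lemma noise_mass_gt0 : 0 < noise_mass.
Proof. by have := noise_mass_ge; have := lattice_mass_gt0 D b d L; lra. Qed.

Lemma small_noiseN x : x \in small_noise -> - x \in small_noise.
Proof.
by rewrite !mem_filter => /andP[xa xL]; rewrite mulmxN norm2N xa latticeN.
Qed.

(** The truncation is symmetric, so the conditioned noise is still centred. *)
Lemma noise_mean0 v : \sum_(g <- small_noise) weight b g * dot g v = 0.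
Proof.
set S := \sum_(g <- _) _; suff : S = - S by move=> h; lra.
have uN : uniq small_noise by rewrite filter_uniq// lattice_uniq.
rewrite {1}/S (perm_big [seq - g | g <- small_noise])/=.
  rewrite big_map -sumrN; apply: eq_bigr => g _.
  by rewrite /weight !dotNl !dotNr opprK mulrN.
apply: uniq_perm => //; first by rewrite map_inj_uniq//; exact: oppr_inj.
move=> x; apply/idP/mapP => [xN|[y yN ->]]; last exact: small_noiseN.
by exists (- x); rewrite ?opprK// small_noiseN.
Qed.

(* The noise x + g has mean x, and its density relative to the prior weight is
   exp (b (2 x.g + |x|^2)), whose logarithm has mean b |x|^2 by symmetry. *)
Lemma gibbs_shift (x v : 'cV[R]_d) : x \in lattice D d D -> norm2 x <= 1 ->
  expR (dot x v) <=
  expR b / noise_mass * \sum_(y <- bounded_lattice) weight b y * expR (dot y v).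
Proof.
move=> xL x1; have Z0 := noise_mass_gt0.
have xx1 : dot x x <= 1 by rewrite -norm2_sqr expr_le1 ?norm2_ge0.
pose p (g : 'cV[R]_d) := weight b g / noise_mass.
pose f (g : 'cV[R]_d) := dot (x + g) v - b * (2 * dot x g + dot x x).
have p0 g : 0 <= p g by rewrite divr_ge0 ?expR_ge0// ltW.
have p1 : \sum_(g <- small_noise) p g = 1 by rewrite -mulr_suml mulfV// gt_eqF.
have pf : \sum_(g <- small_noise) p g * f g = dot x v - b * dot x x.
  have pm w : \sum_(g <- small_noise) p g * dot g w = 0.
    rewrite (eq_bigr (fun g => noise_mass^-1 * (weight b g * dot g w))).
      by rewrite -mulr_sumr noise_mean0 mulr0.
    by move=> g _; rewrite /p; ring.
  rewrite (eq_bigr (fun g => p g * (dot x v - b * dot x x) + p g * dot g v + (- (2 * b)) * (p g * dot g x))).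
    by rewrite !big_split/= -mulr_suml p1 -mulr_sumr !pm; ring.
  by move=> g _; rewrite /f dotDl [dot x g]dotC; ring.
have := jensen_expR f p0 p1; rewrite pf.
have E g : p g * expR (f g) = noise_mass^-1 * (weight b (x + g) * expR (dot (x + g) v)).
  rewrite /p mulrAC [LHS]mulrC; congr (_ * _); rewrite -!expRD; congr expR.
  by rewrite /f !dotDl !dotDr [dot g x]dotC; ring.
rewrite (eq_bigr _ (fun g _ => E g)) -mulr_sumr => J.
have -> : dot x v = b * dot x x + (dot x v - b * dot x x) by ring.
rewrite expRD -mulrA; apply: ler_pM; rewrite ?expR_ge0//.
  by rewrite ler_expR ler_piMr// ltW.
apply: le_trans J _; rewrite ler_wpM2l ?invr_ge0 ?(ltW Z0)//.
rewrite -(big_map (+%R x) xpredT (fun y => weight b y * expR (dot y v))).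
apply: ler_sum_subseq.
- by rewrite map_inj_uniq ?filter_uniq ?lattice_uniq//; exact: addrI.
- by rewrite filter_uniq ?lattice_uniq.
- move=> _ /mapP[g + ->]; rewrite !mem_filter => /andP[ga gL].
  rewrite [x + g]addrC latticeD// andbT mulmxDr (le_trans (norm2D _ _))//.
  have : norm2 (A *m x) <= a by rewrite (le_trans (A_le x))// ler_piMr// ltW.
  lra.
- by move=> y; rewrite mulr_ge0 ?expR_ge0.
Qed.

(** The shift is applied to [x] against [M y], and then to [y] against [M^T p] for each perturbed
    [p]. *)
Lemma gibbs_bilinear (M : 'M[R]_d) x y :
  x \in lattice D d D -> norm2 x <= 1 -> y \in lattice D d D -> norm2 y <= 1 ->
  expR (dot x (M *m y)) <= expR (2 * b) / noise_mass ^+ 2 *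
    \sum_(p <- bounded_lattice) \sum_(q <- bounded_lattice)
      weight b p * weight b q * expR (dot p (M *m q)).
Proof.
move=> xL x1 yL y1; have Z0 := noise_mass_gt0.
apply: le_trans (gibbs_shift (M *m y) xL x1) _.
have -> : expR (2 * b) / noise_mass ^+ 2 = expR b / noise_mass * (expR b / noise_mass).
  have -> : 2 * b = b + b by ring.
  by rewrite expRD expr2 invfM mulrACA.
have : 0 <= expR b / noise_mass by rewrite divr_ge0 ?expR_ge0// ltW.
have := gibbs_shift _ yL y1; move: (expR b / noise_mass) => c shift c0.
rewrite -[leRHS]mulrA ler_wpM2l// mulr_sumr; apply: ler_sum => p _.
have E q : dot p (M *m q) = dot q (M^T *m p) by rewrite -dot_mull dotC.
under eq_bigr do rewrite E -mulrA.
by rewrite E -mulr_sumr mulrCA ler_wpM2l ?expR_ge0.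
Qed.

End gibbs.

(** * Subgaussian maps *)

Section subgaussian_deviation.
Context {R : realType} d0 (T : measurableType d0) (P : probability T R).
Context (s n d : nat) (S : random_matrix P s n) (Y : 'I_s * 'I_n -> {RV P >-> R}) (K : R).
Hypotheses (Y_indep : mutually_independent Y) (K_gt0 : 0 < K).
Hypothesis Y_mean : forall ij, has_mean P (Y ij) 0.
Hypothesis Y_var : forall ij, has_mean P (fun w => Y ij w * Y ij w) 1.
Hypothesis Y_tail : forall ij, subgaussian_tail P (Y ij) K.
Hypothesis SE : forall i j w, S i j w = (Num.sqrt s%:R)^-1 * Y (i, j) w.
Hypothesis s_gt0 : (0 < s)%N.
Context (A : 'M[R]_(n, d)) (eps : R).
Hypotheses (A_neq0 : A != 0) (eps_gt0 : 0 < eps) (eps_le1 : eps <= 1).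

Let a := spectral_norm A.
Let a_gt0 : 0 < a := spectral_norm_gt0 A_neq0.
Let s_gt0R : 0 < s%:R :> R. Proof. by rewrite ltr0n. Qed.

Definition gram_diff w := A^T *m (mx_at S w)^T *m mx_at S w *m A - A^T *m A.

Lemma gram_diff_row_error p q w :
  s%:R * dot p (gram_diff w *m q) = \sum_l row_error Y l (A *m p) (A *m q) w.
Proof.
rewrite /gram_diff mulmxBl dotBr -!mulmxA -!dot_mull.
rewrite sumrB sumr_const card_ord mulrBr; congr (_ - _); last by rewrite mulr_natl.
rewrite dotE mulr_sumr; apply: eq_bigr => l _.
have E (v : 'cV[R]_n) : (mx_at S w *m v) l 0 = (Num.sqrt s%:R)^-1 * row_form Y l v w.
  rewrite mxE mulr_sumr; apply: eq_bigr => i _; rewrite mxE SE; ring.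
rewrite !E.
have sq : Num.sqrt s%:R ^+ 2 = s%:R :> R by rewrite sqr_sqrtr// ltW.
have sq0 : Num.sqrt s%:R != 0 :> R by rewrite gt_eqF// sqrtr_gt0.
by move: (Num.sqrt s%:R) sq sq0 => r <- r0; field.
Qed.

(** The first bound keeps [lam * (2 a)^2 = 4 k eps] within half of [error_scale]; the second makes
    the quadratic cost [C (4 k eps)^2 s] at most half of the linear gain [k eps^2 s / 4]. *)
Definition deviation_rate : R :=
  Num.min (error_scale K / 8) (128 * error_constant K)^-1.

Lemma deviation_rate_gt0 : 0 < deviation_rate.
Proof.
rewrite /deviation_rate lt_min divr_gt0 ?error_scale_gt0//= invr_gt0 mulr_gt0//.
exact: error_constant_gt0.
Qed.

(** The bad event lies in a level set of the single variable [W], a weighted sum of exponentials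
    over all pairs of lattice points. Markov's inequality is used once, and the lattice costs only
    its mass relative to [Z]. *)
Lemma gram_diff_deviation :
  (P [set w | (eps * a ^+ 2 <= spectral_norm (gram_diff w))%R] <=
   (expR (4 + 32 * stable_rank A - deviation_rate * eps ^+ 2 * s%:R / 8))%:E)%E.
Proof.
have k0 := deviation_rate_gt0; set k := deviation_rate in k0 *.
have kscale : 8 * k <= error_scale K.
  have : k <= error_scale K / 8 by rewrite /k /deviation_rate ge_min lexx.
  lra.
have C0 := error_constant_gt0 K_gt0.
have kconst : 128 * error_constant K * k <= 1.
  have C128 : 0 < 128 * error_constant K by rewrite mulr_gt0.
  have : k <= (128 * error_constant K)^-1 by rewrite /k /deviation_rate ge_min lexx orbT.
  by move=> /(ler_wpM2l (ltW C128)); rewrite mulfV ?gt_eqF.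
(* Turns the requirement on [b] into an equality; the two shifts then cost [expR (2 b)], the source
   of [32 * stable_rank A]. *)
pose b := 16 * stable_rank A.
have b0 : 0 < b by rewrite mulr_gt0// (lt_le_trans ltr01)// stable_rank_ge1.
have bE : 16 * frobenius A ^+ 2 <= b * a ^+ 2.
  by rewrite /b /stable_rank -mulrA divfK// expf_neq0// gt_eqF.
pose D := (4 * d).+1; have D0 : (0 < D)%N by [].
have A_le x : norm2 (A *m x) <= a * norm2 x by exact: spectral_normP.
(* A ratio of [1 + 1/(d+1)] per coordinate, so that [d] coordinates together cost at most
   [expR 1]. *)
have e0 : 0 < d.+1%:R^-1 :> R by rewrite invr_gt0.
have [L massL] := grid_mass_ratio D0 b0 D e0.
pose Z := noise_mass D A a b L.
have Z0 : 0 < Z by apply: noise_mass_gt0.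
have mass_ratio : lattice_mass D b d (L + D) <= 2 * expR 1 * Z.
  have h : lattice_mass D b d (L + D) <= expR 1 * lattice_mass D b d L.
    rewrite !lattice_massE.
    have m0 N : 0 <= grid_mass D b N by rewrite (le_trans ler01)// grid_mass_ge1.
    apply: le_trans (_ : ((1 + d.+1%:R^-1) * grid_mass D b L) ^+ d <= _).
      by rewrite lerXn2r ?nnegrE ?mulr_ge0 ?addr_ge0 ?(ltW e0).
    rewrite exprMn ler_wpM2r ?exprn_ge0//.
    apply: le_trans (_ : expR d.+1%:R^-1 ^+ d <= _).
      by rewrite lerXn2r ?nnegrE ?addr_ge0 ?expR_ge0 ?(ltW e0)// expR_ge1Dx.
    by rewrite -expRM_natr ler_expR mulrC ler_pdivrMr// mul1r ler_nat.
  apply: le_trans h _; rewrite -mulrA mulrCA ler_wpM2l ?expR_ge0//.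
  exact: noise_mass_ge.
pose lam := k * eps / a ^+ 2.
have a2 : 0 < a ^+ 2 by rewrite exprn_gt0.
have lam0 : 0 < lam by rewrite divr_gt0// mulr_gt0.
have lam_rho : lam * (2 * a) ^+ 2 = 4 * k * eps by rewrite /lam; field; rewrite gt_eqF.
pose B := bounded_lattice D A a L.
pose F p q w := weight b p * weight b q * expR (lam * \sum_l row_error Y l (A *m p) (A *m q) w).
pose E1 := expR (error_constant K * (lam * (2 * a) ^+ 2) ^+ 2 * s%:R).
have mF p q : measurable_fun setT (F p q).
  apply: measurable_funM => //; apply: measurableT_comp => //; apply: measurable_funM => //.
  apply: measurable_sum => l; apply: measurable_funB => //.
  by apply: measurable_funM; exact: measurable_row_form.
have F0 p q w : 0 <= F p q w by rewrite !mulr_ge0 ?expR_ge0.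
have meanF p q : p \in B -> q \in B -> mean_le P (F p q) (weight b p * weight b q * E1).
  rewrite !mem_filter => /andP[pa _] /andP[qa _].
  apply: mean_leZ; first by rewrite mulr_ge0 ?expR_ge0.
  apply: quadratic_form_mgf => //; first by rewrite mulr_gt0.
  - by rewrite -norm2_le// mulr_ge0// ltW.
  - by rewrite -norm2_le// mulr_ge0// ltW.
  rewrite (gtr0_norm lam0) lam_rho ler_pdivlMr//.
  apply: le_trans kscale; rewrite mulrAC -mulrA.
  by have := ler_wpM2l (ltW k0) eps_le1; lra.
pose W w := \sum_(p <- B) \sum_(q <- B) F p q w.
have W0 w : 0 <= W w by apply: sumr_ge0 => p _; apply: sumr_ge0 => q _.
have mW : measurable_fun setT W by apply: measurable_sum => p; exact: measurable_sum.
have meanW : mean_le P W ((2 * expR 1 * Z) ^+ 2 * E1).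
  apply: mean_le_trans (_ : mean_le P W (\sum_(p <- B) \sum_(q <- B) weight b p * weight b q * E1)) _.
    by apply: mean_le_sum => p pB; apply: mean_le_sum => q qB; exact: meanF.
  have -> : \sum_(p <- B) \sum_(q <- B) weight b p * weight b q * E1 =
      (\sum_(p <- B) weight b p) ^+ 2 * E1.
    rewrite expr2 !mulr_suml; apply: eq_bigr => p _; rewrite mulr_sumr mulr_suml.
    by [].
  rewrite ler_wpM2r ?expR_ge0// lerXn2r ?nnegrE ?mulr_ge0 ?expR_ge0 ?(ltW Z0)//.
    by apply: sumr_ge0 => p _; exact: expR_ge0.
  apply: le_trans mass_ratio; apply: ler_sum_subseq.
  - by rewrite filter_uniq ?lattice_uniq.
  - exact: lattice_uniq.
  - by move=> p; rewrite mem_filter => /andP[].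
  - by move=> p; exact: expR_ge0.
(* [2 * t] is strictly below the bad level, so a bad outcome has a pair of lattice points whose form
   exceeds [t]. *)
pose t := eps * a ^+ 2 / 4.
have t0 : 0 < t by rewrite divr_gt0// mulr_gt0.
pose thr := expR (lam * s%:R * t) / (expR (2 * b) / Z ^+ 2).
have c0 : 0 < expR (2 * b) / Z ^+ 2 by rewrite divr_gt0 ?expR_gt0// exprn_gt0.
have thr0 : 0 < thr by rewrite divr_gt0 ?expR_gt0.
apply: le_trans (_ : P [set w | (thr <= W w)%R] <= _)%E; last first.
  apply: le_trans (markov_mean_le mW W0 meanW thr0) _; rewrite lee_fin.
  have -> : (2 * expR 1 * Z) ^+ 2 * E1 / thr =
      4 * (expR 1 ^+ 2 * E1 * expR (2 * b) / expR (lam * s%:R * t)).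
    have gen (x z e u v : R) : z != 0 -> u != 0 -> v != 0 ->
        (2 * x * z) ^+ 2 * e / (v / (u / z ^+ 2)) = 4 * (x ^+ 2 * e * u / v).
      by move=> z0 u0 v0; field; rewrite ?z0 ?u0 ?v0.
    by apply: gen; rewrite gt_eqF ?expR_gt0.
  have e2 : 2 <= expR 1 :> R by rewrite (le_trans _ (expR_ge1Dx 1)).
  apply: le_trans (_ : expR 1 ^+ 2 * (expR 1 ^+ 2 * E1 * expR (2 * b) / expR (lam * s%:R * t)) <= _).
    rewrite ler_wpM2r ?divr_ge0 ?mulr_ge0 ?expR_ge0// ?exprn_ge0 ?expR_ge0//.
    by rewrite (_ : 4 = 2 ^+ 2) ?lerXn2r ?nnegrE ?expR_ge0// -natrX.
  rewrite /E1 -!expRM_natl -expRN -!expRD ler_expR lam_rho.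
  have -> : lam * s%:R * t = k * eps ^+ 2 * s%:R / 4 by rewrite /lam /t; field; rewrite gt_eqF.
  have h : error_constant K * (4 * k * eps) ^+ 2 * s%:R <= k * eps ^+ 2 * s%:R / 8.
    have := ler_wpM2r (_ : 0 <= k * eps ^+ 2 * s%:R) kconst.
    have -> : 0 <= k * eps ^+ 2 * s%:R by rewrite !mulr_ge0 ?sqr_ge0// ltW.
    by move=> /(_ isT); lra.
  rewrite /b; lra.
apply: le_measure; rewrite ?inE.
- by apply: measurable_spectral_norm_ge => i j; exact: measurable_gram_diff.
- rewrite (_ : [set _ | _] = W @^-1` `[thr, +oo[); last first.
    by apply/seteqP; split => w /=; rewrite in_itv/= andbT.
  by rewrite -[X in measurable X]setTI; exact: mW.
move=> w /= bad.
have [x [y [xL yL x1 y1 xy]]] : exists x y : 'cV[R]_d,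
    [/\ x \in lattice D d D, y \in lattice D d D, norm2 x <= 1, norm2 y <= 1 &
      t < dot x (gram_diff w *m y)].
  apply: contrapT => none; have : spectral_norm (gram_diff w) <= 2 * t.
    apply: (@spectral_norm_lattice _ _ D); first exact: ltnSn.
    move=> x y xL yL x1 y1; rewrite leNgt; apply/negP => xy.
    by apply: none; exists x, y.
  move=> /(le_trans bad); rewrite leNgt => /negP; apply.
  by have : 0 < eps * a ^+ 2 by [exact: mulr_gt0]; rewrite /t; lra.
have := gibbs_bilinear D0 a_gt0 b0 A_le bE L ((lam * s%:R) *: gram_diff w) xL x1 yL y1.
rewrite -scalemxAl dotZr -/Z.
have -> : \sum_(p <- bounded_lattice D A a L) \sum_(q <- bounded_lattice D A a L)
    weight b p * weight b q * expR (dot p ((lam * s%:R) *: gram_diff w *m q)) = W w.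
  apply: eq_bigr => p _; apply: eq_bigr => q _; rewrite /F; congr (_ * expR _).
  by rewrite -scalemxAl dotZr -mulrA gram_diff_row_error.
move=> h; rewrite /thr ler_pdivrMr// [leRHS]mulrC; apply: le_trans h.
by rewrite ler_expR ler_wpM2l ?(ltW xy)// mulr_ge0// ltW.
Qed.

End subgaussian_deviation.

Section transfer.
Local Open Scope ereal_scope.
Context {R : realType} d (T : measurableType d) (P : probability T R)
  (Q : probability (measurableTypeR R) R) (X : {RV P >-> R}).
Hypothesis lawX : forall B : set R, measurable B -> P (X @^-1` B) = Q B.

Lemma has_mean_transfer (f : R -> R) v : measurable_fun setT f ->
  has_mean Q f v -> has_mean P (fun w => f (X w)) v.
Proof.
move=> mf [/integrableP[_ fi] fv].
(* Q lives on measurableTypeR R and X takes values in R: same sigma-algebra,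
   different displays. *)
have mX : measurable_fun setT (X : T -> measurableTypeR R).
  by move=> _ B mB; rewrite setTI; exact: (measurable_funPTI X).
have intE (g : R -> \bar R) :
    \int[pushforward P (X : T -> measurableTypeR R)]_y g y = \int[Q]_y g y.
  by apply: eq_measure_integral => B mB _; exact: lawX.
have mfX : measurable_fun setT (fun w => f (X w)) by apply: measurableT_comp.
have mfE : measurable_fun setT (fun y : measurableTypeR R => (f y)%:E).
  by apply/measurable_EFinP.
have intf : P.-integrable setT ((fun y => (f y)%:E) \o X).
  apply/integrableP; split; first exact/measurable_EFinP.
  have := @ge0_integral_pushforward _ _ _ _ _ _ mX P setT (fun y => `|(f y)%:E|).
  rewrite preimage_setT intE => <-//; exact: measurableT_comp.
split=> //; rewrite -fv -intE.
by rewrite integral_pushforward// ?preimage_setT.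
Qed.

End transfer.

Lemma subgaussian_gram {R : realType} (Q : probability (measurableTypeR R) R) :
  standard_subgaussian Q ->
  exists2 C : R, 0 < C &
    forall (n d : nat) (A : 'M[R]_(n, d)) (k : nat) (nu delta : R),
      (1 <= k <= \rank A)%N -> sigma A k.+1 < sigma A k ->
      0 < nu < 2^-1 -> 0 < delta < 2^-1 ->
    forall (dS : measure_display) (TS : measurableType dS)
      (PS : probability TS R) (s : nat) (S : random_matrix PS s n),
      iid_scaled_entries Q S ->
      C * ((stable_rank A + ln (delta^-1)) / (gap k A ^+ 2 * nu ^+ 2)) <= s%:R ->
      gram_property S A (sketch_accuracy A k nu) delta.
Proof.
move=> [Q0 Q1 [K K0 Qtail]].
have mid : measurable_fun setT (idfun : measurableTypeR R -> R).
  by move=> _ B mB; rewrite setTI.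
have [mean0 mean1] := standardized_moments mid Q0 Q1.
have rate0 := deviation_rate_gt0 K0; set rate := deviation_rate K in rate0.
(* 1152 is 4 times 288: as [stable_rank A >= 1], the exponent needs [rate * eps^2 * s / 8] above 36
   times the sum of stable rank and logarithm, and squaring [eps >= nu * gap / 2] costs 4. *)
have C0 : 0 < 1152 / rate by rewrite divr_gt0 ?ltr0n.
exists (1152 / rate) => //.
move=> n d A k nu delta kr gap_gt0 nu01 /andP[delta0 delta1] dS TS PS s S [Y [Yind Ylaw SE]] s_ge.
have A0 := rank_gt0_neq0 kr; have sr1 := stable_rank_ge1 A0.
have /andP[k0 _] := kr; have /andP[nu0 _] := nu01.
move: s_ge (sketch_accuracy_bounds k0 gap_gt0 nu01); rewrite /gram_property.
move: (sketch_accuracy A k nu) (gap k A) => eps g s_ge [g0 _ eps_ge eps1].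
have gnu0 : 0 < g ^+ 2 * nu ^+ 2 by rewrite mulr_gt0 ?exprn_gt0.
have ng0 : 0 < nu * g by exact: mulr_gt0.
have eps0 : 0 < eps by apply: lt_le_trans eps_ge; exact: divr_gt0.
have ln0 : 0 < ln (delta^-1).
  rewrite ln_gt0// invf_gt1//; apply: lt_trans delta1 _.
  by rewrite invf_lt1// ltr1n.
have s0 : (0 < s)%N.
  rewrite -(ltr0n R); apply: lt_le_trans s_ge.
  by apply: mulr_gt0 C0 _; rewrite divr_gt0// addr_gt0// (lt_le_trans ltr01).
have Ymean ij : has_mean PS (Y ij) 0.
  exact: (has_mean_transfer (Ylaw ij) (@measurable_id _ _ setT) mean0).
have Yvar ij : has_mean PS (fun w => Y ij w * Y ij w) 1.
  apply: (has_mean_transfer (Ylaw ij) (f := fun x => x * x) _ mean1).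
  exact: measurable_funM.
have Ytail ij : subgaussian_tail PS (Y ij) K.
  move=> t t0; apply: le_trans (Qtail t t0).
  have mB : measurable [set x : R | t <= `|x|].
    rewrite (_ : [set _ | _] = (fun x : R => `|x|) @^-1` `[t, +oo[); last first.
      by apply/seteqP; split => w /=; rewrite in_itv/= andbT.
    by rewrite -[X in measurable X]setTI; exact: normr_measurable.
  by rewrite -(Ylaw ij _ mB).
have := gram_diff_deviation Yind K0 Ymean Yvar Ytail SE s0 A0 eps0 eps1.
move=> /le_trans; apply; rewrite lee_fin.
rewrite -[leRHS]lnK ?posrE// ler_expR.
have lnV : ln delta^-1 = - ln delta by rewrite lnV ?posrE.
rewrite -/rate.
have h : (stable_rank A + ln delta^-1) * 288 <= rate * eps ^+ 2 * s%:R.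
  move: s_ge; rewrite mulrA ler_pdivrMr// mulrAC ler_pdivrMr// => s_ge.
  have eps2 : (nu * g / 2) ^+ 2 <= eps ^+ 2.
    by rewrite ler_sqr ?nnegrE ?(ltW eps0)//; apply: divr_ge0 => //; exact: ltW.
  have := ler_wpM2l (_ : 0 <= rate * s%:R) eps2.
  have -> : 0 <= rate * s%:R by rewrite mulr_ge0// ltW.
  move=> /(_ isT); lra.
lra.
Qed.

(* S and xi live on separate probability spaces, i.e. jointly on their product:
   S is independent of b = f + xi, and the expectations over xi inside
   excess_risk are taken with S held fixed. *)
Theorem theorem14 (R : realType) :
  [/\
   forall (n d : nat) (A : 'M[R]_(n, d)) (k : nat) (nu delta : R),
     (1 <= k <= \rank A)%N -> sigma A k.+1 < sigma A k ->
     0 < nu < 2^-1 -> 0 < delta < 2^-1 ->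
   forall (dS : measure_display) (TS : measurableType dS)
     (PS : probability TS R) (s : nat) (S : random_matrix PS s n)
     (dX : measure_display) (TX : measurableType dX) (PX : probability TX R)
     (f : 'cV[R]_n) (xi : 'I_n -> {RV PX >-> R}) (sd : R),
     white_noise xi sd ->
     gram_property S A (sketch_accuracy A k nu) delta ->
   forall U sv V, thin_svd A U sv V ->
   let b := response f xi in
   with_prob_ge PS (1 - delta) [set w | (k <= minn s d)%N /\
     forall U' sv' V', thin_svd (mx_at S w *m A) U' sv' V' ->
     let M := first_cols k V' in
     (forall w', approx_pcr A V k (b w') (sigma A k.+1 / sigma A k * nu)
        (nu / ((Num.sqrt (1 - nu ^+ 2) - nu) * sigma A k))
        (sketched_solution A M (b w'))) /\
     (excess_risk PX A b (fun w' => sketched_solution A M (b w')) <=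
      ((1 + nu) * norm2 (min_norm_optimum PX A b) ^+ 2 * sigma A k.+1 ^+ 2
         / n%:R + sd ^+ 2 * k%:R / n%:R)%:E)%E],
   exists2 C : R, 0 < C &
     forall (n d : nat) (A : 'M[R]_(n, d)) (k : nat) (nu delta : R),
       (1 <= k <= \rank A)%N -> sigma A k.+1 < sigma A k ->
       0 < nu < 2^-1 -> 0 < delta < 2^-1 ->
     forall (dS : measure_display) (TS : measurableType dS)
       (PS : probability TS R) (s : nat) (S : random_matrix PS s n),
       countsketch S ->
       C * (stable_rank A ^+ 2 / (gap k A ^+ 2 * nu ^+ 2 * delta)) <= s%:R ->
       gram_property S A (sketch_accuracy A k nu) delta
   &  forall Q : probability (measurableTypeR R) R, standard_subgaussian Q ->
   exists2 C : R, 0 < C &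
     forall (n d : nat) (A : 'M[R]_(n, d)) (k : nat) (nu delta : R),
       (1 <= k <= \rank A)%N -> sigma A k.+1 < sigma A k ->
       0 < nu < 2^-1 -> 0 < delta < 2^-1 ->
     forall (dS : measure_display) (TS : measurableType dS)
       (PS : probability TS R) (s : nat) (S : random_matrix PS s n),
       iid_scaled_entries Q S ->
       C * ((stable_rank A + ln (delta^-1)) / (gap k A ^+ 2 * nu ^+ 2))
         <= s%:R ->
       gram_property S A (sketch_accuracy A k nu) delta].
Proof.
split; [exact: left_sketching|exact: countsketch_gram|exact: subgaussian_gram].
Qed.
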